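(* There is a universal constant $C>0$ such that the following holds for every measurable space $(\Omega,\Sigma)$, every real Banach space $X$ and every countably additive vector measure $m:\Sigma\to X$ that is not identically zero. Consider the DFJP-LNO factorization $I_m=J\circ T$ of the integration operator $I_m:L_1(m)\to X$ through the Banach space $Y$ (with operators $T:L_1(m)\to Y$ and $J:Y\to X$), as defined in the context. Let $\tilde m:\Sigma\to Y$ be the countably additive vector measure defined by $\tilde m(A):=T(\chi_A)$ for all $A\in\Sigma$. Then: (i) $L_1(\tilde m)=L_1(m)$ with equal norms, i.e., $\|f\|_{L_1(m)}=\|f\|_{L_1(\tilde m)}$ for all $f\in L_1(m)$. In particular, $\|m\|(A)=\|\tilde m\|(A)$ for all $A\in\Sigma$. (ii) $$\|I_{\tilde m}(f)\|^2\leq C\,\|f\|_{L_1(m)}\,\|I_m(f)\|\quad\text{for every } f\in L_1(m).$$ In particular, $\|\tilde m(A)\|^2\leq C\,\|m\|(A)\,\|m(A)\|$ for all $A\in\Sigma$. (iii) $|m|(A)\leq|\tilde m|(A)\leq\sqrt{C}\,|m|(A)$ for all $A\in\Sigma$. Therefore, $\tilde m$ has finite (resp., $\sigma$-finite) variation whenever $m$ does. (iv) If $m$ has finite variation and a Bochner derivative $G$ with respect to $|m|$, then $\tilde m$ has a Bochner derivative $\tilde F$ with respect to $|\tilde m|$ and $$\int_\Omega\|\tilde F\|^2\,d|\tilde m|\leq C\int_\Omega\|G\|\,d|m|.$$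
   Context: Operators are continuous linear maps between Banach spaces; $B_Z$ is the closed unit ball of a Banach space $Z$. Vector measures. For a countably additive vector measure $\nu:\Sigma\to Z$ with values in a Banach space $Z$: $|\nu|$ is its variation (possibly infinite); for $z^*\in Z^*$, $z^*\nu$ is the composition and $|z^*\nu|$ its variation; $\|\nu\|(A):=\sup_{z^*\in B_{Z^*}}|z^*\nu|(A)$ is the semivariation. $\nu$ has finite variation if $|\nu|(\Omega)<\infty$, and $\sigma$-finite variation if $\Omega$ is a countable union of sets $A\in\Sigma$ with $|\nu|(A)<\infty$. A Bochner derivative of $\nu$ with respect to a non-negative finite measure $\mu$ on $\Sigma$ is a $\mu$-Bochner integrable function $h:\Omega\to Z$ with $\nu(A)=\int_A h\,d\mu$ for all $A\in\Sigma$. A $\Sigma$-measurable $f:\Omega\to\mathbb{R}$ is $\nu$-integrable if $\int_\Omega|f|\,d|z^*\nu|<\infty$ for all $z^*\in Z^*$ and for each $A\in\Sigma$ there is $\int_A f\,d\nu\in Z$ with $z^*(\int_A f\,d\nu)=\int_A f\,d(z^*\nu)$ for all $z^*\in Z^*$. $L_1(\nu)$ is the Banach space of $\nu$-integrable functions, identified when equal $\nu$-a.e. (i.e., outside a set $A\in\Sigma$ with $\|\nu\|(A)=0$), with norm $\|f\|_{L_1(\nu)}=\sup_{z^*\in B_{Z^*}}\int_\Omega|f|\,d|z^*\nu|$. The integration operator is $I_\nu:L_1(\nu)\to Z$, $I_\nu(f)=\int_\Omega f\,d\nu$; if $\nu$ is not identically zero, $\|I_\nu\|=1$. DFJP-LNO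 construction. For a closed absolutely convex set $K\subseteq B_X$ and $a\in(1,\infty)$, let $K_n:=a^nK+a^{-n}B_X$ ($n\in\mathbb{N}=\{1,2,\dots\}$), let $\|x\|_n:=\inf\{t>0:x\in tK_n\}$, and let $X_K:=\{x\in X:\sum_{n=1}^\infty\|x\|_n^2<\infty\}$, a Banach space with norm $\|x\|_K:=(\sum_{n=1}^\infty\|x\|_n^2)^{1/2}$. Let $J_K:X_K\to X$ be the identity (inclusion) map, which is an operator. Let $f(a):=\Big(\sum_{n=1}^\infty\big(\frac{a^n}{a^{2n}+1}\big)^2\Big)^{1/2}$ and let $\bar a$ be the unique element of $(1,\infty)$ with $f(\bar a)=1$. For a Banach space $Z$ and a non-zero operator $S:Z\to X$, take $K:=\frac{1}{\|S\|}\overline{S(B_Z)}$ and $a=\bar a$; then $S(Z)\subseteq X_K$, and $S=J_K\circ S_K$ where $S_K:Z\to X_K$, $S_K(z)=S(z)$, is an operator. This is the DFJP-LNO factorization of $S$. In the claim, $S=I_m$, $Z=L_1(m)$, $K=\overline{I_m(B_{L_1(m)})}$, $Y=X_K$, $T=S_K$, $J=J_K$. *)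

(* Defs.v *)
From HB Require Import structures.
From mathcomp Require Import all_boot all_order all_algebra.
From mathcomp Require Import all_classical all_reals all_analysis.
From mathcomp Require Import ring lra.
Set Implicit Arguments.
Unset Strict Implicit.
Unset Printing Implicit Defensive.
Import Order.TTheory GRing.Theory Num.Theory.
Import numFieldNormedType.Exports.
Local Open Scope classical_set_scope.
Local Open Scope ring_scope.

Section minkowski.
Context (R : realType) (X : normedModType R).
Implicit Types (D : set X) (x y : X).

Definition absolutely_convex D :=
  forall x y s t, D x -> D y -> `|s| + `|t| <= 1 -> D (s *: x + t *: y).

Definition minkowski D x : R :=
  inf [set t | 0 < t /\ exists2 y, D y & x = t *: y].

Variables (D : set X) (r M : R).
Hypotheses (Dc : absolutely_convex D) (r0 : 0 < r)
  (rD : forall x, `|x| <= r -> D x) (DM : forall x, D x -> `|x| <= M).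

Let S x := [set t | 0 < t /\ exists2 y, D y & x = t *: y].

Let S_big x t : 0 < t -> r^-1 * `|x| <= t -> S x t.
Proof.
move=> t0 xt; split => //; exists (t^-1 *: x); last first.
  by rewrite scalerA divff ?scale1r// gt_eqF.
apply: rD; rewrite normrZ gtr0_norm ?invr_gt0// mulrC ler_pdivrMr//.
by rewrite -ler_pdivrMl.
Qed.

Let S_has_inf x : has_inf (S x).
Proof.
split; last by exists 0 => t [/ltW].
exists (r^-1 * `|x| + 1); apply: S_big; last by rewrite lerDl.
by rewrite ltr_wpDl// mulr_ge0// invr_ge0 ltW.
Qed.

Lemma minkowski_ge0 x : 0 <= minkowski D x.
Proof. by apply: lb_le_inf; [case: (S_has_inf x)|move=> t [/ltW]]. Qed.

Let minkowski_le x t : S x t -> minkowski D x <= t.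
Proof. by move=> St; apply: ge_inf => //; case: (S_has_inf x). Qed.

Lemma minkowski_le_norm x : minkowski D x <= r^-1 * `|x|.
Proof.
apply/ler_addgt0Pr => e e0; apply: minkowski_le; apply: S_big.
  by rewrite ltr_wpDl// mulr_ge0// invr_ge0 ltW.
by rewrite lerDl ltW.
Qed.

Lemma norm_le_minkowski x : `|x| <= M * minkowski D x.
Proof.
have M0 : 0 <= M.
  by apply: (@le_trans _ _ `|0 : X|) => //; apply: DM; apply: rD; rewrite normr0 ltW.
apply/ler_addgt0Pr => e e0.
have M10 : 0 < M + 1 by rewrite ltr_wpDl.
have [t [t0 [y Dy xE]] tlt] := inf_adherent (divr_gt0 e0 M10) (S_has_inf x).
rewrite {1}xE normrZ gtr0_norm//.
apply: (@le_trans _ _ (t * M)); first by rewrite ler_wpM2l ?DM// ltW.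
apply: (@le_trans _ _ (M * (minkowski D x + e / (M + 1)))).
  by rewrite mulrC; apply: ler_wpM2l => //; exact: ltW.
rewrite mulrDr lerD2l mulrCA; apply: ler_piMr; first exact: ltW.
by rewrite ler_pdivrMr// mul1r lerDl.
Qed.

Lemma minkowskiD x y : minkowski D (x + y) <= minkowski D x + minkowski D y.
Proof.
apply/ler_addgt0Pr => e e0.
have e20 : 0 < e / 2 by rewrite divr_gt0.
have [s [s0 [u Du xE]] sl] := inf_adherent e20 (S_has_inf x).
have [t [t0 [v Dv yE]] tl] := inf_adherent e20 (S_has_inf y).
apply: (@le_trans _ _ (s + t)).
  have st0 : 0 < s + t by rewrite addr_gt0.
  apply: minkowski_le; split => //.
  exists ((s / (s + t)) *: u + (t / (s + t)) *: v).
    apply: Dc => //; rewrite !gtr0_norm ?divr_gt0//.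
    by rewrite -mulrDl divff// gt_eqF.
  rewrite scalerDr !scalerA mulrC divfK ?gt_eqF//.
  by rewrite (mulrC (s + t)) divfK ?gt_eqF// -xE -yE.
rewrite (le_trans (ltW (ltrD sl tl)))// addrACA -splitr.
exact: lexx.
Qed.

Let minkowskiZ_le c x : c != 0 -> minkowski D (c *: x) <= `|c| * minkowski D x.
Proof.
move=> c0; have c0' : 0 < `|c| by rewrite normr_gt0.
rewrite -ler_pdivrMl//; apply: lb_le_inf; first by case: (S_has_inf x).
move=> t [t0 [y Dy ->]]; rewrite ler_pdivrMl//.
apply: minkowski_le; split; first by rewrite mulr_gt0.
exists ((c / `|c|) *: y + 0 *: y).
  apply: Dc => //; rewrite normr0 addr0 normrM normfV normr_id divff//.
  by rewrite gt_eqF.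
rewrite scale0r addr0 !scalerA; congr (_ *: _).
by rewrite [RHS]mulrC mulrA divfK// gt_eqF.
Qed.

Lemma minkowskiZ c x : minkowski D (c *: x) = `|c| * minkowski D x.
Proof.
have [->|c0] := eqVneq c 0.
  rewrite scale0r normr0 mul0r; apply/eqP; rewrite eq_le minkowski_ge0 andbT.
  by rewrite (le_trans (minkowski_le_norm _))// normr0 mulr0.
apply/eqP; rewrite eq_le minkowskiZ_le//=.
have := minkowskiZ_le (c *: x) (invr_neq0 c0).
rewrite scalerA mulVf// scale1r normfV -ler_pdivrMl ?invrK//.
by rewrite invr_gt0 normr_gt0.
Qed.

Lemma minkowski_dist x y : `|minkowski D x - minkowski D y| <= r^-1 * `|x - y|.
Proof.
have H u v : minkowski D u - minkowski D v <= r^-1 * `|u - v|.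
  rewrite lerBlDr (le_trans _ (lerD (minkowski_le_norm (u - v)) (lexx _)))//.
  by rewrite -{1}(subrK v u) minkowskiD.
by rewrite ler_norml H andbT lerNl opprB distrC H.
Qed.

End minkowski.

(** The standing assumption on the sets K to which the DFJP-LNO construction
    applies. *)
Record dfjp_body (R : realType) (X : normedModType R) := DfjpBody {
  dfjp_set :> set X;
  dfjp_closed : closed dfjp_set;
  dfjp_nonempty : dfjp_set !=set0;
  dfjp_absolutely_convex : absolutely_convex dfjp_set;
  dfjp_subball : dfjp_set `<=` [set x | `|x| <= 1] }.

(** The function f of the construction, and the unique element of (1, +oo)
    where it takes the value 1; the default value 2 of [xget] is never used. *)
Definition dfjp_f (R : realType) (a : R) : R :=
  Num.sqrt (fine (\sum_(1 <= n <oo)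
    ((a ^+ n / (a ^+ (2 * n) + 1)) ^+ 2)%:E)%E).

Definition lno_base (R : realType) : R :=
  xget 2 [set a : R | 1 < a /\ dfjp_f a = 1].

Lemma lno_base_gt1 (R : realType) : 1 < lno_base R.
Proof. by rewrite /lno_base; case: xgetP => [a _ []|_]//; rewrite ltr1n. Qed.

Section dfjp.
Context (R : realType) (X : completeNormedModType R).
Variable K : dfjp_body X.
Local Notation a := (lno_base R).
Implicit Types (x y : X) (n : nat).

Definition dfjp_Kn n : set X :=
  [set a ^+ n *: k + a ^- n *: b | k in K & b in [set b : X | `|b| <= 1]].

Definition dfjp_gauge n x : R := minkowski (dfjp_Kn n) x.

Definition dfjp_sum x : \bar R :=
  (\sum_(1 <= n <oo) ((dfjp_gauge n x) ^+ 2)%:E)%E.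

Definition dfjp_dom : {pred X} := fun x => (dfjp_sum x < +oo)%E.

Definition dfjp_norm x : R := Num.sqrt (fine (dfjp_sum x)).

Let a0 : 0 < a. Proof. exact: lt_trans (lno_base_gt1 R). Qed.

Let an0 n : 0 < a ^+ n. Proof. exact: exprn_gt0. Qed.

Let anV0 n : 0 < a ^- n. Proof. by rewrite invr_gt0. Qed.

Let K0 : dfjp_set K 0.
Proof.
have [k Kk] := dfjp_nonempty K.
have := @dfjp_absolutely_convex _ _ K k k 0 0 Kk Kk.
by rewrite !scale0r addr0; apply; rewrite normr0 addr0.
Qed.

Let Kn_absconvex n : absolutely_convex (dfjp_Kn n).
Proof.
move=> _ _ s t [k Kk [b b1 <-]] [l Kl [c c1 <-]] st.
exists (s *: k + t *: l); first exact: dfjp_absolutely_convex.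
exists (s *: b + t *: c).
  rewrite /= (le_trans (ler_normD _ _))// !normrZ (le_trans _ st)// lerD//.
    by rewrite ler_piMr.
  by rewrite ler_piMr.
rewrite !scalerDr !scalerA addrACA.
by rewrite (mulrC s (a ^+ n)) (mulrC t (a ^+ n)) (mulrC s) (mulrC t).
Qed.

Let Kn_ball n x : `|x| <= a ^- n -> dfjp_Kn n x.
Proof.
move=> xa; exists 0 => //; exists (a ^+ n *: x); last first.
  by rewrite scaler0 add0r scalerA mulVf ?scale1r// gt_eqF.
by rewrite /= normrZ gtr0_norm// -ler_pdivlMl// mulr1.
Qed.

Let Kn_bounded n x : dfjp_Kn n x -> `|x| <= a ^+ n + a ^- n.
Proof.
move=> [k Kk [b b1 <-]]; rewrite (le_trans (ler_normD _ _))// !normrZ.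
rewrite !(@gtr0_norm _ (_ ^+ _))// (@gtr0_norm _ (_ ^- _))//.
have k1 := @dfjp_subball _ _ K k Kk.
by rewrite lerD// ler_piMr// ltW.
Qed.

Lemma dfjp_gaugeZ n c x : dfjp_gauge n (c *: x) = `|c| * dfjp_gauge n x.
Proof. exact: (minkowskiZ (@Kn_absconvex n) (anV0 n) (@Kn_ball n)). Qed.

Lemma dfjp_gaugeD n x y : dfjp_gauge n (x + y) <= dfjp_gauge n x + dfjp_gauge n y.
Proof. exact: (minkowskiD (@Kn_absconvex n) (anV0 n) (@Kn_ball n)). Qed.

Lemma dfjp_gauge_ge0 n x : 0 <= dfjp_gauge n x.
Proof. exact: (minkowski_ge0 (anV0 n) (@Kn_ball n)). Qed.

Lemma norm_le_dfjp_gauge n x : `|x| <= (a ^+ n + a ^- n) * dfjp_gauge n x.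
Proof. exact: (norm_le_minkowski (anV0 n) (@Kn_ball n) (@Kn_bounded n)). Qed.

Lemma dfjp_gauge_dist n x y :
  `|dfjp_gauge n x - dfjp_gauge n y| <= a ^+ n * `|x - y|.
Proof.
have := minkowski_dist (@Kn_absconvex n) (anV0 n) (@Kn_ball n) x y.
by rewrite invrK.
Qed.

Let gauge2_ge0 n x : (0 <= ((dfjp_gauge n x) ^+ 2)%:E)%E.
Proof. by rewrite lee_fin sqr_ge0. Qed.

Lemma dfjp_sum_ge0 x : (0 <= dfjp_sum x)%E.
Proof. by apply: nneseries_ge0 => *; exact: gauge2_ge0. Qed.

Lemma dfjp_sumZ c x : dfjp_sum (c *: x) = ((c ^+ 2)%:E * dfjp_sum x)%E.
Proof.
rewrite /dfjp_sum -nneseriesZl//; apply: eq_eseriesr => n _.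
by rewrite dfjp_gaugeZ exprMn real_normK ?num_real// EFinM.
Qed.

Lemma dfjp_sumD (s t : R) x y : 0 < s -> 0 < t -> s + t = 1 ->
  (dfjp_sum (x + y)%R <= s^-1%:E * dfjp_sum x + t^-1%:E * dfjp_sum y)%E.
Proof.
move=> s0 t0 st; rewrite /dfjp_sum -!nneseriesZl//.
have Z0 c n z : 0 < c -> (0 <= c^-1%:E * ((dfjp_gauge n z) ^+ 2)%:E)%E.
  by move=> c0; rewrite mule_ge0// lee_fin invr_ge0 ltW.
rewrite -nneseriesD; [|by move=> *; exact: Z0..].
apply: lee_nneseries => [n _ _|n _]; first exact: gauge2_ge0.
rewrite -!EFinM -EFinD lee_fin.
set u := dfjp_gauge n x; set v := dfjp_gauge n y.
apply: (@le_trans _ _ ((u + v) ^+ 2)).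
  by rewrite ler_pXn2r ?nnegrE ?addr_ge0 ?dfjp_gaugeD//; exact: dfjp_gauge_ge0.
have -> : t = 1 - s by rewrite -st addrAC subrr add0r.
have s1 : 1 - s != 0 by rewrite gt_eqF// -st addrAC subrr add0r.
rewrite -subr_ge0.
suff -> : s^-1 * u ^+ 2 + (1 - s)^-1 * v ^+ 2 - (u + v) ^+ 2 =
    s^-1 * (1 - s)^-1 * ((1 - s) * u - s * v) ^+ 2.
  rewrite mulr_ge0 ?sqr_ge0// mulr_ge0// invr_ge0 ?ltW//.
  by rewrite -st addrAC subrr add0r.
have s0' : s != 0 by rewrite gt_eqF.
by field; apply/andP.
Qed.


Let gauge1_le x : (((dfjp_gauge 1 x) ^+ 2)%:E <= dfjp_sum x)%E.
Proof.
have := @nneseries_lim_ge _ (fun n => ((dfjp_gauge n x) ^+ 2)%:E) xpredT 1 2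
  (fun n _ _ => gauge2_ge0 n x).
by rewrite big_nat1.
Qed.

Let sum_fin x : (dfjp_sum x < +oo)%E -> dfjp_sum x \is a fin_num.
Proof. by move=> xoo; rewrite ge0_fin_numE//; exact: dfjp_sum_ge0. Qed.

Lemma dfjp_sumE x : (dfjp_sum x < +oo)%E -> dfjp_sum x = ((dfjp_norm x) ^+ 2)%:E.
Proof. by move=> /sum_fin xf; rewrite sqr_sqrtr ?fineK// fine_ge0// dfjp_sum_ge0. Qed.

Lemma dfjp_norm_ge0 x : 0 <= dfjp_norm x. Proof. exact: sqrtr_ge0. Qed.

Lemma dfjp_norm_le x : (dfjp_sum x < +oo)%E -> `|x| <= (a + a^-1) * dfjp_norm x.
Proof.
move=> xoo; have := norm_le_dfjp_gauge 1 x; rewrite expr1 => /le_trans; apply.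
apply: ler_wpM2l; first by rewrite addr_ge0// ?invr_ge0 ltW.
rewrite -(@ler_pXn2r _ 2) ?nnegrE ?dfjp_norm_ge0 ?dfjp_gauge_ge0//.
by rewrite -lee_fin -dfjp_sumE.
Qed.

Fact dfjp_dom_submod : GRing.subsemimod_closed dfjp_dom.
Proof.
split=> [|c x xoo].
  split; rewrite /in_mem/= /dfjp_dom.
    by rewrite -(scale0r 0) dfjp_sumZ expr0n/= mul0e.
  move=> x y xoo yoo; have h0 : 0 < 2^-1 :> R by rewrite invr_gt0.
  apply: le_lt_trans (dfjp_sumD x y h0 h0 _) _; first by field.
  by rewrite lte_add_pinfty// lte_mul_pinfty// lee_fin invr_ge0 ltW.
by rewrite /in_mem/= /dfjp_dom dfjp_sumZ lte_mul_pinfty// lee_fin sqr_ge0.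
Qed.

HB.instance Definition _ :=
  GRing.isSubmodClosed.Build R X dfjp_dom dfjp_dom_submod.

Lemma dfjp_normZ c x : x \in dfjp_dom -> dfjp_norm (c *: x) = `|c| * dfjp_norm x.
Proof.
move=> xoo; rewrite {1}/dfjp_norm dfjp_sumZ (dfjp_sumE xoo) -EFinM/= -exprMn.
by rewrite sqrtr_sqr normrM (ger0_norm (dfjp_norm_ge0 _)).
Qed.

Lemma dfjp_normD x y : x \in dfjp_dom -> y \in dfjp_dom ->
  dfjp_norm (x + y) <= dfjp_norm x + dfjp_norm y.
Proof.
move=> xoo yoo; have xyoo : x + y \in dfjp_dom by rewrite rpredD.
have [x0|x0] := eqVneq x 0; first by rewrite x0 add0r lerDr dfjp_norm_ge0.
have [y0|y0] := eqVneq y 0; first by rewrite y0 addr0 lerDl dfjp_norm_ge0.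
have aa0 : 0 < a + a^-1 by rewrite addr_gt0// invr_gt0.
have pos z : z \in dfjp_dom -> z != 0 -> 0 < dfjp_norm z.
  move=> zoo z0; rewrite -(pmulr_rgt0 _ aa0) (lt_le_trans _ (dfjp_norm_le zoo))//.
  by rewrite normr_gt0.
have xp := pos _ xoo x0; have yp := pos _ yoo y0.
set u := dfjp_norm x in xp *; set v := dfjp_norm y in yp *.
have uv0 : 0 < u + v by rewrite addr_gt0.
rewrite -(@ler_pXn2r _ 2) ?nnegrE ?dfjp_norm_ge0 ?(ltW uv0)//.
rewrite -lee_fin -(dfjp_sumE xyoo).
have := dfjp_sumD x y (divr_gt0 xp uv0) (divr_gt0 yp uv0).
rewrite -mulrDl divff ?gt_eqF// => /(_ erefl) /le_trans; apply.
rewrite (dfjp_sumE xoo) (dfjp_sumE yoo) -/u -/v -!EFinM -EFinD lee_fin.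
rewrite le_eqVlt; apply/orP; left; apply/eqP; field.
by rewrite !gt_eqF.
Qed.

Lemma dfjp_norm_eq0 x : x \in dfjp_dom -> dfjp_norm x = 0 -> x = 0.
Proof.
move=> /dfjp_norm_le xle x0; apply/normr0_eq0/eqP.
by rewrite eq_le normr_ge0 andbT (le_trans xle)// x0 mulr0.
Qed.

(** The inclusion J_K of X_K into X is the projection [dfjp_val]. *)
Record dfjp_space := DfjpSpace {
  dfjp_val : X; dfjp_valP : dfjp_val \in dfjp_dom }.

HB.instance Definition _ := [isSub for dfjp_val].
HB.instance Definition _ := [Choice of dfjp_space by <:].
HB.instance Definition _ := [SubChoice_isSubZmodule of dfjp_space by <:].
HB.instance Definition _ := [SubZmodule_isSubLmodule of dfjp_space by <:].

Let snorm (u : dfjp_space) := dfjp_norm (val u).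

Let snormD u v : snorm (u + v) <= snorm u + snorm v.
Proof. exact: dfjp_normD (valP u) (valP v). Qed.

Let snormZ (c : R) u : snorm (c *: u) = `|c| * snorm u.
Proof. exact: dfjp_normZ (valP u). Qed.

Let snorm_eq0 u : snorm u = 0 -> u = 0.
Proof. by move=> u0; apply/val_inj/(dfjp_norm_eq0 (valP u)). Qed.

HB.instance Definition _ :=
  Lmodule_isNormed.Build R dfjp_space snormD snormZ snorm_eq0.

Lemma dfjp_normE (u : dfjp_space) : `|u| = dfjp_norm (val u).
Proof. by []. Qed.

Let gauge_cvg n (F : set_system dfjp_space) x y : ProperFilter F ->
  val @ F --> x ->
  (fun v => (dfjp_gauge n (y - val v)) ^+ 2) @ F --> (dfjp_gauge n (y - x)) ^+ 2.
Proof.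
move=> FF /cvgrPdist_le Fx.
have h : (fun v => dfjp_gauge n (y - val v)) @ F --> dfjp_gauge n (y - x).
  apply/cvgrPdist_le => e e0.
  apply: filterS (Fx _ (divr_gt0 e0 (an0 n))) => v /= xv.
  rewrite (le_trans (dfjp_gauge_dist _ _ _))// -ler_pdivlMl// mulrC.
  by rewrite opprB addrC addrA subrK distrC.
exact: (cvgM h h).
Qed.

Let space_complete (F : set_system dfjp_space) :
  ProperFilter F -> cauchy F -> cvg F.
Proof.
move=> FF /cauchyP Fc.
have aa0 : 0 < a + a^-1 by rewrite addr_gt0// invr_gt0.
have vFc : cauchy (val @ F : set_system X).
  apply/cauchyP => e e0.
  have [u] := Fc _ (divr_gt0 e0 aa0); rewrite -ball_normE /= => Fu.
  exists (val u); rewrite -ball_normE /=; apply: filterS Fu => v /=.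
  rewrite ltr_pdivlMr// mulrC; apply: le_lt_trans.
  exact: (dfjp_norm_le (valP (u - v))).
have /cvg_ex[x Fx] : cvg (val @ F : set_system X) by exact: cauchy_cvg vFc.
have key (e : R) : 0 < e -> \forall u \near F,
    (dfjp_sum (val u - x)%R <= (e ^+ 2)%:E)%E.
  move=> e0; have [w] := Fc _ (divr_gt0 e0 (ltr0Sn R 1)).
  rewrite -ball_normE /= => Fw; apply: filterS (Fw) => u /= uw.
  have uF : \forall v \near F, `|u - v| < e.
    apply: filterS Fw => v /= vw.
    rewrite -(subrK w u) -addrA (le_lt_trans (ler_normD _ _))//.
    by rewrite (splitr e) ltrD// distrC.
  apply: lime_le; first by apply: is_cvg_nneseries.
  apply: nearW => N; rewrite sumEFin lee_fin.
  have : (fun v => \sum_(1 <= n < N) (dfjp_gauge n (val u - val v)) ^+ 2) @ F -->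
      \sum_(1 <= n < N) (dfjp_gauge n (val u - x)) ^+ 2.
    by apply: cvg_big => [|n _]; [exact: add_continuous|exact: gauge_cvg].
  move=> /cvgr_to_le; apply.
  apply: filterS uF => v uve.
  rewrite -lee_fin -sumEFin (le_trans (nneseries_lim_ge _ _))//.
  rewrite -[X in (X <= _)%E]/(dfjp_sum (val (u - v))) (dfjp_sumE (valP (u - v))).
  by rewrite lee_fin ler_pXn2r ?nnegrE ?dfjp_norm_ge0 ?(ltW e0)// ltW.
have xoo : x \in dfjp_dom.
  have [u ux] := filter_ex (key _ ltr01).
  have uxoo : val u - x \in dfjp_dom by apply: le_lt_trans ux _; rewrite ltry.
  by rewrite -(subKr (val u) x) rpredB//; exact: dfjp_valP.
apply/cvg_ex; exists (DfjpSpace xoo).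
apply/cvgrPdist_le => /= e e0.
apply: filterS (key _ e0) => u ux.
rewrite distrC dfjp_normE /= -(@ler_pXn2r _ 2) ?nnegrE ?dfjp_norm_ge0 ?(ltW e0)//.
by rewrite -lee_fin -dfjp_sumE//; apply: le_lt_trans ux _; rewrite ltry.
Unshelve. all: by end_near. Qed.

HB.instance Definition _ := Uniform_isComplete.Build dfjp_space space_complete.
End dfjp.

Section body_of.
Context (R : realType) (X : normedModType R).

Definition dfjp_admissible (D : set X) :=
  [/\ closed D, D !=set0, absolutely_convex D & D `<=` [set x | `|x| <= 1]].

Fact dfjp_admissible0 : dfjp_admissible [set 0].
Proof.
split.
- exact/accessible_closed_set1/hausdorff_accessible/norm_hausdorff.
- by exists 0.
- by move=> _ _ s t -> -> _ /=; rewrite !scaler0 addr0.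
- by move=> _ -> /=; rewrite normr0.
Qed.

(** The set D itself when it satisfies the standing assumption on K; the other
    branch is only there to make the definition total. *)
Definition dfjp_body_of (D : set X) : dfjp_body X :=
  match pselect (dfjp_admissible D) with
  | left (And4 h1 h2 h3 h4) => DfjpBody h1 h2 h3 h4
  | right _ => let: And4 h1 h2 h3 h4 := dfjp_admissible0 in
               DfjpBody h1 h2 h3 h4
  end.

Lemma dfjp_body_ofE (D : set X) :
  dfjp_admissible D -> dfjp_body_of D = D :> set X.
Proof. by rewrite /dfjp_body_of; case: pselect => // -[]. Qed.

End body_of.

Section vector_measure.
Context d (T : measurableType d) (R : realType).

(** A measure on the sigma-algebra is represented by a function on all subsets
    of T, whose values outside the measurable sets are never relevant. This
    covers vector measures, their variations and the measures mu below: the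
    integral of the library accepts arbitrary set functions. *)
Definition vector_measure (Z : normedModType R) (nu : set T -> Z) :=
  forall F : (set T)^nat, (forall i, measurable (F i)) -> trivIset setT F ->
    (fun n => \sum_(0 <= i < n) nu (F i)) @ \oo --> nu (\bigcup_i F i).

Definition vvariation (V : normedZmodType R) (nu : set T -> V) (A : set T) :
    \bar R :=
  ereal_sup [set v | exists n (F : 'I_n -> set T),
    [/\ forall i, measurable (F i), trivIset setT F, \bigcup_i F i = A &
        v = (\sum_(i < n) `|nu (F i)|)%:E]].

Definition finite_variation (V : normedZmodType R) (nu : set T -> V) :=
  (vvariation nu setT < +oo)%E.

Definition sigma_finite_variation (V : normedZmodType R) (nu : set T -> V) :=
  exists A : (set T)^nat, [/\ forall i, measurable (A i),
    forall i, (vvariation nu (A i) < +oo)%E & \bigcup_i A i = setT].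

(** Integration against a real-valued measure lambda, through its Jordan
    decomposition (|lambda| + lambda) / 2, (|lambda| - lambda) / 2. *)
Definition positive_variation (lambda : set T -> R) (A : set T) : \bar R :=
  (2^-1%:E * (vvariation lambda A + (lambda A)%:E))%E.

Definition negative_variation (lambda : set T -> R) (A : set T) : \bar R :=
  (2^-1%:E * (vvariation lambda A - (lambda A)%:E))%E.

Definition signed_integral (lambda : set T -> R) (A : set T) (f : T -> R) : R :=
  fine (\int[positive_variation lambda]_(x in A) (f x)%:E)%E -
  fine (\int[negative_variation lambda]_(x in A) (f x)%:E)%E.

Section integration.
Context (Z : normedModType R) (nu : set T -> Z).

Definition dual_ball : set {linear Z -> R^o} :=
  [set phi | continuous phi /\ forall z, `|phi z| <= `|z|].

Definition semivariation (A : set T) : \bar R :=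
  ereal_sup [set vvariation (phi \o nu) A | phi in dual_ball].

Definition has_vintegral (A : set T) (f : T -> R) (z : Z) :=
  forall phi : {linear Z -> R^o}, continuous phi ->
    phi z = signed_integral (phi \o nu) A f.

Definition vintegrable (f : T -> R) :=
  [/\ measurable_fun setT f,
      forall phi : {linear Z -> R^o}, continuous phi ->
        (\int[vvariation (phi \o nu)]_x `|f x|%:E < +oo)%E &
      forall A, measurable A -> exists z, has_vintegral A f z].

Definition vintegral (A : set T) (f : T -> R) : Z :=
  xget 0 (has_vintegral A f).

Definition L1norm (f : T -> R) : \bar R :=
  ereal_sup [set (\int[vvariation (phi \o nu)]_x `|f x|%:E)%E
            | phi in dual_ball].

(** L_1(nu) is handled through representatives: the norm and the integral do
    not distinguish functions that are equal nu-a.e. *)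
Definition integration_operator (f : T -> R) : Z := vintegral setT f.

Definition L1ball : set (T -> R) :=
  [set f | vintegrable f /\ (L1norm f <= 1)%E].

End integration.

Section bochner.
Context (Z : normedModType R) (mu : set T -> \bar R).

Definition vsimple (s : T -> Z) :=
  finite_set (range s) /\ forall z, measurable (s @^-1` [set z]).

Definition vsimple_integral (A : set T) (s : T -> Z) : Z :=
  \sum_(z \in range s) fine (mu (A `&` s @^-1` [set z])) *: z.

(** As h is only an a.e. limit of simple functions, |h - s_n| is measurable
    for the completion of mu only; for such a non-negative function, the
    integral of the library (a supremum over the simple functions below it) is
    the integral with respect to the completion. *)
Definition strongly_measurable (h : T -> Z) :=
  exists s : nat -> T -> Z, (forall n, vsimple (s n)) /\
    {ae mu, forall x, (fun n => s n x) @ \oo --> h x}.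

Definition bochner_approx (h : T -> Z) (s : nat -> T -> Z) :=
  (forall n, vsimple (s n)) /\
  (fun n => \int[mu]_x `|h x - s n x|%:E)%E @ \oo --> 0%E.

Definition bochner_integrable (h : T -> Z) :=
  strongly_measurable h /\ exists s, bochner_approx h s.

Definition bochner_integral (A : set T) (h : T -> Z) : Z :=
  xget 0 [set z | forall s, bochner_approx h s ->
    (fun n => vsimple_integral A (s n)) @ \oo --> z].

Definition bochner_derivative (nu : set T -> Z) (h : T -> Z) :=
  bochner_integrable h /\
  forall A, measurable A -> nu A = bochner_integral A h.

End bochner.

Section lno.
Context (X : completeNormedModType R) (m : set T -> X).

Definition lno_body : dfjp_body X :=
  dfjp_body_of (closure (integration_operator m @` L1ball m)).

Definition lno_space : completeNormedModType R := dfjp_space lno_body.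

Definition lno_J : lno_space -> X := @dfjp_val R X lno_body.

(** S_K z = S z, the default value 0 being irrelevant since S(Z) is included
    in X_K. *)
Definition lno_T (f : T -> R) : lno_space :=
  insubd (0 : dfjp_space lno_body) (integration_operator m f).

Definition lno_measure (A : set T) : lno_space := lno_T \1_A.

End lno.

End vector_measure.

(* Main.v *)
(** For x in L K the n-th gauge is at most min(L a^-n, a^n |x|), so that
    |x|_K^2 <= C L |x|; (ii) is the case x = I_m f, L = |f|. By the same inequality,
    a convex subset of L K on which a functional of Y is >= e > 0 stays away from 0
    in X. Hence a sequence of L K that tends weakly to 0 in X does so in Y, which
    transfers the integrals of m to mt by dominated convergence; (i) follows since
    J and T have norm at most 1. As |m| is additive, summing (ii) over partitions
    gives (iii). For (iv), m(A)/|m|(A) belongs to K, so G is K-valued almost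
    everywhere, and the inclusion of K into Y is 1/2-Hölder by the inequality above. *)

From HB Require Import structures.
Require Import Defs.
From mathcomp Require Import all_boot all_order all_algebra.
From mathcomp Require Import all_classical all_reals all_analysis measurable_realfun.
From mathcomp Require Import ring lra.
Set Implicit Arguments.
Unset Strict Implicit.
Unset Printing Implicit Defensive.
Import Order.TTheory GRing.Theory Num.Theory.
Import numFieldNormedType.Exports.
Local Open Scope classical_set_scope.
Local Open Scope ring_scope.

(** * Functionals on a normed space *)

(** The equation f(a) = 1 is what makes (i) isometric. On [K] the n-th gauge is at most
    [dfjp_coef n], and everywhere it is at least [dfjp_coef n] times the norm; as the squares of
    these coefficients add up to 1, both T and J are contractions. The obstacle in (i) is the scalar
    definition of the integral. Dominated convergence yields convergence only against each
    functional of X, and a functional of Y need not factor through J. What compensates is that the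
    remainders stay in one dilate L K, where interpolation controls the norm of Y by that of X. Such
    an L exists because the norm of L_1(m) is finite, which the definition of integrability does not
    provide: it comes from uniform boundedness, proved here from Hahn-Banach by a gliding hump. In
    (iv) the Hölder bound is available only between points of K. It is therefore not enough that G
    takes its values there: its simple approximants are moved into K as well, before anything is
    lifted to Y. The measure changes too, from |m| to |mt|, at the price of a density with values in
    [0, 1]. *)

Section hahn_banach.
Context (R : realType) (V : lmodType R).
Implicit Types (p q : V -> R) (x y w : V) (D : set V).

Definition sublinear p :=
  (forall x y, p (x + y) <= p x + p y) /\
  (forall (t : R) x, 0 <= t -> p (t *: x) = t * p x).

Definition segment_closed D := forall x y s t,
  D x -> D y -> 0 <= s -> 0 <= t -> s + t = 1 -> D (s *: x + t *: y).

Lemma sublinear0 p : sublinear p -> p 0 = 0.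
Proof. by move=> [_ pZ]; rewrite -(scale0r 0) pZ// mul0r. Qed.

Lemma sublinearN p x : sublinear p -> - p (- x) <= p x.
Proof.
move=> ps; rewrite -subr_ge0 opprK -(sublinear0 ps) -(subrr x).
exact: ps.1.
Qed.

Section relax.
Variables (q : V -> R) (D : set V) (delta : R).
Hypotheses (qs : sublinear q) (Dc : segment_closed D) (D0 : D !=set0)
  (qD : forall w, D w -> delta <= q w).

Let S x := [set q (x + t.1 *: t.2) - t.1 * delta | t in [set t | 0 <= t.1 /\ D t.2]].

(** The largest sublinear function below [q] whose value at [- w] is at most [- delta] for every [w]
    in [D]; a linear functional below it is at least [delta] on [D]. It serves with [D] a singleton
    in [hahn_banach] and with [q] the norm in [separation]. *)
Definition relax x : R := inf (S x).

Let S_lb x : lbound (S x) (- q (- x)).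
Proof.
move=> _ [[t w]/= [t0 Dw] <-]; rewrite lerBrDr -lerBrDl opprK.
apply: (@le_trans _ _ (q (t *: w))); first by rewrite qs.2// ler_wpM2l// qD.
by rewrite addrC (le_trans _ (qs.1 _ _))// addKr.
Qed.

Let S_inf x : has_inf (S x).
Proof.
split; last by exists (- q (- x)); exact: S_lb.
have [w Dw] := D0; exists (q (x + 0 *: w) - 0 * delta).
by exists (0, w).
Qed.

Lemma relax_le x (t : R) w : 0 <= t -> D w -> relax x <= q (x + t *: w) - t * delta.
Proof. by move=> t0 Dw; apply: ge_inf; [case: (S_inf x)|exists (t, w)]. Qed.

Lemma relax_leW x : relax x <= q x.
Proof.
have [w Dw] := D0; have := relax_le x (lexx 0) Dw.
by rewrite scale0r addr0 mul0r subr0.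
Qed.

Lemma relaxN w : D w -> relax (- w) <= - delta.
Proof.
move=> Dw; have := relax_le (- w) ler01 Dw.
by rewrite scale1r addNr (sublinear0 qs) mul1r sub0r.
Qed.

(** The two witnesses merge: convexity puts the weighted mean [u] of [w] and [v] in [D], and (t + s)
    u = t w + s v. *)
Let relaxD_le x y r r' : S x r -> S y r' -> relax (x + y) <= r + r'.
Proof.
move=> [[t w]/= [t0 Dw] <-] [[s v]/= [s0 Dv] <-].
have [st0|st0] := eqVneq (t + s) 0.
  move: st0 => /eqP; rewrite paddr_eq0// => /andP[/eqP -> /eqP ->].
  rewrite !scale0r !addr0 !mul0r !subr0.
  by rewrite (le_trans (relax_leW _))// qs.1.
have stp : 0 < t + s by rewrite lt_neqAle eq_sym st0 addr_ge0.
set u := (t / (t + s)) *: w + (s / (t + s)) *: v.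
have Du : D u.
  by apply: Dc => //; rewrite ?divr_ge0 ?(ltW stp)// -mulrDl divff.
apply: (le_trans (relax_le _ (ltW stp) Du)).
have -> : x + y + (t + s) *: u = (x + t *: w) + (y + s *: v).
  by rewrite /u scalerDr !scalerA !(mulrC (t + s)) !divfK// addrACA.
by rewrite mulrDl opprD [X in _ <= X]addrACA lerD2r qs.1.
Qed.

Let relaxD x y : relax (x + y) <= relax x + relax y.
Proof.
rewrite -lerBlDr; apply: lb_le_inf; first by case: (S_inf x).
move=> r Sr; rewrite lerBlDr -lerBlDl.
apply: lb_le_inf; first by case: (S_inf y).
by move=> r' Sr'; rewrite lerBlDl relaxD_le.
Qed.

Let relaxZ_le t x : 0 < t -> relax (t *: x) <= t * relax x.
Proof.
move=> t0; rewrite -ler_pdivrMl//; apply: lb_le_inf; first by case: (S_inf x).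
move=> _ [[s w]/= [s0 Dw] <-]; rewrite ler_pdivrMl//.
have := relax_le (t *: x) (mulr_ge0 (ltW t0) s0) Dw.
by rewrite -scalerA -scalerDr qs.2 ?(ltW t0)// -mulrA -mulrBr.
Qed.

Lemma relax_sublinear : sublinear relax.
Proof.
split; first exact: relaxD.
have relax0 : relax 0 = 0.
  apply/eqP; rewrite eq_le; apply/andP; split.
    by rewrite (le_trans (relax_leW 0))// sublinear0.
  apply: lb_le_inf; first by case: (S_inf 0).
  by move=> _ [[t w]/= [t0 Dw] <-]; rewrite add0r subr_ge0 qs.2// ler_wpM2l// qD.
move=> t x; rewrite le_eqVlt => /predU1P[<-|t0]; first by rewrite scale0r mul0r.
apply/eqP; rewrite eq_le relaxZ_le//=.
rewrite -ler_pdivlMl//; have := @relaxZ_le t^-1 (t *: x).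
by rewrite invr_gt0 => /(_ t0); rewrite scalerA mulVf ?scale1r// gt_eqF.
Qed.

End relax.

(* By Zorn's lemma there is a minimal sublinear functional below p; minimality
   against its relaxations forces it to be additive. *)
Lemma hahn_banach p : sublinear p ->
  exists f : {linear V -> R^o}, forall x, f x <= p x.
Proof.
move=> ps.
pose T := {q | sublinear q /\ forall x, q x <= p x}.
(* The order is reversed: [t] is above [s] when it is pointwise smaller, so that a maximal element
   for Zorn is a minimal sublinear functional. *)
pose r (s t : T) : bool := `[< forall x, sval t x <= sval s x >].
have [//|||A Atot|[q [qs qp]] qmin] := @Zorn T r.
- by move=> t; apply/asboolP.
- move=> s t u /asboolP st /asboolP tu; apply/asboolP => x.
  exact: le_trans (tu x) (st x).
- move=> [s Ps] [t Pt] /asboolP/= st /asboolP/= ts.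
  by apply: eq_exist; apply/funext => x; apply/eqP; rewrite eq_le st ts.
- have [A0|/set0P [q0 Aq0]] := eqVneq A set0.
    by exists (exist _ p (conj ps (fun=> lexx _))); rewrite A0.
  pose S x := [set sval q x | q in A].
  have Slb x : lbound (S x) (- p (- x)).
    move=> _ [[q [qs qp]] Aq <-] /=.
    by rewrite (le_trans _ (sublinearN _ qs))// lerN2.
  have Sinf x : has_inf (S x).
    by split; [exists (sval q0 x); exists q0|exists (- p (- x)); exact: Slb].
  pose g x := inf (S x).
  have gle (q : T) x : A q -> g x <= sval q x.
    by move=> Aq; apply: ge_inf; [case: (Sinf x)|exists q].
  have gs : sublinear g.
    split=> [x y|t x].
      rewrite -lerBlDr; apply: lb_le_inf; first by case: (Sinf x).
      move=> _ [q1 Aq1 <-]; rewrite lerBlDr -lerBlDl.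
      apply: lb_le_inf; first by case: (Sinf y).
      move=> _ [q2 Aq2 <-]; rewrite lerBlDl.
      (* The pointwise smaller of [q1] and [q2] serves at both [x] and [y]: this is where the
         totality of the chain enters. *)
      have [/asboolP h|/asboolP h] := Atot _ _ Aq1 Aq2.
        rewrite (le_trans (gle _ _ Aq2))// (le_trans ((svalP q2).1.1 _ _))//.
        by rewrite lerD2r.
      rewrite (le_trans (gle _ _ Aq1))// (le_trans ((svalP q1).1.1 _ _))//.
      by rewrite lerD2l.
    rewrite le_eqVlt => /predU1P[<-|t0].
      rewrite scale0r mul0r /g (_ : S 0 = [set 0]) ?inf1//.
      apply/seteqP; split=> [_ [q _ <-]/=|_ ->]; first exact: sublinear0 (svalP q).1.
      by exists q0 => //; exact: sublinear0 (svalP q0).1.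
    have gZ (u : R) y : 0 < u -> g (u *: y) <= u * g y.
      move=> u0; rewrite -ler_pdivrMl//; apply: lb_le_inf; first by case: (Sinf y).
      move=> _ [q Aq <-]; rewrite ler_pdivrMl//.
      by rewrite (le_trans (gle _ _ Aq))// (svalP q).1.2// ltW.
    apply/eqP; rewrite eq_le gZ//= -ler_pdivlMl//.
    by have := gZ t^-1 (t *: x); rewrite invr_gt0 scalerA mulVf ?scale1r ?gt_eqF//; apply.
  have gp x : g x <= p x by rewrite (le_trans (gle _ _ Aq0))// (svalP q0).2.
  exists (exist _ g (conj gs gp)) => q Aq; apply/asboolP => x; exact: gle.
have min q' : sublinear q' -> (forall x, q' x <= q x) -> q' = q.
  move=> q's q'q.
  have q'p x : q' x <= p x by exact: le_trans (q'q x) (qp x).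
  have := qmin (exist _ q' (conj q's q'p)).
  by move=> /(_ (introT (asboolP _) q'q)) [].
have qD x y : q (x + y) = q x + q y.
  apply/eqP; rewrite eq_le qs.1/=.
  (* By minimality the relaxation along [[set y]] at height [q y] is [q] itself, and [relax_le] at t
     = 1 then reads q x <= q (x + y) - q y. *)
  have Dc : segment_closed [set y].
    by move=> _ _ s t -> -> _ _ st; rewrite -scalerDl st scale1r.
  have D0 : [set y] !=set0 by exists y.
  have qy w : [set y] w -> q y <= q w by move=> ->.
  have relE := min _ (relax_sublinear qs Dc D0 qy) (relax_leW qs D0 qy).
  have := relax_le qs D0 qy x ler01 (erefl : [set y] y).
  by rewrite relE scale1r mul1r lerBrDr.
have qN x : q (- x) = - q x.
  by apply/eqP; rewrite -subr_eq0 opprK -qD addNr (sublinear0 qs).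
have qZ (t : R) x : q (t *: x) = t *: (q x : R^o).
  have [t0|/ltW t0] := leP 0 t; first exact: qs.2.
  by rewrite -[t]opprK scaleNr qN qs.2 ?oppr_ge0// scaleNr.
pose fl := GRing.isLinear.Build R V R^o *:%R (q : V -> R^o)
  (fun a u v => etrans (qD _ _) (congr1 (+%R ^~ _) (qZ a u))).
pose f : {linear V -> R^o} := HB.pack (q : V -> R^o) fl.
by exists f.
Qed.

End hahn_banach.

Section dual.
Context (R : realType) (Z : normedModType R).
Implicit Types (f : {linear Z -> R^o}) (z w : Z).

Lemma dual_continuous f (k : R) : (forall z, `|f z| <= k * `|z|) -> continuous f.
Proof.
move=> fk; apply/linear_bounded_continuous/linear_boundedP.
near=> r => z; rewrite (le_trans (fk z))// ler_wpM2r//.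
Unshelve. all: by end_near. Qed.

Lemma dual_bound f : continuous f -> exists2 k, 0 < k & forall z, `|f z| <= k * `|z|.
Proof.
move=> /linear_bounded_continuous/linear_boundedP fb.
near +oo_R => k; exists k => //.
by near: k.
Unshelve. all: by end_near. Qed.

(** Hahn-Banach applied to the norm relaxed along [D]: staying below the norm puts [f] in the dual
    ball, and the value at [- w] gives the lower bound on [D]. *)
Lemma separation (D : set Z) (delta : R) : segment_closed D -> D !=set0 ->
  (forall w, D w -> delta <= `|w|) ->
  exists2 f, dual_ball f & forall w, D w -> delta <= f w.
Proof.
move=> Dc D0 Ddelta.
have ns : sublinear (fun z : Z => `|z|).
  by split=> [x y|t x t0]; rewrite ?ler_normD// normrZ ger0_norm.
have [f fle] := hahn_banach (relax_sublinear ns Dc D0 Ddelta).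
have fz z : f z <= `|z| by rewrite (le_trans (fle z))// (relax_leW ns).
have fb z : `|f z| <= `|z|.
  by rewrite ler_norml fz andbT lerNl -raddfN -(normrN z) fz.
exists f; first by split=> //; apply: (@dual_continuous _ 1) => z; rewrite mul1r.
move=> w Dw; rewrite -lerN2 -raddfN (le_trans (fle _))//.
exact: (relaxN ns D0 Ddelta).
Qed.

Lemma norming_functional z : exists2 f, dual_ball f & f z = `|z|.
Proof.
have [|||f fb fz] := @separation [set z] `|z|.
- by move=> _ _ s t -> -> _ _ st; rewrite -scalerDl st scale1r.
- by exists z.
- by move=> _ ->.
- exists f => //; apply/eqP; rewrite eq_le fz// andbT.
  by rewrite (le_trans (ler_norm _))// fb.2.
Qed.

Lemma dual_inj z w : (forall f, continuous f -> f z = f w) -> z = w.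
Proof.
move=> zw; apply/eqP; rewrite -subr_eq0 -normr_eq0.
by have [f [fc _] <-] := norming_functional (z - w); rewrite linearB (zw f fc) subrr.
Qed.

End dual.

Section uniform_boundedness.
Context (R : realType) (Z : normedModType R).
Variables (z : nat -> Z) (phi : nat -> {linear Z -> R^o}).
Hypothesis phib : forall n, dual_ball (phi n).
Hypothesis phiz : forall n, phi n (z n) = `|z n|.

(* Gliding hump: at step n the increment 4^-n phi_n is added only if it is needed
   to make the functional large at z_n; the later increments are too small to
   undo this. *)
Fixpoint hump n : Z -> R :=
  if n is n'.+1 then fun x => hump n' x +
    (if `|hump n' (z n')| < 4^-1 ^+ n' * `|z n'| / 2 then 4^-1 ^+ n' * phi n' x else 0)
  else fun=> 0.

Let humpP n : linear (hump n : Z -> R^o).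
Proof.
elim: n => [|n IH] a u v /=; first by rewrite addr0 scaler0.
rewrite IH scalerDr addrACA; congr (_ + _).
by case: ifPn => _; rewrite ?scaler0 ?addr0// linearP mulrDr [X in X + _]mulrCA.
Qed.

Let hump_step n x : `|hump n.+1 x - hump n x| <= 4^-1 ^+ n * `|x|.
Proof.
have ? : 0 <= 4^-1 ^+ n :> R by [].
rewrite /= addrAC subrr add0r; case: ifPn => _; last by rewrite normr0 mulr_ge0.
by rewrite normrM ger0_norm// ler_wpM2l// (phib n).2.
Qed.

(** If the test in [hump] succeeds, the new term has size 4^-n |z_n| at z_n and the old functional
    less than half of that, so at least half remains. *)
Let hump_large n : 4^-1 ^+ n * `|z n| / 2 <= `|hump n.+1 (z n)|.
Proof.
rewrite /=; case: ifPn => [h|]; last by rewrite -leNgt addr0.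
rewrite phiz; set u := 4^-1 ^+ n * `|z n| in h *.
have u0 : 0 <= u by rewrite mulr_ge0.
rewrite addrC (le_trans _ (lerB_normD _ _))// (ger0_norm u0).
by rewrite lerBrDr; move: h; lra.
Qed.

(** The exact partial geometric sum makes the induction close; [hump_tailW] then drops its negative
    term. *)
Let hump_tail n k x : (n <= k)%N ->
  `|hump k x - hump n x| <= 4 / 3 * (4^-1 ^+ n - 4^-1 ^+ k) * `|x|.
Proof.
move=> /subnKC <-; elim: (k - n)%N => [|j IH].
  by rewrite addn0 !subrr normr0 mulr0 mul0r.
rewrite addnS -(subrK (hump (n + j) x) (hump (n + j).+1 x)) -addrA.
rewrite (le_trans (ler_normD _ _))// (le_trans (lerD (hump_step _ _) IH))//.
rewrite -mulrDl ler_wpM2r// exprS.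
by rewrite le_eqVlt; apply/orP; left; apply/eqP; field.
Qed.

Let hump_tailW n k x : (n <= k)%N ->
  `|hump k x - hump n x| <= 4 / 3 * 4^-1 ^+ n * `|x|.
Proof.
move=> /hump_tail /le_trans; apply; rewrite ler_wpM2r// ler_wpM2l//.
by rewrite gerDl oppr_le0.
Qed.

Let geo_cvg (x : R) : (fun n => 4 / 3 * 4^-1 ^+ n * x : R^o) @ \oo --> (0 : R^o).
Proof.
have h : `|4^-1 : R| < 1 by rewrite gtr0_norm; lra.
have := cvg_geometric (4 / 3 * x) h.
by under eq_fun do rewrite /geometric/= mulrAC.
Qed.

Let hump_cvg x : cvgn (hump ^~ x : nat -> R^o).
Proof.
apply: cauchy_cvg; apply/cauchyP => e e0.
have /cvgrPdist_lt/(_ e e0)[N _ /(_ _ (leqnn N))/=] := geo_cvg `|x|.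
rewrite sub0r normrN => /(le_lt_trans (ler_norm _)) Ne.
exists (hump N x); exists N => // k /= Nk.
by rewrite -ball_normE/= distrC (le_lt_trans (hump_tailW _ Nk)).
Qed.

Let humplim x : R := limn (hump ^~ x : nat -> R^o).

Let humplim_tail n x : `|humplim x - hump n x| <= 4 / 3 * 4^-1 ^+ n * `|x|.
Proof.
have : (fun k => `|hump k x - hump n x|) @ \oo --> `|humplim x - hump n x|.
  apply: (@cvg_norm _ R^o); apply: (@cvgB _ R^o) => //; exact: cvg_cst.
move=> /cvgr_to_le; apply.
by near=> k; apply: hump_tailW; near: k; exact: nbhs_infty_ge.
Unshelve. all: by end_near. Qed.

Let humplimP : linear (humplim : Z -> R^o).
Proof.
move=> a u v; apply/cvg_lim => //; under eq_fun do rewrite humpP.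
by apply: (@cvgD _ R^o) => //; apply: (@cvgZr _ R^o).
Qed.

Lemma exists_hump : exists2 f : {linear Z -> R^o}, continuous f &
  forall n, 4^-1 ^+ n * `|z n| / 6 <= `|f (z n)|.
Proof.
pose f : {linear Z -> R^o} := HB.pack humplim
  (GRing.isLinear.Build R Z R^o *:%R _ humplimP).
exists f.
  apply: (@dual_continuous _ _ _ (4 / 3)) => x.
  by have := humplim_tail 0 x; rewrite /= subr0 expr0 mulr1.
(* 1/6 = 1/2 - 1/3: [hump_large] leaves half of 4^-n |z_n| after step n, and the tail from n + 1 on
   removes at most (4/3) 4^-(n+1) |z_n|, that is a third of it. *)
move=> n; have := humplim_tail n.+1 (z n); have := hump_large n.
have := lerB_dist (hump n.+1 (z n)) (humplim (z n)).
rewrite distrC -[f (z n)]/(humplim (z n)) exprS.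
set u := 4^-1 ^+ n; set v := `|z n|.
have -> : 4 / 3 * (4^-1 * u) * v = u * v / 3 by field.
by lra.
Qed.

End uniform_boundedness.

Lemma uniform_boundedness (R : realType) (Z : normedModType R) (S : set Z) :
  (forall f : {linear Z -> R^o}, continuous f ->
     exists c, forall z, S z -> `|f z| <= c) ->
  exists M, forall z, S z -> `|z| <= M.
Proof.
move=> Sw; apply: contrapT => /forallNP Snb.
(* The growth n 4^n outweighs the factor 4^-n / 6 of [exists_hump], so |f (z n)| exceeds n / 6. *)
have /choice[z zP] : forall n : nat, exists z, S z /\ n%:R * 4 ^+ n < `|z|.
  move=> n; have /existsNP[z /not_implyP[Sz /negP]] := Snb (n%:R * 4 ^+ n).
  by rewrite -ltNge; exists z.
have /choice[phi phiP] : forall n, exists f : {linear Z -> R^o},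
    dual_ball f /\ f (z n) = `|z n|.
  by move=> n; have [f fb fz] := norming_functional (z n); exists f.
have [f fc fz] := exists_hump (fun n => (phiP n).1) (fun n => (phiP n).2).
have [c Sc] := Sw _ fc.
pose n := (Num.truncn (6 * `|c|)).+1.
have nc : 6 * `|c| < n%:R by rewrite truncnS_gt.
have := Sc _ (zP n).1; have := fz n; have := (zP n).2.
rewrite -(@ltr_pM2l _ (4^-1 ^+ n)) ?exprn_gt0// mulrCA -exprMn mulVf// expr1n mulr1.
by have := ler_norm c; lra.
Qed.

(** * The gauges of the DFJP construction *)

Section geometric_bounds.
Context (R : realType).
Implicit Types (u : nat -> R) (A x L q : R).

Lemma sum_tail_le u q N M : 0 <= q < 1 ->
  (forall n, (N <= n)%N -> u n <= q ^+ n) -> (N <= M)%N ->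
  \sum_(N <= n < M) u n <= (1 - q)^-1 * (q ^+ N - q ^+ M).
Proof.
move=> /andP[q0 q1] uq NM; have q1' : 1 - q != 0 by rewrite gt_eqF// subr_gt0.
elim: M NM => [|M IH].
  by rewrite leqn0 => /eqP ->; rewrite big_geq// subrr mulr0.
rewrite leq_eqVlt => /predU1P[<-|]; first by rewrite big_geq// subrr mulr0.
rewrite ltnS => NM; rewrite big_nat_recr//= (le_trans (lerD (IH NM) (uq _ NM)))//.
by rewrite exprS le_eqVlt; apply/orP; left; apply/eqP; field.
Qed.

Lemma sum_tail_leW u q N M : 0 <= q < 1 ->
  (forall n, (N <= n)%N -> u n <= q ^+ n) ->
  \sum_(N <= n < M) u n <= (1 - q)^-1 * q ^+ N.
Proof.
move=> q01 uq; have [NM|MN] := leqP N M; last first.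
  rewrite big_geq; last exact: ltnW.
  by move: q01 => /andP[q0 q1]; rewrite mulr_ge0 ?exprn_ge0// invr_ge0 subr_ge0 ltW.
rewrite (le_trans (sum_tail_le q01 uq NM))//.
move: q01 => /andP[q0 q1].
apply: ler_wpM2l; first by rewrite invr_ge0 subr_ge0 ltW.
by rewrite gerDl oppr_le0 exprn_ge0.
Qed.

(** Let p be the least index with L <= A^p x. Before p the first bound grows up to x^2 A^(p-1) < L
    x; from p on the second decreases from L^2 A^-p <= L x. Each side adds up to at most L x / (1 -
    A^-1), whence the factor 2. *)
Lemma sum_two_sided_geometric u A x L N : 1 < A -> 0 < x -> 0 < L ->
  (forall n, 0 <= u n) ->
  (forall n, u n <= x ^+ 2 * A ^+ n) -> (forall n, u n <= L ^+ 2 * A ^- n) ->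
  \sum_(0 <= n < N) u n <= 2 / (1 - A^-1) * (L * x).
Proof.
move=> A1 x0 L0 u0 ux uL.
have A0 : 0 < A by exact: lt_trans A1.
have AV1 : A^-1 < 1 by rewrite invf_lt1.
have c0 : 0 < 1 - A^-1 by rewrite subr_gt0.
set c := (1 - A^-1)^-1; have cp : 0 < c by rewrite invr_gt0.
have head n : \sum_(0 <= i < n) u i <= c * x ^+ 2 * A ^+ n / A.
  elim: n => [|n IH]; first by rewrite big_geq// !mulr_ge0// ?invr_ge0 ltW.
  rewrite big_nat_recr//= (le_trans (lerD IH (ux n)))//.
  rewrite [A ^+ n.+1]exprS le_eqVlt; apply/orP; left; apply/eqP; rewrite /c; field.
  by rewrite (gt_eqF A0) subr_eq0 (gt_eqF A1).
have tail n M : (n <= M)%N -> \sum_(n <= i < M) u i <= c * L ^+ 2 * A^-1 ^+ n.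
  move=> nM.
  have := @sum_tail_leW (fun i => u i / L ^+ 2) A^-1 n M.
  rewrite invr_ge0 (ltW A0) AV1 => /(_ erefl) H.
  have /H : forall i, (n <= i)%N -> u i / L ^+ 2 <= A^-1 ^+ i.
    by move=> i _; rewrite ler_pdivrMr ?exprn_gt0// mulrC exprVn uL.
  by rewrite -mulr_suml ler_pdivrMr ?exprn_gt0// mulrAC.
have exp : exists p, L <= A ^+ p * x.
  have AV0 : `|A^-1| < 1 by rewrite gtr0_norm ?invr_gt0.
  have /cvgrPdist_lt/(_ _ (divr_gt0 x0 L0))[p _ /(_ p (leqnn p))/=] :=
    cvg_geometric 1 AV0.
  rewrite sub0r normrN mul1r ger0_norm ?exprn_ge0 ?invr_ge0 ?(ltW A0)// => h.
  exists p; rewrite mulrC -ler_pdivrMr ?exprn_gt0// -exprVn mulrC.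
  by rewrite -ler_pdivlMr// ltW.
have [p pP pmin] := ex_minnP exp.
have headp : \sum_(0 <= i < p) u i <= c * (L * x).
  case: p pP pmin => [|p] pP pmin.
    by rewrite big_geq// !mulr_ge0// ltW.
  rewrite (le_trans (head _))//.
  have -> : c * x ^+ 2 * A ^+ p.+1 / A = c * ((A ^+ p * x) * x).
    by rewrite [A ^+ p.+1]exprS; field; rewrite gt_eqF.
  apply: ler_wpM2l; first exact: ltW.
  rewrite ler_wpM2r ?(ltW x0)// ltW// ltNge; apply/negP => /pmin.
  by rewrite ltnn.
have tailp M : (p <= M)%N -> \sum_(p <= i < M) u i <= c * (L * x).
  move=> pM; rewrite (le_trans (tail _ _ pM))// -!mulrA.
  apply: ler_wpM2l; first exact: ltW.
  apply: ler_wpM2l; first exact: ltW.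
  by rewrite exprVn ler_pdivrMr ?exprn_gt0// mulrC.
have -> : 2 / (1 - A^-1) * (L * x) = c * (L * x) + c * (L * x).
  by rewrite -/c mulrDl mul1r mulrDl.
have [Np|pN] := leqP N p.
  rewrite -[X in X <= _]addr0 lerD//; last by rewrite !mulr_ge0// ltW.
  rewrite (le_trans _ headp)// [X in _ <= X](big_cat_nat (leq0n N) Np)/= lerDl.
  by rewrite sumr_ge0.
by rewrite (big_cat_nat (leq0n p) (ltnW pN))/= lerD// tailp// ltnW.
Qed.

End geometric_bounds.

Lemma nneseries_cvg_le (R : realType) (u : nat -> R) m (B : R) :
  (forall n, 0 <= u n) -> (forall N, \sum_(m <= n < N) u n <= B) ->
  (\sum_(m <= n <oo) (u n)%:E <= B%:E)%E.
Proof.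
move=> u0 uB; apply: lime_le; first by apply: is_cvg_nneseries => *; rewrite lee_fin.
by apply: nearW => N; rewrite sumEFin lee_fin.
Qed.

(** * The base of the construction: existence of a solution of f(a) = 1 *)

Section base.
Context (R : realType).
Implicit Types (a b : R) (n N : nat).

Let t n a := (a ^+ n / (a ^+ (2 * n) + 1)) ^+ 2.
Let S N a := \sum_(1 <= n < N) t n a.

Let t_ge0 n a : 0 <= t n a. Proof. exact: sqr_ge0. Qed.

Let t_le n a b : 0 < b -> b <= a -> t n a <= (b ^- 2) ^+ n.
Proof.
move=> b0 ba; have a0 : 0 < a by exact: lt_le_trans ba.
have an0 : 0 < a ^+ n by rewrite exprn_gt0.
have bn0 : 0 < b ^+ n by rewrite exprn_gt0.
have -> : (b ^- 2) ^+ n = ((b ^+ n)^-1) ^+ 2.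
  by rewrite -!exprVn -!exprM mulnC.
have d0 : 0 < (a ^+ n) ^+ 2 + 1 by rewrite ltr_wpDl ?sqr_ge0.
rewrite /t mulnC exprM ler_pXn2r ?nnegrE ?invr_ge0 ?(ltW bn0)//; last first.
  by rewrite divr_ge0// ltW.
rewrite ler_pdivrMr// mulrC ler_pdivlMr//.
rewrite (@le_trans _ _ ((a ^+ n) ^+ 2))//; last by rewrite lerDl.
rewrite expr2 ler_wpM2l ?(ltW an0)//.
by case: n an0 bn0 d0 => // n _ _ _; rewrite ler_pXn2r ?nnegrE ?(ltW b0) ?(ltW a0).
Qed.

Let S_le N M a b : (0 < N)%N -> 1 < b -> b <= a ->
  S M a <= S N a + (1 - b ^- 2)^-1 * (b ^- 2) ^+ N.
Proof.
move=> N1 b1 ba; have b0 : 0 < b by exact: lt_trans b1.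
have q01 : 0 <= b ^- 2 < 1.
  by rewrite invr_ge0 exprn_ge0 ?(ltW b0)//= invf_lt1 ?exprn_gt0// exprn_egt1.
have tq n : (N <= n)%N -> t n a <= (b ^- 2) ^+ n by move=> _; exact: t_le.
have c0 : 0 <= (1 - b ^- 2)^-1 * (b ^- 2) ^+ N.
  by move: q01 => /andP[q0 q1]; rewrite mulr_ge0 ?exprn_ge0// invr_ge0 subr_ge0 ltW.
rewrite /S; have [NM|MN] := leqP N M.
  by rewrite (big_cat_nat N1 NM)/= lerD2l sum_tail_leW.
rewrite -[X in X <= _]addr0 lerD//.
have [M1|M1] := leqP 1 M; last by rewrite big_geq ?sumr_ge0// ltnW.
by rewrite [X in _ <= X](big_cat_nat M1 (ltnW MN))/= lerDl sumr_ge0.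
Qed.

(** The geometric tail depends on [b] alone, so the partial sum approximates f^2 uniformly on [b,
    +oo); this gives both numeric bounds at given points and continuity. It also shows that the
    series is finite, so that the [fine] in [dfjp_f] loses nothing. *)
Lemma dfjp_fE a b N : (0 < N)%N -> 1 < b -> b <= a ->
  S N a <= dfjp_f a ^+ 2 <= S N a + (1 - b ^- 2)^-1 * (b ^- 2) ^+ N /\
  (\sum_(1 <= n <oo) (t n a)%:E = (dfjp_f a ^+ 2)%:E)%E.
Proof.
move=> N1 b1 ba.
have ub : (\sum_(1 <= n <oo) (t n a)%:E <=
    (S N a + (1 - b ^- 2)^-1 * (b ^- 2) ^+ N)%:E)%E.
  by apply: nneseries_cvg_le => // M; exact: S_le.
have lb M : ((S M a)%:E <= \sum_(1 <= n <oo) (t n a)%:E)%E.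
  rewrite -sumEFin; apply: nneseries_lim_ge => n _ _; by rewrite lee_fin.
have s0 : (0 <= \sum_(1 <= n <oo) (t n a)%:E)%E.
  by apply: nneseries_ge0 => *; rewrite lee_fin.
have fin : (\sum_(1 <= n <oo) (t n a)%:E)%E \is a fin_num.
  by rewrite ge0_fin_numE// (le_lt_trans ub)// ltry.
have E : (\sum_(1 <= n <oo) (t n a)%:E = (dfjp_f a ^+ 2)%:E)%E.
  by rewrite /dfjp_f sqr_sqrtr ?fine_ge0// fineK.
by rewrite -!lee_fin -E lb.
Qed.

Let f_continuous a b : 1 < b -> b < a -> {for a, continuous (fun x => dfjp_f x ^+ 2)}.
Proof.
move=> b1 ba; apply/(@cvgrPdist_le _ R^o) => e e0.
have b0 : 0 < b by exact: lt_trans b1.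
have q1 : `|b ^- 2| < 1.
  by rewrite gtr0_norm ?invr_gt0 ?exprn_gt0// invf_lt1 ?exprn_gt0// exprn_egt1.
have e3 : 0 < e / 3 by rewrite divr_gt0.
have /cvgrPdist_lt/(_ _ e3)[N _ /(_ N.+1 (leqnSn N))/=] :=
  cvg_geometric (1 - b ^- 2)^-1 q1.
rewrite sub0r normrN => /(le_lt_trans (ler_norm _)) Ne.
have Sc : S N.+1 x @[x --> a] --> S N.+1 a.
  rewrite /S; apply: cvg_big => [|n _]; first exact: (@add_continuous R^o).
  have a0 : 0 < a by exact: lt_trans ba.
  have h : x ^+ n / (x ^+ (2 * n) + 1) @[x --> a] --> a ^+ n / (a ^+ (2 * n) + 1).
    apply: cvgM; first exact: exprn_continuous.
    apply: cvgV; first by rewrite gt_eqF// ltr_wpDl// exprn_ge0// ltW.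
    by apply: cvgD; [exact: exprn_continuous|exact: cvg_cst].
  exact: cvgM.
near=> x.
have bx : b <= x by apply/ltW; near: x; exact: lt_nbhsr.
have [/andP[xl xu] _] := dfjp_fE (ltn0Sn N) b1 bx.
have [/andP[al au] _] := dfjp_fE (ltn0Sn N) b1 (ltW ba).
have : `|S N.+1 a - S N.+1 x| < e / 3 by near: x; move/(@cvgrPdist_lt _ R^o) : Sc; apply.
rewrite ltr_norml ler_norml => /andP[]; lra.
Unshelve. all: by end_near. Qed.

Let dfjp_f_ge0 a : 0 <= dfjp_f a. Proof. exact: sqrtr_ge0. Qed.

Lemma dfjp_f_eq1 : exists a : R, 1 < a /\ dfjp_f a = 1.
Proof.
(* Any number strictly between 1 and 11/10, the left end of the interval for the intermediate value
   theorem. *)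
have b1 : 1 < 21 / 20 :> R by lra.
(* With N = 1 the partial sum is empty, and the whole series is below its geometric majorant 1/3. *)
have f2 : dfjp_f (2 : R) ^+ 2 <= 1.
  have [|/andP[_ h] _] := @dfjp_fE 2 2 1%N erefl _ (lexx _); first by lra.
  rewrite (le_trans h)// /S big_geq// add0r expr1.
  by have -> : (1 - 2 ^- 2)^-1 * 2 ^- 2 = 1 / 3 :> R; [field|lra].
(* Seven terms suffice: u = (11/10)^n lies in [1, 2] for n <= 7, where u / (u^2 + 1) >= 2/5, and
   seven times 4/25 exceeds 1. *)
have f1 : 1 <= dfjp_f (11 / 10 : R) ^+ 2.
  have [||/andP[h _] _] := @dfjp_fE (11 / 10) (21 / 20) 8%N erefl; [lra..|].
  rewrite (le_trans _ h)// /S.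
  have t5 n : (n <= 7)%N -> 4 / 25 <= t n (11 / 10).
    move=> n7; rewrite /t mulnC exprM; set u := (11 / 10) ^+ n.
    have u1 : 1 <= u by rewrite exprn_ege1//; lra.
    have u2 : u <= 2.
      rewrite (@le_trans _ _ ((11 / 10) ^+ 7))//; last by lra.
      by rewrite ler_weXn2l//; lra.
    have -> : 4 / 25 = (2 / 5) ^+ 2 :> R by field.
    have d0 : 0 < u ^+ 2 + 1 by rewrite ltr_wpDl ?sqr_ge0.
    have u0 : 0 <= u by lra.
    rewrite ler_pXn2r ?nnegrE ?divr_ge0 ?(ltW d0)// ler_pdivlMr// expr2.
    by have : 0 <= (u - 1) * (2 - u); [rewrite mulr_ge0// subr_ge0|nra].
  rewrite (@le_trans _ _ (\sum_(1 <= n < 8) (4 / 25 : R)))//.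
    by rewrite sumr_const_nat -[(8 - 1)%N]/7%N -mulr_natr; lra.
  by apply: ler_sum_nat => n /andP[_ n8]; exact: t5.
have [|||c] := @IVT R (fun x : R => dfjp_f x ^+ 2) (11 / 10) 2 1.
- by lra.
- apply: continuous_in_subspaceT => x; rewrite inE/= in_itv/= => /andP[xl _].
  by apply: (f_continuous b1); lra.
- by rewrite ge_min le_max f1 f2 orbT.
- rewrite in_itv/= => /andP[c1 c2] fc; exists c; split; first by lra.
  by apply/eqP; rewrite -(@eqrXn2 _ 2) ?expr1n ?fc.
Qed.

Lemma lno_baseE : dfjp_f (lno_base R) = 1.
Proof.
rewrite /lno_base; case: xgetP => [a _ []//|none].
by have [a /none] := dfjp_f_eq1.
Qed.

End base.

(** * Bounds for the gauges, and the interpolation inequality *)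

Section gauge.
Context (R : realType) (X : completeNormedModType R) (K : dfjp_body X).
Local Notation a := (lno_base R).
Implicit Types (x y k : X) (n : nat).

Let a1 : 1 < a. Proof. exact: lno_base_gt1. Qed.
Let a0 : 0 < a. Proof. exact: lt_trans a1. Qed.
Let an0 n : 0 < a ^+ n. Proof. exact: exprn_gt0. Qed.

(** Equal to (a^n + a^-n)^-1, the inverse of the radius of a ball that contains K_n. The squares are
    the terms of the series for f(a)^2. *)
Definition dfjp_coef n : R := a ^+ n / (a ^+ (2 * n) + 1).

Let coef_ge0 n : 0 <= dfjp_coef n.
Proof. by rewrite divr_ge0 ?addr_ge0 ?ltW. Qed.

Lemma dfjp_coef_sum : (\sum_(1 <= n <oo) ((dfjp_coef n) ^+ 2)%:E = 1 :> \bar R)%E.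
Proof.
have [_ ->] := dfjp_fE (ltn0Sn 0) a1 (lexx a).
by rewrite lno_baseE expr1n.
Qed.

Let gauge_le n x t : 0 < t -> (exists2 y, dfjp_Kn K n y & x = t *: y) ->
  dfjp_gauge K n x <= t.
Proof. by move=> t0 xt; apply: ge_inf => //; exists 0 => u [/ltW]. Qed.

Lemma dfjp_gauge_le n k : dfjp_set K k -> dfjp_gauge K n k <= dfjp_coef n.
Proof.
move=> Kk; apply: gauge_le; first by rewrite divr_gt0// addr_gt0.
(* As [K] lies in the unit ball, [k] can be taken for both summands. *)
exists (a ^+ n *: k + a ^- n *: k).
  by exists k => //; exists k => //; exact: dfjp_subball Kk.
rewrite -scalerDl scalerA /dfjp_coef [X in X *: _](_ : _ = 1) ?scale1r//.
have h : a ^+ (2 * n) + 1 != 0 by rewrite gt_eqF// addr_gt0.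
by rewrite mulnC exprM in h *; field; rewrite h gt_eqF.
Qed.

Lemma dfjp_gauge_le_body n k (L : R) : 0 <= L -> dfjp_set K k ->
  dfjp_gauge K n (L *: k) <= L * a ^- n.
Proof.
move=> L0 Kk; rewrite dfjp_gaugeZ ger0_norm// ler_wpM2l//.
apply: gauge_le; first by rewrite invr_gt0.
exists (a ^+ n *: k + a ^- n *: 0).
  by exists k => //; exists 0 => //=; rewrite normr0.
by rewrite scaler0 addr0 scalerA mulVf ?scale1r// gt_eqF.
Qed.

Lemma dfjp_gauge_le_norm n x : dfjp_gauge K n x <= a ^+ n * `|x|.
Proof.
have g0 : dfjp_gauge K n 0 = 0 by rewrite -(scale0r 0) dfjp_gaugeZ normr0 mul0r.
have := dfjp_gauge_dist K n x 0; rewrite g0 !subr0.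
exact/le_trans/ler_norm.
Qed.

Lemma dfjp_gauge_ge n x : dfjp_coef n * `|x| <= dfjp_gauge K n x.
Proof.
have -> : dfjp_gauge K n x = dfjp_coef n * ((a ^+ n + a ^- n) * dfjp_gauge K n x).
  rewrite mulrA [X in X * _](_ : _ = 1) ?mul1r//.
  have h : a ^+ (2 * n) + 1 != 0 by rewrite gt_eqF// addr_gt0.
  by rewrite /dfjp_coef mulnC exprM in h *; field; rewrite h gt_eqF.
by rewrite ler_wpM2l// norm_le_dfjp_gauge.
Qed.

Lemma dfjp_sum_le1 k : dfjp_set K k -> (dfjp_sum K k <= 1)%E.
Proof.
move=> Kk; rewrite -dfjp_coef_sum; apply: lee_nneseries => [n _ _|n _].
  by rewrite lee_fin sqr_ge0.
by rewrite lee_fin ler_pXn2r ?nnegrE ?dfjp_gauge_ge0// dfjp_gauge_le.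
Qed.

Lemma dfjp_domZ (L : R) k : dfjp_set K k -> L *: k \in dfjp_dom K.
Proof. by move=> Kk; rewrite rpredZ// /in_mem/= /dfjp_dom (le_lt_trans (dfjp_sum_le1 Kk))// ltry. Qed.

Lemma dfjp_norm_leZ (L : R) k : dfjp_set K k -> dfjp_norm K (L *: k) <= `|L|.
Proof.
move=> Kk; have kK : k \in dfjp_dom K by rewrite -(scale1r k) dfjp_domZ.
rewrite dfjp_normZ// ler_piMr// -(@ler_pXn2r _ 2) ?nnegrE ?dfjp_norm_ge0//.
by rewrite expr1n -lee_fin -dfjp_sumE// dfjp_sum_le1.
Qed.

Lemma norm_le_dfjp_norm x : x \in dfjp_dom K -> `|x| <= dfjp_norm K x.
Proof.
move=> xK; rewrite -(@ler_pXn2r _ 2) ?nnegrE ?dfjp_norm_ge0//.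
rewrite -lee_fin -dfjp_sumE// -[X in (X <= _)%E]mule1 -dfjp_coef_sum -nneseriesZl; last first.
  by move=> *; rewrite lee_fin sqr_ge0.
apply: lee_nneseries => [n _ _|n _]; first by rewrite -EFinM lee_fin mulr_ge0 ?sqr_ge0.
rewrite -EFinM lee_fin -exprMn ler_pXn2r ?nnegrE ?dfjp_gauge_ge0//; last first.
  exact: mulr_ge0 (normr_ge0 _) (coef_ge0 _).
by rewrite mulrC dfjp_gauge_ge.
Qed.

(** The bound of [sum_two_sided_geometric] at A = a^2, the ratio of the bounds for the squared
    gauges. It involves neither the space nor [K], which makes it universal. *)
Definition lno_const : R := 2 / (1 - (a ^+ 2)^-1).

Lemma lno_const_gt1 : 1 < lno_const.
Proof.
have h : (a ^+ 2)^-1 < 1 by rewrite invf_lt1 ?exprn_gt0// exprn_egt1.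
have h0 : 0 < (a ^+ 2)^-1 by rewrite invr_gt0 exprn_gt0.
by rewrite /lno_const ltr_pdivlMr; lra.
Qed.

(* The n-th gauge is at most min(L a^-n, a^n |x|): a geometric sequence on each
   side of the index where the two bounds cross. *)
Lemma dfjp_interpolation (L : R) k : 0 <= L -> dfjp_set K k ->
  dfjp_norm K (L *: k) ^+ 2 <= lno_const * (L * `|L *: k|).
Proof.
move=> L0 Kk; have xK := dfjp_domZ L Kk.
have n0 : dfjp_norm K 0 = 0 by have := dfjp_normZ 0 xK; rewrite scale0r normr0 mul0r.
have [/eqP|x0] := eqVneq (L *: k) 0.
  by move=> /eqP ->; rewrite n0 normr0 !mulr0 expr0n.
have Lp : 0 < L.
  by rewrite lt_neqAle L0 andbT; apply: contra x0 => /eqP <-; rewrite scale0r.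
have xp : 0 < `|L *: k| by rewrite normr_gt0.
rewrite -lee_fin -dfjp_sumE//; apply: nneseries_cvg_le => [n|N]; first exact: sqr_ge0.
(* The series of the construction starts at n = 1 and [sum_two_sided_geometric] at 0: a non-negative
   term is added. *)
rewrite (@le_trans _ _ (\sum_(0 <= n < N) dfjp_gauge K n (L *: k) ^+ 2))//.
  case: N => [|N]; first by rewrite !big_geq.
  by rewrite [X in _ <= X]big_nat_recl// big_add1/= lerDr sqr_ge0.
apply: sum_two_sided_geometric => // [|n|n|n].
- by rewrite exprn_egt1.
- exact: sqr_ge0.
- rewrite -exprM mulnC exprM -exprMn ler_pXn2r ?nnegrE ?dfjp_gauge_ge0//.
    by rewrite mulrC dfjp_gauge_le_norm.
  by rewrite mulr_ge0// ltW.
- rewrite -exprM mulnC exprM -exprVn -exprMn ler_pXn2r ?nnegrE ?dfjp_gauge_ge0//.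
    exact: dfjp_gauge_le_body.
  by rewrite mulr_ge0// invr_ge0 ltW.
Qed.

End gauge.

(** * Variation of a vector measure *)

Section variation.
Context d (T : measurableType d) (R : realType) (V : normedZmodType R).
Variable nu : set T -> V.
Implicit Types A B : set T.

Let part n (F : 'I_n -> set T) A :=
  [/\ forall i, measurable (F i), trivIset setT F & \bigcup_i F i = A].

Let vvariation_ge n (F : 'I_n -> set T) A : part F A ->
  ((\sum_(i < n) `|nu (F i)|)%:E <= vvariation nu A)%E.
Proof. by move=> [mF tF FA]; apply: ereal_sup_ubound; exists n, F. Qed.

Lemma vvariation_le A (M : \bar R) :
  (forall n (F : 'I_n -> set T), (forall i, measurable (F i)) -> trivIset setT F ->
    \bigcup_i F i = A -> ((\sum_(i < n) `|nu (F i)|)%:E <= M)%E) ->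
  (vvariation nu A <= M)%E.
Proof. by move=> AM; apply: ge_ereal_sup => _ [n [F [mF tF FA ->]]]; exact: AM. Qed.

Let part_const A : measurable A -> @part 1 (fun=> A) A.
Proof.
move=> mA; split=> //; first by move=> i j _ _ _; rewrite !ord1.
by apply/seteqP; split=> [x [_ _]//|x Ax]; exists ord0.
Qed.

Lemma norm_le_vvariation A : measurable A -> ((`|nu A|)%:E <= vvariation nu A)%E.
Proof.
move=> mA; have := vvariation_ge (part_const mA).
by rewrite big_ord_recl big_ord0 addr0.
Qed.

Lemma vvariation_ge0 A : measurable A -> (0 <= vvariation nu A)%E.
Proof. by move=> /norm_le_vvariation; apply: le_trans; rewrite lee_fin. Qed.

Lemma vvariation0 : nu set0 = 0 -> vvariation nu set0 = 0%E.
Proof.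
move=> nu0; apply/eqP; rewrite eq_le vvariation_ge0// andbT.
apply: vvariation_le => n F _ _ F0; rewrite big1// => i _.
suff -> : F i = set0 by rewrite nu0 normr0.
by rewrite -subset0 -F0; exact: bigcup_sup.
Qed.

Let part_cat n m (F : 'I_n -> set T) (G : 'I_m -> set T) A B :
  A `&` B = set0 -> part F A -> part G B ->
  part (fun i : 'I_(n + m) => match fintype.split i with inl j => F j | inr j => G j end)
    (A `|` B).
Proof.
move=> AB [mF tF FA] [mG tG GB].
have FG i j x : F i x -> G j x -> False.
  move=> Fx Gx; have : (A `&` B) x by split; [rewrite -FA; exists i|rewrite -GB; exists j].
  by rewrite AB.
split.
- by move=> i; case: (fintype.split i).
- move=> i j _ _; rewrite -[X in X = _](splitK i) -[X in _ = X](splitK j).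
  case: (fintype.split i) => i'; case: (fintype.split j) => j' [x [xi xj]] /=.
  + by rewrite (tF i' j')//; exists x.
  + by have := FG _ _ _ xi xj.
  + by have := FG _ _ _ xj xi.
  + by rewrite (tG i' j')//; exists x.
- rewrite -FA -GB; apply/seteqP; split=> [x [i _]|x [[i _ Fx]|[i _ Gx]]].
  + by case: (fintype.split i) => j xj; [left|right]; exists j.
  + by exists (lshift m i) => //; rewrite -[lshift m i]/(unsplit (inl i)) unsplitK.
  + by exists (rshift n i) => //; rewrite -[rshift n i]/(unsplit (inr i)) unsplitK.
Qed.

Let vvariation_ge_cat n m (F : 'I_n -> set T) (G : 'I_m -> set T) A B :
  A `&` B = set0 -> part F A -> part G B ->
  ((\sum_(i < n) `|nu (F i)| + \sum_(i < m) `|nu (G i)|)%:E <=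
    vvariation nu (A `|` B))%E.
Proof.
move=> AB FA GB; have := vvariation_ge (part_cat AB FA GB).
rewrite big_split_ord/=.
under eq_bigr do rewrite -[lshift m _]/(unsplit (inl _)) unsplitK.
by under [X in _ + X]eq_bigr do rewrite -[rshift n _]/(unsplit (inr _)) unsplitK.
Qed.

Lemma vvariation_ge2 A B : measurable A -> measurable B -> A `&` B = set0 ->
  ((`|nu A| + `|nu B|)%:E <= vvariation nu (A `|` B))%E.
Proof.
move=> mA mB AB; have := vvariation_ge_cat AB (part_const mA) (part_const mB).
by rewrite !big_ord_recl !big_ord0 !addr0.
Qed.

Lemma vvariationU_ge A B : measurable A -> measurable B -> A `&` B = set0 ->
  (vvariation nu A + vvariation nu B <= vvariation nu (A `|` B))%E.
Proof.
move=> mA mB AB.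
have [->|Coo] := eqVneq (vvariation nu (A `|` B)) +oo%E; first by rewrite leey.
have Cfin : vvariation nu (A `|` B) \is a fin_num.
  by rewrite ge0_fin_numE ?vvariation_ge0//; [rewrite ltey|exact: measurableU].
(* The supremum is taken first over partitions of [B], with the partition [F] of [A] fixed, and then
   over [F]; the subtraction in between relies on finiteness. *)
have H n (F : 'I_n -> set T) : part F A ->
    (vvariation nu B <= vvariation nu (A `|` B) - (\sum_(i < n) `|nu (F i)|)%:E)%E.
  move=> FA; apply: vvariation_le => m G mG tG GB.
  by rewrite leeBrDl// -EFinD; exact: vvariation_ge_cat.
have Bfin : vvariation nu B \is a fin_num.
  rewrite ge0_fin_numE ?vvariation_ge0// (le_lt_trans (H _ _ (part_const mA)))//.
  by rewrite ltey_eq fin_numB Cfin.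
rewrite -leeBrDr//; apply: vvariation_le => n F mF tF FA.
rewrite leeBrDr// addeC -leeBrDr//; exact: H.
Qed.

Lemma le_vvariation A B : measurable A -> measurable B -> A `<=` B ->
  (vvariation nu A <= vvariation nu B)%E.
Proof.
move=> mA mB AB; rewrite -(setDUK AB).
have mBA : measurable (B `\` A) by exact: measurableD.
rewrite (le_trans _ (vvariationU_ge mA mBA _)) ?setDIK//.
by rewrite leeDl// vvariation_ge0.
Qed.

Lemma vvariation_bigsetU_ge (F : (set T)^nat) n : nu set0 = 0 ->
  (forall i, measurable (F i)) -> trivIset setT F ->
  (\sum_(0 <= i < n) vvariation nu (F i) <=
    vvariation nu (\big[setU/set0]_(0 <= i < n) F i))%E.
Proof.
move=> nu0 mF tF; elim: n => [|n IH]; first by rewrite !big_geq// vvariation0.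
rewrite !big_nat_recr//= (le_trans (leeD2r _ IH))//.
apply: vvariationU_ge => //; first exact: bigsetU_measurable.
rewrite big_mkord (@trivIset_bigsetUI _ xpredT)//; exact: sub_trivIset tF.
Qed.

End variation.

Section vector_measure_theory.
Context d (T : measurableType d) (R : realType) (Z : normedModType R).
Variable nu : set T -> Z.
Hypothesis num : vector_measure nu.
Implicit Types A B : set T.

(** The empty set repeated is a disjoint sequence, so the constant series of [nu set0] converges and
    its general term tends to 0. *)
Lemma vector_measure0 : nu set0 = 0.
Proof.
have := num (fun=> measurable0) (@trivIset_set0 _ _ setT).
rewrite bigcup0//; under eq_fun do rewrite sumr_const_nat subn0.
move=> h; have h1 : (fun n => nu set0 *+ n.+1) @ \oo --> nu set0.
  by move: h; rewrite -cvg_shiftS.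
have h2 : (fun _ : nat => nu set0) @ \oo --> (0 : Z).
  rewrite (_ : (fun=> _) = (fun n => nu set0 *+ n.+1 - nu set0 *+ n)).
    by rewrite -(subrr (nu set0)); exact: cvgB.
  by apply/funext => n; rewrite mulrS addrK.
by apply: (cvg_unique _ (cvg_cst _) h2).
Qed.

Lemma vector_measureU A B : measurable A -> measurable B -> A `&` B = set0 ->
  nu (A `|` B) = nu A + nu B.
Proof.
move=> mA mB AB.
have mF i : measurable (bigcup2 A B i) by case: i => [|[|i]] //=.
have tF : trivIset setT (bigcup2 A B).
  move=> [|[|i]] [|[|j]] _ _ //=; rewrite ?set0I ?setI0 ?AB 1?(setIC B) ?AB//;
    by case.
have := num mF tF; rewrite bigcup2E => h.
have h2 : (fun n => \sum_(0 <= i < n) nu (bigcup2 A B i)) @ \oo --> nu A + nu B.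
  rewrite -(cvg_shiftn 2).
  under eq_fun do rewrite addn2 !big_nat_recl//= big1 ?vector_measure0// addr0.
  exact: cvg_cst.
exact: cvg_unique h h2.
Qed.

Lemma vector_measureID A B : measurable A -> measurable B ->
  nu A = nu (A `&` B) + nu (A `\` B).
Proof.
move=> mA mB; rewrite -vector_measureU//.
- by rewrite setUIDK.
- exact: measurableI.
- exact: measurableD.
- by rewrite setDE setIACA setICr setI0.
Qed.

Lemma vector_measure_bigsetU n (F : (set T)^nat) :
  (forall i, measurable (F i)) -> trivIset setT F ->
  nu (\big[setU/set0]_(0 <= i < n) F i) = \sum_(0 <= i < n) nu (F i).
Proof.
move=> mF tF; elim: n => [|n IH]; first by rewrite !big_geq// vector_measure0.
rewrite !big_nat_recr//= vector_measureU ?IH//; first exact: bigsetU_measurable.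
rewrite big_mkord (@trivIset_bigsetUI _ xpredT)//; exact: sub_trivIset tF.
Qed.

Lemma vector_measure_comp (Z' : normedModType R) (f : {linear Z -> Z'}) :
  continuous f -> vector_measure (f \o nu).
Proof.
move=> fc F mF tF; under eq_fun do rewrite -linear_sum.
by apply: continuous_cvg; [exact: fc|exact: num].
Qed.

(** Superadditivity on finite unions gives one inequality. For the other, each piece [G i] of a
    partition of the union is cut along the [F j]; for fixed j the resulting pieces partition
    [F j]. *)
Lemma vvariation_semi_sigma_additive : semi_sigma_additive (vvariation nu).
Proof.
move=> F mF tF mUF.
have v0 i : (0 <= vvariation nu (F i))%E by exact: vvariation_ge0.
have -> : vvariation nu (\bigcup_i F i) = (\sum_(0 <= i <oo) vvariation nu (F i))%E.
  apply/eqP; rewrite eq_le; apply/andP; split; last first.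
    apply: lime_le; first exact: is_cvg_nneseries.
    apply: nearW => n; rewrite (le_trans (vvariation_bigsetU_ge n vector_measure0 mF tF))//.
    apply: le_vvariation => //; first exact: bigsetU_measurable.
    by rewrite big_mkord; exact: bigsetU_bigcup.
  apply: vvariation_le => n G mG tG GU.
  have GF i : ((`|nu (G i)|)%:E <= \sum_(0 <= j <oo) (`|nu (G i `&` F j)|)%:E)%E.
    have mGF j : measurable (G i `&` F j) by exact: measurableI.
    have tGF : trivIset setT (fun j => G i `&` F j) by exact: trivIset_setIl.
    have /(cvg_norm) := num mGF tGF.
    rewrite -setI_bigcupr -GU setIidl; last exact: bigcup_sup.
    move=> h; have /cvg_lim <- // : ((fun n => (`|\sum_(0 <= j < n) nu (G i `&` F j)|)%:E) @ \oo --> (`|nu (G i)|)%:E)%E.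
      by apply: cvg_comp h _; exact: cvg_id.
    apply: lee_lim.
    - by apply/cvg_ex; exists (`|nu (G i)|)%:E; apply: cvg_comp h _; exact: cvg_id.
    - by apply: is_cvg_nneseries => *; rewrite lee_fin.
    - by apply: nearW => k; rewrite sumEFin lee_fin ler_norm_sum.
  rewrite -sumEFin (le_trans (lee_sum _ (fun i _ => GF i)))//.
  rewrite -nneseries_sum; last by move=> *; rewrite lee_fin.
  apply: lee_nneseries => [j _ _|j _]; first by rewrite sume_ge0// => *; rewrite lee_fin.
  rewrite sumEFin; apply: ereal_sup_ubound; exists n, (fun i => G i `&` F j).
  split=> //; first by move=> i; exact: measurableI.
  - by apply: trivIset_setIr.
  - by rewrite -setI_bigcupl GU setIC setIidl//; exact: bigcup_sup.
exact: is_cvg_nneseries.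
Qed.

End vector_measure_theory.

(** * Scalar measures: Jordan decomposition and signed integrals *)

Section integral_set_function.
Import HBNNSimple.
Context d (T : measurableType d) (R : realType).
Implicit Types (mu : set T -> \bar R) (D : set T) (f : T -> \bar R).

(** The integral is built from simple functions, which evaluate the set function at measurable level
    sets only. This exchanges a variation, defined on all subsets, for a packaged measure. *)
Lemma eq_integral_set_function mu mu' D f :
  (forall A, measurable A -> mu A = mu' A) ->
  (\int[mu]_(x in D) f x = \int[mu']_(x in D) f x)%E.
Proof.
move=> mumu'.
have S (h : {nnsfun T >-> R}) : sintegral mu h = sintegral mu' h.
  by rewrite /sintegral; apply: eq_fsbigr => x _; rewrite mumu'.
rewrite /integral; congr (ereal_sup _ - ereal_sup _)%E;
  by apply/seteqP; split=> _ [h hf <-]; exists h => //; rewrite S.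
Qed.

Lemma measure_of_vvariation (Z : normedModType R) (nu : set T -> Z) :
  vector_measure nu -> exists mu : {measure set T -> \bar R},
    forall A, measurable A -> vvariation nu A = mu A.
Proof.
(* Off the sigma-algebra the variation is a supremum over the empty set, hence -oo, while a packaged
   measure has to be non-negative on every subset. *)
move=> num; pose mu A := if pselect (measurable A) then vvariation nu A else 0%E.
have muE A : measurable A -> mu A = vvariation nu A.
  by rewrite /mu => mA; case: pselect.
have mu0 : mu set0 = 0%E by rewrite muE// vvariation0// vector_measure0.
have muge0 A : (0 <= mu A)%E.
  by rewrite /mu; case: pselect => // mA; exact: vvariation_ge0.
have mus : semi_sigma_additive mu.
  move=> F mF tF mUF; rewrite muE//; under eq_fun do under eq_bigr do rewrite muE//.
  exact: vvariation_semi_sigma_additive.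
pose m : {measure set T -> \bar R} :=
  HB.pack mu (isMeasure.Build _ T R mu mu0 muge0 mus).
by exists m => A mA; rewrite -muE.
Qed.

(** For a Hahn decomposition P, N the measures p and n are [lam] on P and [- lam] on N. Cutting a
    set into these two parts shows that the variation over partitions is p + n, from which both
    half-sums are computed. *)
Lemma signed_decomposition (lam : set T -> R) :
  vector_measure (lam : set T -> R^o) ->
  exists (p n : {finite_measure set T -> \bar R}) (P : set T),
  [/\ measurable P, p (~` P) = 0%E, n P = 0%E &
      forall A, measurable A ->
        [/\ vvariation lam A = (p A + n A)%E, positive_variation lam A = p A,
            negative_variation lam A = n A & lam A = fine (p A) - fine (n A)]].
Proof.
move=> lamm; pose mu (A : set T) := (lam A)%:E.
have mu0 : mu set0 = 0%E by rewrite /mu (vector_measure0 lamm).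
have muf A : measurable A -> mu A \is a fin_num by [].
have mus : semi_sigma_additive mu.
  move=> F mF tF _; rewrite /mu; under eq_fun do rewrite sumEFin.
  by apply: cvg_EFin; [exact: nearW|exact: lamm].
pose m : {charge set T -> \bar R} := HB.pack mu (isCharge.Build _ T R mu mu0 muf mus).
have [P [N PN]] := Hahn_decomposition m.
have [[mP posP] [mN negN] PNT PN0] := PN.
have pE A : measurable A -> jordan_pos PN A = (lam (A `&` P))%:E.
  by move=> mA; rewrite jordan_posE cjordan_posE /crestr0 mem_set.
have nE A : measurable A -> jordan_neg PN A = (- lam (A `&` N))%:E.
  by move=> mA; rewrite jordan_negE cjordan_negE /crestr0 mem_set.
have lamE A : measurable A -> lam A = lam (A `&` P) + lam (A `&` N).
  move=> mA; have := @charge_partition _ _ _ m A P N mA mP mN PNT PN0.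
  by rewrite /= /mu -EFinD => -[].
have lP A : measurable A -> 0 <= lam (A `&` P).
  move=> mA; rewrite -lee_fin; apply: posP; last exact: subIsetr.
  exact: measurableI.
have lN A : measurable A -> lam (A `&` N) <= 0.
  move=> mA; rewrite -lee_fin; apply: negN; last exact: subIsetr.
  exact: measurableI.
have vE A : measurable A -> vvariation lam A = (jordan_pos PN A + jordan_neg PN A)%E.
  move=> mA; apply/eqP; rewrite eq_le; apply/andP; split.
    apply: vvariation_le => n F mF tF FA.
    have lamF i : ((`|lam (F i)|)%:E <= jordan_pos PN (F i) + jordan_neg PN (F i))%E.
      rewrite pE// nE// -EFinD lee_fin lamE// (le_trans (ler_normD _ _))//.
      by rewrite ger0_norm ?lP// ler0_norm ?lN.
    rewrite -sumEFin (le_trans (lee_sum _ (fun i _ => lamF i)))//.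
    rewrite big_split/= -!measure_semi_additive_ord//; try exact: bigsetU_measurable.
    rewrite (_ : \big[setU/set0]_(i < n) F i = A)// -FA -bigcup_seq.
    by apply: eq_bigcupl; split=> i //= _; exact: mem_index_enum.
  rewrite pE// nE// -EFinD -{1}(ger0_norm (lP _ mA)) -(ler0_norm (lN _ mA)).
  have {3}-> : A = (A `&` P) `|` (A `&` N) by rewrite -setIUr PNT setIT.
  apply: vvariation_ge2; [exact: measurableI|exact: measurableI|].
  by rewrite setIACA PN0 setI0.
have vp A : measurable A -> positive_variation lam A = jordan_pos PN A.
  move=> mA; rewrite /positive_variation vE// pE// nE// -!EFinD -EFinM (lamE _ mA).
  by congr EFin; field.
have vn A : measurable A -> negative_variation lam A = jordan_neg PN A.
  move=> mA; rewrite /negative_variation vE// pE// nE// -EFinN -!EFinD -EFinM (lamE _ mA).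
  by congr EFin; field.
exists (jordan_pos PN), (jordan_neg PN), P; split=> //.
- have := pE _ (measurableC mP); rewrite setICl => /= ->; exact: mu0.
- by have := nE _ mP; rewrite PN0 (vector_measure0 lamm) oppr0.
- move=> A mA; split; rewrite ?vE ?vp ?vn//.
  by have := pE _ mA; have := nE _ mA => /= -> ->; rewrite /= opprK (lamE _ mA).
Qed.

End integral_set_function.

Lemma norm_sign_indic (T : Type) (R : numDomainType) (P : set T) x :
  `|\1_P x - \1_(~` P) x : R| = 1.
Proof.
rewrite !indicE in_setC; case: (x \in P); rewrite ?subr0 ?sub0r ?normrN normr1//.
Qed.

Lemma measurable_sign_indic d (T : measurableType d) (R : realType) (P : set T) :
  measurable P -> measurable_fun setT (fun x => \1_P x - \1_(~` P) x : R).
Proof.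
by move=> mP; apply: measurable_funB; apply: measurable_indic => //; exact: measurableC.
Qed.

Section signed_integral.
Context d (T : measurableType d) (R : realType) (lam : set T -> R).
Hypothesis lamm : vector_measure (lam : set T -> R^o).
Implicit Types (f g : T -> R) (A B : set T).

Definition sintegrable f :=
  measurable_fun setT f /\ (\int[vvariation lam]_x `|f x|%:E < +oo)%E.

Let jordan : exists (p n : {finite_measure set T -> \bar R}) (P : set T),
  [/\ measurable P, p (~` P) = 0%E, n P = 0%E,
      forall A, measurable A -> lam A = fine (p A) - fine (n A) &
  [/\ forall g, measurable_fun setT g -> (forall x, 0 <= g x) ->
        (\int[vvariation lam]_x (g x)%:E = \int[p]_x (g x)%:E + \int[n]_x (g x)%:E)%E,
      forall A f, signed_integral lam A f = \int[p]_(x in A) f x - \int[n]_(x in A) f x &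
      forall f, sintegrable f <->
        p.-integrable setT (EFin \o f) /\ n.-integrable setT (EFin \o f)]].
Proof.
have [p [n [P [mP pP nP H]]]] := signed_decomposition lamm.
have HI g : measurable_fun setT g -> (forall x, 0 <= g x) ->
    (\int[vvariation lam]_x (g x)%:E = \int[p]_x (g x)%:E + \int[n]_x (g x)%:E)%E.
  move=> mg g0; rewrite -ge0_integral_measure_add//; last 2 first.
  - by move=> x _; rewrite lee_fin.
  - exact/measurable_EFinP.
  apply: eq_integral_set_function => A mA; rewrite measure_addE.
  by have [-> _ _ _] := H A mA.
exists p, n, P; split=> //; first by move=> A /H[].
split=> // [A f|f].
  rewrite /signed_integral /Rintegral; congr (fine _ - fine _).
    by apply: eq_integral_set_function => B /H[].
  by apply: eq_integral_set_function => B /H[].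
split=> [[mf]|[/integrableP[/measurable_EFinP mf fp] /integrableP[_ fn]]].
  rewrite HI//; last exact: measurableT_comp.
  move=> h; split; apply/integrableP; split; try exact/measurable_EFinP.
    by apply: le_lt_trans h; rewrite leeDl// integral_ge0.
  by apply: le_lt_trans h; rewrite leeDr// integral_ge0.
split=> //; rewrite HI//; last exact: measurableT_comp.
by rewrite lte_add_pinfty.
Qed.

Lemma sintegrableP (a : R) f g : sintegrable f -> sintegrable g ->
  sintegrable (fun x => a * f x + g x) /\
  signed_integral lam setT (fun x => a * f x + g x) =
    a * signed_integral lam setT f + signed_integral lam setT g.
Proof.
have [p [n [P [mP pP nP lamE [_ sE iE]]]]] := jordan.
move=> /iE[fp fn] /iE[gp gn].
have afp := integrableZl measurableT a fp.
have afn := integrableZl measurableT a fn.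
split.
  by apply/iE; split; [exact: (integrableD measurableT afp gp)|exact: (integrableD measurableT afn gn)].
by rewrite !sE !RintegralD// !RintegralZl// mulrBr addrACA opprD.
Qed.

Lemma le_sintegrable f g : measurable_fun setT f ->
  (forall x, `|f x| <= `|g x|) -> sintegrable g -> sintegrable f.
Proof.
have [p [n [P [mP pP nP lamE [_ sE iE]]]]] := jordan.
move=> mf fg; have h x : setT x -> (`|(EFin \o f) x| <= `|(EFin \o g) x|)%E by move=> _ /=; rewrite lee_fin fg.
move=> /iE[gp gn]; apply/iE; split.
  by apply: (le_integrable measurableT _ h gp); exact/measurable_EFinP.
by apply: (le_integrable measurableT _ h gn); exact/measurable_EFinP.
Qed.

Lemma signed_integral_mkcond A f : measurable A ->
  signed_integral lam A f = signed_integral lam setT (fun x => f x * \1_A x).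
Proof.
have [p [n [P [mP pP nP lamE [_ sE iE]]]]] := jordan.
move=> mA; rewrite !sE; congr (_ - _); rewrite Rintegral_mkcond;
  apply: eq_Rintegral => x _; rewrite patchE indicE;
  by case: (x \in A); rewrite ?mulr1 ?mulr0.
Qed.

Lemma signed_integral_indic B : measurable B ->
  sintegrable \1_B /\ signed_integral lam setT \1_B = lam B.
Proof.
have [p [n [P [mP pP nP lamE [_ sE iE]]]]] := jordan.
move=> mB; split.
  apply/iE; split; (apply: integrable_indic => //; rewrite -ge0_fin_numE//);
  exact: fin_num_measure.
by rewrite sE lamE// /Rintegral !integral_indic// !setIT.
Qed.

Lemma le_norm_signed_integral f : sintegrable f ->
  ((`|signed_integral lam setT f|)%:E <= \int[vvariation lam]_x `|f x|%:E)%E.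
Proof.
have [p [n [P [mP pP nP lamE [HI sE iE]]]]] := jordan.
move=> fi; have /iE[fp fn] := fi.
rewrite sE HI//; last by apply: measurableT_comp => //; exact: fi.1.
have EF (mu : {measure set T -> \bar R}) : mu.-integrable setT (EFin \o f) ->
    ((`|\int[mu]_x f x|)%:E <= \int[mu]_x `|f x|%:E)%E.
  move=> fm; rewrite EFin_normr_Rintegral//.
  by apply: le_abse_integral => //; case/integrableP: fm.
rewrite (le_trans _ (leeD (EF _ fp) (EF _ fn)))// -EFinD lee_fin.
exact: ler_normB.
Qed.

(* On the positive set P of a Hahn decomposition the measure is |lam|, on its
   complement it is -|lam|. *)
Lemma signed_integral_sign : exists2 P, measurable P & forall f, sintegrable f ->
  (forall x, 0 <= f x) ->
  ((signed_integral lam setT (fun x => f x * (\1_P x - \1_(~` P) x)%R))%:E =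
  \int[vvariation lam]_x (f x)%:E)%E.
Proof.
have [p [n [P [mP pP nP lamE [HI sE iE]]]]] := jordan.
exists P => // f fi f0; have [mf _] := fi; have /iE[fp fn] := fi.
have mg : measurable_fun setT (fun x => f x * (\1_P x - \1_(~` P) x)).
  by apply: measurable_funM => //; exact: measurable_sign_indic.
have /iE[gp gn] : sintegrable (fun x => f x * (\1_P x - \1_(~` P) x)).
  by apply: le_sintegrable fi => // x; rewrite normrM norm_sign_indic mulr1.
rewrite sE HI// EFinB /Rintegral !fineK ?integrable_fin_num//.
have -> : (\int[p]_x (f x * (\1_P x - \1_(~` P) x))%:E = \int[p]_x (f x)%:E)%E.
  apply: ae_eq_integral => //; try exact/measurable_EFinP.
  exists (~` P); split=> //; first exact: measurableC.
  move=> x /= /not_implyP[_]; apply: contra_not => Px.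
  by rewrite !indicE in_setC mem_set//= subr0 mulr1.
have -> : (\int[n]_x (f x * (\1_P x - \1_(~` P) x))%:E = \int[n]_x (- (f x)%:E))%E.
  apply: ae_eq_integral => //; first exact/measurable_EFinP.
    by apply: measurableT_comp => //; exact/measurable_EFinP.
  exists P; split=> //.
  move=> x /= /not_implyP[_]; apply: contra_notP => Px.
  by rewrite !indicE in_setC memNset//= sub0r mulrN1.
by rewrite integral_ge0N ?oppeK// => x _; rewrite lee_fin.
Qed.

Lemma signed_integral_cvg (f_ : (T -> R)^nat) f g :
  (forall n, measurable_fun setT (f_ n)) -> sintegrable g ->
  (forall x, f_ ^~ x @ \oo --> f x) -> (forall n x, `|f_ n x| <= `|g x|) ->
  (fun n => signed_integral lam setT (f_ n)) @ \oo --> signed_integral lam setT f.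
Proof.
have [p [n [P [mP pP nP lamE [HI sE iE]]]]] := jordan.
move=> mf /iE[gp gn] fx fg; under eq_fun do rewrite sE; rewrite sE.
have key (mu : {measure set T -> \bar R}) : mu.-integrable setT (EFin \o g) ->
    (fun k => \int[mu]_x f_ k x) @ \oo --> \int[mu]_x f x.
  move=> gm; apply: fine_cvg; rewrite fineK; last first.
    apply: integrable_fin_num => //; apply: (le_integrable measurableT _ _ gm).
      by apply/measurable_EFinP; apply: (measurable_fun_cvg mf) => x _; exact: fx.
    move=> x _; rewrite lee_fin; have h : (fun k => `|f_ k x|) @ \oo --> `|f x| by apply: cvg_norm; exact: fx.
    by apply: (cvgr_to_le h); apply: nearW => k; exact: fg.
  apply: (@dominated_cvg _ _ _ mu setT _ _ _ (fun x => `|g x|%:E)) => //.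
  - by move=> k; exact/measurable_EFinP.
  - by move=> x _; apply: cvg_EFin; [exact: nearW|exact: fx].
  - exact: integrable_abse gm.
  - by move=> k x _; rewrite lee_fin.
by apply: cvgB; exact: key.
Qed.

End signed_integral.

(** * Integration with respect to a vector measure *)

Section vector_integral.
Context d (T : measurableType d) (R : realType) (Z : normedModType R).
Variable nu : set T -> Z.
Hypothesis num : vector_measure nu.
Implicit Types (f g : T -> R) (A B : set T) (phi : {linear Z -> R^o}) (z : Z).

Let num_comp phi : continuous phi -> vector_measure (phi \o nu).
Proof. exact: vector_measure_comp. Qed.

Lemma vintegrable_sintegrable phi f : continuous phi -> vintegrable nu f ->
  sintegrable (phi \o nu) f.
Proof. by move=> phic [mf fi _]; split=> //; exact: fi. Qed.

Lemma has_vintegral_inj A f z z' :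
  has_vintegral nu A f z -> has_vintegral nu A f z' -> z = z'.
Proof. by move=> zf z'f; apply: dual_inj => phi phic; rewrite zf// z'f. Qed.

Lemma vintegralE A f z : has_vintegral nu A f z -> vintegral nu A f = z.
Proof.
rewrite /vintegral => zf; case: xgetP => [y _ yf|/(_ z)//].
exact: has_vintegral_inj yf zf.
Qed.

Lemma vintegralP A f : measurable A -> vintegrable nu f ->
  has_vintegral nu A f (vintegral nu A f).
Proof. by move=> mA [_ _ /(_ A mA)[z zf]]; rewrite (vintegralE zf). Qed.

Lemma integration_operatorP phi f : continuous phi -> vintegrable nu f ->
  phi (integration_operator nu f) = signed_integral (phi \o nu) setT f.
Proof. by move=> phic fi; rewrite (vintegralP measurableT fi). Qed.

Lemma has_vintegral_mkcond A f z : measurable A ->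
  has_vintegral nu A f z <-> has_vintegral nu setT (fun x => f x * \1_A x) z.
Proof.
move=> mA; split=> zf phi phic;
  have e := signed_integral_mkcond (num_comp phic) f mA.
- by rewrite -e zf.
- by rewrite e zf.
Qed.

Lemma vintegrable_intro f : measurable_fun setT f ->
  (forall phi, continuous phi -> sintegrable (phi \o nu) f) ->
  (forall A, measurable A ->
    exists z, has_vintegral nu setT (fun x => f x * \1_A x) z) ->
  vintegrable nu f.
Proof.
move=> mf fs fz; split=> // [phi /fs[]//|A mA].
by have [z zf] := fz A mA; exists z; apply/has_vintegral_mkcond.
Qed.

Let mulindic_sintegrable phi f A : continuous phi -> measurable A ->
  vintegrable nu f -> sintegrable (phi \o nu) (fun x => f x * \1_A x).
Proof.
move=> phic mA fi; have fs := vintegrable_sintegrable phic fi.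
apply: (le_sintegrable (num_comp phic) _ _ fs) => [|x].
  by apply: measurable_funM => //; exact: fs.1.
rewrite normrM ler_piMr// indicE; by case: (x \in A); rewrite ?normr1 ?normr0.
Qed.

Lemma vintegrableP (a : R) f g : vintegrable nu f -> vintegrable nu g ->
  vintegrable nu (fun x => a * f x + g x) /\
  integration_operator nu (fun x => a * f x + g x) =
    a *: integration_operator nu f + integration_operator nu g.
Proof.
move=> fi gi.
have H A : measurable A -> has_vintegral nu setT
    (fun x => (a * f x + g x) * \1_A x) (a *: vintegral nu A f + vintegral nu A g).
  move=> mA phi phic.
  rewrite linearP (vintegralP mA fi)// (vintegralP mA gi)//.
  rewrite (signed_integral_mkcond (num_comp phic) f mA) (signed_integral_mkcond (num_comp phic) g mA).
  have [_ <-] := sintegrableP (num_comp phic) a (mulindic_sintegrable phic mA fi)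
    (mulindic_sintegrable phic mA gi).
  by congr signed_integral; apply/funext => x; rewrite mulrDl mulrA.
split; last first.
  by apply: vintegralE; apply/has_vintegral_mkcond => //; exact: H.
apply: vintegrable_intro => [|phi phic|A mA]; last by eexists; exact: H.
- have [mf _ _] := fi; have [mg _ _] := gi.
  by apply: measurable_funD => //; exact: measurable_funM.
- by have [] := sintegrableP (num_comp phic) a (vintegrable_sintegrable phic fi)
    (vintegrable_sintegrable phic gi).
Qed.

Lemma vintegrable_mulindic f B : measurable B -> vintegrable nu f ->
  vintegrable nu (fun x => f x * \1_B x).
Proof.
move=> mB fi; apply: vintegrable_intro => [|phi phic|A mA].
- by have [mf _ _] := fi; exact: measurable_funM.
- exact: mulindic_sintegrable.
- exists (vintegral nu (B `&` A) f).
  under eq_fun do rewrite -mulrA -[\1_B _ * _]/((\1_B \* \1_A) _) -indicI.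
  have mBA := measurableI _ _ mB mA.
  exact: (has_vintegral_mkcond f _ mBA).1 (vintegralP mBA fi).
Qed.

Lemma vintegrable_indic B : measurable B ->
  vintegrable nu \1_B /\ integration_operator nu \1_B = nu B.
Proof.
move=> mB.
have H A : measurable A -> has_vintegral nu setT (fun x => \1_B x * \1_A x) (nu (B `&` A)).
  move=> mA phi phic; under eq_fun do rewrite -[\1_B _ * _]/((\1_B \* \1_A) _) -indicI.
  by have [_ ->] := signed_integral_indic (num_comp phic) (measurableI _ _ mB mA).
split; last first.
  by apply: vintegralE; apply/has_vintegral_mkcond => //; have := H _ measurableT; rewrite setIT.
apply: vintegrable_intro => [|phi phic|A mA]; last by eexists; exact: H.
- exact: measurable_indic.
- by have [] := signed_integral_indic (num_comp phic) mB.
Qed.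

Lemma vintegrable0 : vintegrable nu (fun=> 0) /\ integration_operator nu (fun=> 0) = 0.
Proof.
have [vi ve] := vintegrable_indic measurable0.
have e : \1_set0 = (fun=> 0 : R) :> (T -> R) by rewrite indic0.
by rewrite -e; split=> //; rewrite ve vector_measure0.
Qed.

Lemma vintegrable_sign f P : measurable P -> vintegrable nu f ->
  vintegrable nu (fun x => f x * (\1_P x - \1_(~` P) x)).
Proof.
move=> mP fi.
have [+ _] := vintegrableP (-1) (vintegrable_mulindic (measurableC mP) fi)
  (vintegrable_mulindic mP fi).
by under eq_fun do rewrite mulN1r addrC -mulrBr.
Qed.

(** |f| is f times the sign 1_P - 1_{~P} of P = {f >= 0}, so its vector integrals are combinations
    of integrals of f over smaller sets. *)
Lemma vintegrable_norm f : vintegrable nu f -> vintegrable nu (fun x => `|f x|).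
Proof.
move=> fi; have [mf _ _] := fi.
have mP : measurable [set x | 0 <= f x].
  by rewrite -[X in measurable X]setTI; exact: measurable_fun_le.
have := vintegrable_sign mP fi.
rewrite (_ : (fun x => f x * _) = (fun x => `|f x|))//; apply/funext => x.
rewrite !indicE in_setC; have [f0|f0] := leP 0 (f x).
  by rewrite mem_set//= subr0 mulr1 ger0_norm.
rewrite memNset/= ?sub0r ?mulrN1 ?ltr0_norm//.
by apply/negP; rewrite -ltNge.
Qed.

Lemma L1norm_ge phi f : dual_ball phi ->
  (\int[vvariation (phi \o nu)]_x `|f x|%:E <= L1norm nu f)%E.
Proof. by move=> phib; apply: ereal_sup_ubound; exists phi. Qed.

Lemma L1norm_le (M : \bar R) f :
  (forall phi, dual_ball phi ->
    (\int[vvariation (phi \o nu)]_x `|f x|%:E <= M)%E) -> (L1norm nu f <= M)%E.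
Proof. by move=> fM; apply: ge_ereal_sup => _ [phi phib <-]; exact: fM. Qed.

Let integral_vvariation_measure phi : continuous phi ->
  exists mu : {measure set T -> \bar R}, forall f : T -> \bar R,
    (\int[vvariation (phi \o nu)]_x f x = \int[mu]_x f x)%E /\
    forall A, measurable A -> vvariation (phi \o nu) A = mu A.
Proof.
move=> phic; have [mu muE] := measure_of_vvariation (num_comp phic).
by exists mu => f; split=> //; exact: eq_integral_set_function.
Qed.

Lemma dual_ball0 : exists phi : {linear Z -> R^o}, dual_ball phi.
Proof. by have [phi phib _] := norming_functional (0 : Z); exists phi. Qed.

Lemma L1norm_ge0 f : (0 <= L1norm nu f)%E.
Proof.
have [phi phib] := dual_ball0; rewrite (le_trans _ (L1norm_ge f phib))//.
have [mu muE] := integral_vvariation_measure phib.1.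
by rewrite (muE _).1; apply: integral_ge0 => x _; rewrite lee_fin.
Qed.

Lemma eq_L1norm f g : (forall x, `|f x| = `|g x|) -> L1norm nu f = L1norm nu g.
Proof.
move=> fg; rewrite /L1norm.
suff -> : (fun x => `|f x|%:E) = (fun x => `|g x|%:E) by [].
by apply/funext => x; rewrite fg.
Qed.

Lemma le_L1norm f g : measurable_fun setT f -> measurable_fun setT g ->
  (forall x, `|f x| <= `|g x|) -> (L1norm nu f <= L1norm nu g)%E.
Proof.
move=> mf mg fg; apply: L1norm_le => phi phib; apply: le_trans (L1norm_ge g phib).
have [mu muE] := integral_vvariation_measure phib.1.
rewrite !(muE _).1; apply: ge0_le_integral => //.
- by apply/measurable_EFinP; exact: measurableT_comp.
- by apply/measurable_EFinP; exact: measurableT_comp.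
- by move=> x _; rewrite lee_fin.
Qed.

Lemma L1norm_triangle (a b : R) f g :
  measurable_fun setT f -> measurable_fun setT g ->
  (L1norm nu (fun x => (a * f x + b * g x)%R) <=
    `|a|%:E * L1norm nu f + `|b|%:E * L1norm nu g)%E.
Proof.
move=> mf mg; apply: L1norm_le => phi phib.
have fle := lee_wpmul2l (_ : 0 <= `|a|%:E)%E (L1norm_ge f phib).
have gle := lee_wpmul2l (_ : 0 <= `|b|%:E)%E (L1norm_ge g phib).
rewrite (le_trans _ (leeD (fle _) (gle _))) ?lee_fin//.
have [mu muE] := integral_vvariation_measure phib.1.
have mn (h : T -> R) : measurable_fun setT h -> measurable_fun setT (fun x => (`|h x|)%:E).
  by move=> mh; apply/measurable_EFinP; exact: measurableT_comp.
rewrite !(muE _).1 -!ge0_integralZl//; try exact: mn.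
have mZ (c : R) (h : T -> R) : measurable_fun setT h ->
    measurable_fun setT (fun x : T => (c%:E * (`|h x|)%:E)%E).
  by move=> mh; apply: measurable_funeM; exact: mn.
have Z0 (c : R) (h : T -> R) x : (0 <= `|c|%:E * `|h x|%:E)%E.
  by rewrite -EFinM lee_fin mulr_ge0.
rewrite -ge0_integralD//; [|exact: mZ..].
apply: ge0_le_integral => //.
- by apply: mn; apply: measurable_funD; exact: measurable_funM.
- by apply: emeasurable_funD; exact: mZ.
- by move=> x _; rewrite -!EFinM -EFinD lee_fin -!normrM ler_normD.
Qed.

Lemma norm_integration_operator_le f : vintegrable nu f ->
  ((`|integration_operator nu f|)%:E <= L1norm nu f)%E.
Proof.
move=> fi; have [phi phib phif] := norming_functional (integration_operator nu f).
rewrite -phif (le_trans _ (L1norm_ge f phib))//.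
have := le_norm_signed_integral (num_comp phib.1) (vintegrable_sintegrable phib.1 fi).
rewrite -(integration_operatorP phib.1 fi); apply: le_trans.
by rewrite lee_fin ler_norm.
Qed.

(** The Hahn sign of [phi \o nu] turns an integral against the variation into the value of [phi] at
    a single vector integral, so that a bound on norms of integrals bounds [L1norm]. *)
Lemma L1norm_attained phi f : continuous phi -> vintegrable nu f ->
  exists g, [/\ vintegrable nu g, forall x, `|g x| = `|f x| &
    (\int[vvariation (phi \o nu)]_x `|f x|%:E)%E =
    (phi (integration_operator nu g))%:E].
Proof.
move=> phic fi; have nfi := vintegrable_norm fi.
have [P mP PE] := signed_integral_sign (num_comp phic).
have gi := vintegrable_sign mP nfi.
exists (fun x => `|f x| * (\1_P x - \1_(~` P) x)); split=> //.
  by move=> x; rewrite normrM norm_sign_indic mulr1 normr_id.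
rewrite (integration_operatorP phic gi) PE//.
exact: vintegrable_sintegrable.
Qed.

(** [vintegrable] controls each functional separately. The integrals of all g with |g| = |f| are
    weakly bounded, hence bounded, and [L1norm_attained] carries their common bound over to the
    norm. *)
Lemma L1norm_lty f : vintegrable nu f -> (L1norm nu f < +oo)%E.
Proof.
move=> fi.
pose S := [set integration_operator nu g | g in
  [set g | vintegrable nu g /\ forall x, `|g x| = `|f x|]].
have [|M SM] := @uniform_boundedness _ _ S.
  move=> phi phic; exists (fine (\int[vvariation (phi \o nu)]_x `|f x|%:E)%E).
  move=> _ [g [gi gf] <-]; rewrite (integration_operatorP phic gi).
  have := le_norm_signed_integral (num_comp phic) (vintegrable_sintegrable phic gi).
  rewrite (_ : (\int[_]_x `|g x|%:E)%E = (\int[vvariation (phi \o nu)]_x `|f x|%:E)%E).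
    have [_ +] := vintegrable_sintegrable phic fi.
    have [mu muE] := integral_vvariation_measure phic.
    rewrite !(muE _).1 => foo; rewrite -{1}(@fineK _ (\int[mu]_x _)%E) ?lee_fin//.
    by rewrite ge0_fin_numE// integral_ge0.
  suff -> : (fun x => `|g x|%:E) = (fun x => `|f x|%:E) by [].
  by apply/funext => x; rewrite gf.
apply: (@le_lt_trans _ _ M%:E); last exact: ltry.
apply: L1norm_le => phi phib; have [g [gi gf ->]] := L1norm_attained phib.1 fi.
by rewrite lee_fin (le_trans (ler_norm _))// (le_trans (phib.2 _))// SM//; exists g.
Qed.

Lemma semivariationE A : measurable A -> semivariation nu A = L1norm nu \1_A.
Proof.
move=> mA; rewrite /semivariation /L1norm; congr ereal_sup.
apply: eq_imagel => phi phib.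
have [mu muE] := integral_vvariation_measure phib.1.
rewrite (muE (cst 0%E)).2// (muE _).1.
rewrite (eq_integral (fun x => (\1_A x)%:E)); last by move=> x _; rewrite ger0_norm.
by rewrite integral_indic// setIT.
Qed.

Lemma L1ball_integration_operatorZ (L : R) f : 0 < L -> vintegrable nu f ->
  (L1norm nu f <= L%:E)%E ->
  exists2 g, L1ball nu g & integration_operator nu f = L *: integration_operator nu g.
Proof.
(* Homogeneity is read off the linear combination with the zero function. *)
move=> L0 fi fL; have [gi gE] := vintegrableP L^-1 fi vintegrable0.1.
exists (fun x => L^-1 * f x + 0); last first.
  by rewrite gE vintegrable0.2 addr0 scalerA divff ?scale1r// gt_eqF.
split=> //.
have [mf _ _] := fi.
have := L1norm_triangle L^-1 0 mf (measurable_cst (0:R)).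
under eq_fun do rewrite mulr0.
move=> /le_trans; apply; rewrite normr0 mul0e adde0 gtr0_norm ?invr_gt0//.
rewrite (le_trans (lee_wpmul2l _ fL)) ?lee_fin ?invr_ge0 ?(ltW L0)//.
by rewrite mulVf ?gt_eqF//.
Qed.

End vector_integral.

(** * The factorization of the integration operator *)

Lemma closure_absolutely_convex (R : realType) (X : normedModType R) (D : set X) :
  absolutely_convex D -> absolutely_convex (closure D).
Proof.
move=> Dc x y s t xD yD st B /nbhs_ballP[e /= e0 eB].
have [x' [Dx' xx']] := xD _ (nbhsx_ballx x e e0).
have [y' [Dy' yy']] := yD _ (nbhsx_ballx y e e0).
exists (s *: x' + t *: y'); split; first exact: Dc.
apply: eB; move: xx' yy'; rewrite -!ball_normE/= => xx' yy'.
rewrite opprD addrACA -!scalerBr (le_lt_trans (ler_normD _ _))// !normrZ.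
(* Passing to the larger of the two distances keeps the final inequality strict even when [s] and
   [t] vanish. *)
have [M Me [xM yM]] : exists2 M, M < e & `|x - x'| <= M /\ `|y - y'| <= M.
  exists (Num.max `|x - x'| `|y - y'|); first by rewrite gt_max xx' yy'.
  by rewrite !le_max !lexx orbT.
have M0 : 0 <= M by exact: le_trans xM.
apply: le_lt_trans Me; rewrite (@le_trans _ _ ((`|s| + `|t|) * M))//.
  by rewrite mulrDl lerD// ler_wpM2l.
by rewrite ler_piMl.
Qed.

Section eq_set_function.
Import HBNNSimple.
Context d (T : measurableType d) (R : realType).

Lemma eq_vvariation (V : normedZmodType R) (nu nu' : set T -> V) :
  (forall A, measurable A -> nu A = nu' A) -> vvariation nu = vvariation nu'.
Proof.
move=> nunu'; apply/funext => A; rewrite /vvariation; congr ereal_sup.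
apply/seteqP; split=> _ [n [F [mF tF FA ->]]]; exists n, F; split=> //;
  by congr EFin; apply: eq_bigr => i _; rewrite nunu'.
Qed.

Lemma eq_signed_integral (lam lam' : set T -> R) A f :
  (forall A, measurable A -> lam A = lam' A) ->
  signed_integral lam A f = signed_integral lam' A f.
Proof.
move=> ll'; rewrite /signed_integral; congr (fine _ - fine _);
  apply: eq_integral_set_function => B mB.
  by rewrite /positive_variation (eq_vvariation ll') ll'.
by rewrite /negative_variation (eq_vvariation ll') ll'.
Qed.

Lemma nnsfun_ind (P : (T -> R) -> Prop) : P (fun=> 0) ->
  (forall a B g, measurable B -> P g -> P (fun x => a * \1_B x + g x)) ->
  forall h : {nnsfun T >-> R}, P h.
Proof.
move=> P0 PS h.
have -> : (h : T -> R) = (fun x => \sum_(y <- finmap.enum_fset (fset_set (range h))) y * \1_(h @^-1` [set y]) x).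
  by apply/funext => x; rewrite [LHS]fimfunE fsbig_finite.
elim: (finmap.enum_fset _) => [|y s IH].
  by under eq_fun do rewrite big_nil.
by under eq_fun do rewrite big_cons; exact: PS.
Qed.

End eq_set_function.

Section lno_factorization.
Context d (T : measurableType d) (R : realType) (X : completeNormedModType R).
Variable m : set T -> X.
Hypothesis mm : vector_measure m.
Implicit Types (f g : T -> R) (A B : set T).

Local Notation I := (integration_operator m).
Local Notation K := (lno_body m).

Let L1ball_image_convex : absolutely_convex (I @` L1ball m).
Proof.
move=> _ _ s t [f [fi f1] <-] [g [gi g1] <-] st.
have [tgi tgE] := vintegrableP mm t gi (vintegrable0 mm).1.
have [hi hE] := vintegrableP mm s fi tgi.
exists (fun x => s * f x + (t * g x + 0)).
  split=> //; under eq_fun do rewrite addr0.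
  have [mf _ _] := fi; have [mg _ _] := gi.
  rewrite (le_trans (L1norm_triangle mm s t mf mg))//.
  rewrite (@le_trans _ _ (`|s|%:E + `|t|%:E)%E) ?lee_fin//.
  by rewrite leeD// -[X in (_ <= X)%E]mule1 lee_wpmul2l// lee_fin.
by rewrite hE tgE (vintegrable0 mm).2 addr0.
Qed.

(** The closure satisfies the standing assumption, so [dfjp_body_of] does not fall back on {0}; it
    lies in the unit ball because an integral is bounded by the norm of its integrand. *)
Lemma lno_bodyE : dfjp_set K = closure (I @` L1ball m).
Proof.
apply: dfjp_body_ofE; split.
- exact: closed_closure.
- exists 0; apply: subset_closure; exists (fun=> 0).
    split; first exact: (vintegrable0 mm).1.
    have := L1norm_triangle mm 0 0 (measurable_cst (0 : R)) (measurable_cst (0 : R)).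
    by under eq_fun do rewrite mul0r addr0; rewrite normr0 !mul0e adde0 => /le_trans; apply.
  exact: (vintegrable0 mm).2.
- exact: closure_absolutely_convex.
- have cl : closed [set x : X | `|x| <= 1].
    rewrite (_ : [set x | _] = (fun x => `|x|) @^-1` [set r | r <= 1])//.
    apply: closed_comp => [x _|]; [exact: norm_continuous|exact: closed_le].
  move: (cl) => /closure_id ->; apply: closure_subset => _ [f [fi f1] <-] /=.
  by rewrite -lee_fin (le_trans (norm_integration_operator_le mm fi)).
Qed.

Lemma lno_body_scale (L : R) f : 0 < L -> vintegrable m f -> (L1norm m f <= L%:E)%E ->
  exists2 k, dfjp_set K k & I f = L *: k.
Proof.
move=> L0 fi fL; have [g gb gE] := L1ball_integration_operatorZ mm L0 fi fL.
by exists (I g) => //; rewrite lno_bodyE; apply: subset_closure; exists g.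
Qed.

Lemma L1norm_bound f : vintegrable m f -> exists2 L, 0 < L & (L1norm m f <= L%:E)%E.
Proof.
move=> fi; have foo := L1norm_lty mm fi; have f0 := L1norm_ge0 mm f.
(* The added 1 keeps [L] positive when the norm of f is 0. *)
exists (fine (L1norm m f) + 1); first by rewrite ltr_wpDl// fine_ge0.
by rewrite EFinD fineK ?ge0_fin_numE// leeDl.
Qed.

(** [I f] lies in a dilate of K, hence in X_K, so the default value of [insubd] is not reached. *)
Lemma lno_TK f : vintegrable m f -> lno_J (lno_T m f) = I f.
Proof.
move=> fi; have [L L0 fL] := L1norm_bound fi.
have [k Kk IfE] := lno_body_scale L0 fi fL.
by rewrite /lno_J /lno_T insubdK// IfE dfjp_domZ.
Qed.

Lemma lno_J_linear : linear (@lno_J _ _ _ _ m).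
Proof. by []. Qed.

Definition lno_Jlin : {linear lno_space m -> X} :=
  HB.pack (@lno_J _ _ _ _ m) (GRing.isLinear.Build R _ _ *:%R _ lno_J_linear).

Lemma lno_J_inj : injective (@lno_J _ _ _ _ m).
Proof. exact: val_inj. Qed.

Lemma norm_lno_J (y : lno_space m) : `|lno_J y| <= `|y|.
Proof. exact: norm_le_dfjp_norm (dfjp_valP y). Qed.

Lemma lno_J_continuous : continuous lno_Jlin.
Proof.
apply/linear_bounded_continuous/linear_boundedP.
near=> r => y; rewrite (le_trans (norm_lno_J y))// ler_peMl//.
Unshelve. all: by end_near. Qed.

Lemma lno_T_linear (a : R) f g : vintegrable m f -> vintegrable m g ->
  lno_T m (fun x => a * f x + g x) = a *: lno_T m f + lno_T m g.
Proof.
move=> fi gi; have [hi hE] := vintegrableP mm a fi gi.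
apply: lno_J_inj; rewrite (lno_TK hi) hE -(lno_TK fi) -(lno_TK gi).
exact: esym (lno_J_linear _ _ _).
Qed.

Lemma norm_lno_T f : vintegrable m f -> (`|lno_T m f|%:E <= L1norm m f)%E.
Proof.
(* The slack [e] provides a positive dilation factor even when the norm of f is 0. *)
move=> fi; apply/lee_addgt0Pr => e e0.
have foo := L1norm_lty mm fi; have f0 := L1norm_ge0 mm f.
have ffin : L1norm m f \is a fin_num by rewrite ge0_fin_numE.
pose L := fine (L1norm m f) + e.
have L0 : 0 < L by rewrite ltr_wpDl// fine_ge0.
have LE : (L1norm m f + e%:E = L%:E)%E by rewrite EFinD fineK.
have [|k Kk IfE] := lno_body_scale L0 fi; first by rewrite -LE leeDl// lee_fin ltW.
rewrite LE lee_fin dfjp_normE -[val _]/(lno_J _) lno_TK// IfE.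
by rewrite (le_trans (dfjp_norm_leZ _ Kk))// gtr0_norm.
Qed.

Local Notation C := (lno_const R).

Lemma lno_T_interpolation f : vintegrable m f ->
  ((`|lno_T m f| ^+ 2)%:E <= C%:E * L1norm m f * `|I f|%:E)%E.
Proof.
move=> fi; have foo := L1norm_lty mm fi; have f0 := L1norm_ge0 mm f.
have ffin : L1norm m f \is a fin_num by rewrite ge0_fin_numE.
have C0 : 0 < C by apply: lt_trans (lno_const_gt1 R).
have [f0'|fpos] := eqVneq (L1norm m f) 0%E.
  have := norm_lno_T fi; rewrite f0' lee_fin normr_le0 => /eqP ->.
  by rewrite normr0 expr0n/= mule0 mul0e.
have L0 : 0 < fine (L1norm m f) by rewrite fine_gt0// foo lt0e fpos f0.
have [|k Kk IfE] := lno_body_scale L0 fi; first by rewrite fineK.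
rewrite -(fineK ffin) -!EFinM lee_fin dfjp_normE -[val _]/(lno_J _) lno_TK// IfE.
by rewrite -mulrA dfjp_interpolation// ltW.
Qed.

Lemma lno_J_measure A : measurable A -> lno_J (lno_measure m A) = m A.
Proof. by move=> mA; have [iA IA] := vintegrable_indic mm mA; rewrite lno_TK. Qed.

Lemma lno_measure_interpolation A : measurable A ->
  ((`|lno_measure m A| ^+ 2)%:E <= C%:E * semivariation m A * `|m A|%:E)%E.
Proof.
move=> mA; have [iA IA] := vintegrable_indic mm mA.
by rewrite (semivariationE mm mA) -[in X in (_ <= X)%E]IA; exact: lno_T_interpolation.
Qed.

(** The remainders of both series are the values of the measures on the same set, [U] minus [V n].
    Its semivariation is at most the norm of the constant 1, so interpolation turns convergence in X
    into convergence in Y. *)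
Lemma lno_measure_vector_measure : vector_measure (lno_measure m).
Proof.
move=> F mF tF; set U := \bigcup_i F i.
have mU : measurable U by exact: bigcupT_measurable.
pose V n := \big[setU/set0]_(0 <= i < n) F i.
have mV n : measurable (V n) by exact: bigsetU_measurable.
have mUV n : measurable (U `\` V n) by exact: measurableD.
have VU n : V n `<=` U by rewrite /V big_mkord; exact: bigsetU_bigcup.
have mE n : m U - \sum_(0 <= i < n) m (F i) = m (U `\` V n).
  rewrite (vector_measureID mm mU (mV n)) setIidr//.
  by rewrite -(vector_measure_bigsetU mm n mF tF) addrAC subrr add0r.
have mtE n : lno_measure m U - \sum_(0 <= i < n) lno_measure m (F i) =
    lno_measure m (U `\` V n).
  apply: lno_J_inj; rewrite lno_J_measure// -mE -[LHS]/(lno_Jlin _) linearB linear_sum/=.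
  apply: (f_equal2 (fun x y : X => x - y) (lno_J_measure mU)).
  by apply: eq_bigr => i _; exact: (lno_J_measure (mF i)).
have [L L0 TL] := L1norm_bound (vintegrable_indic mm measurableT).1.
have C0 : 0 < C by apply: lt_trans (lno_const_gt1 R).
apply/cvgrPdist_lt => e e0.
have CL0 : 0 < C * L := mulr_gt0 C0 L0.
have e20 : 0 < e ^+ 2 / (C * L) by rewrite divr_gt0 ?exprn_gt0.
move/cvgrPdist_lt : (mm mF tF) => /(_ _ e20).
apply: filterS => n; rewrite mE mtE (ltr_pdivlMr _ _ CL0) => h.
rewrite -(@ltr_pXn2r _ 2) ?nnegrE// ?(ltW e0)// -lte_fin.
rewrite (le_lt_trans (lno_measure_interpolation (mUV n)))//.
apply: (@le_lt_trans _ _ ((C * L)%:E * `|m (U `\` V n)|%:E)%E); last first.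
  by rewrite -EFinM lte_fin mulrC.
apply: lee_wpmul2r; first by rewrite lee_fin.
rewrite (EFinM C L); apply: lee_wpmul2l; first by rewrite lee_fin ltW.
rewrite (semivariationE mm (mUV n)) (le_trans _ TL)//; apply: le_L1norm => // x.
by rewrite !indicE in_setT normr1; case: (x \in _); rewrite ?normr1 ?normr0.
Qed.

Definition lno_dilate (L : R) (y : lno_space m) :=
  exists2 k, dfjp_set K k & lno_J y = L *: k.

Lemma dfjp_norm_lno_dilate L y : 0 <= L -> lno_dilate L y ->
  `|y| ^+ 2 <= C * (L * `|lno_J y|).
Proof.
move=> L0 [k Kk yE].
rewrite dfjp_normE -[val _]/(lno_J _) yE.
exact: dfjp_interpolation.
Qed.

(* By interpolation a convex subset of L K on which psi >= e stays away from 0 in X,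
   so it is separated from 0 by a functional of X. This replaces the description
   of the dual of the interpolation space. *)
Lemma bounded_weak_separation (psi : {linear lno_space m -> R^o}) (L e : R) :
  continuous psi -> 0 < L -> 0 < e ->
  exists2 phi : {linear X -> R^o}, continuous phi & exists2 delta, 0 < delta &
    forall y, lno_dilate L y -> e <= psi y -> delta <= phi (lno_J y).
Proof.
move=> psic L0 e0; have [c c0 psib] := dual_bound psic.
pose D := [set lno_J y | y in [set y | lno_dilate L y /\ e <= psi y]].
have C0 : 0 < C by apply: lt_trans (lno_const_gt1 R).
(* If psi y >= e then |y| >= e / c in Y, and on the dilate L K interpolation gives |J y| >= |y|^2 /
   (C L) in X. *)
pose delta := (e / c) ^+ 2 / (C * L).
have CL0 : 0 < C * L := mulr_gt0 C0 L0.
have delta0 : 0 < delta by rewrite divr_gt0 ?exprn_gt0 ?divr_gt0.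
have [D0|/set0P D0] := eqVneq D set0.
  have [phi [phic _]] := dual_ball0 X; exists phi => //; exists 1 => // y yL ye.
  have : D (lno_J y) by exists y.
  by rewrite D0.
have [||phi [phic _] phiD] := separation _ D0 (_ : forall w, D w -> delta <= `|w|).
- move=> _ _ s t [x [[k Kk xk] xe] <-] [y [[l Kl yl] ye] <-] s0 t0 st.
  exists (s *: x + t *: y); last exact: (linearP lno_Jlin).
  split.
    exists (s *: k + t *: l).
      by apply: dfjp_absolutely_convex => //; rewrite !ger0_norm ?st.
    rewrite -[LHS]/(lno_Jlin _) linearD !linearZ/= xk yl.
    by rewrite scalerDr !scalerA (mulrC s) (mulrC t).
  rewrite linearD !linearZ/= (@le_trans _ _ (s * e + t * e))//.
    by rewrite -mulrDl st mul1r.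
  by rewrite lerD// ler_wpM2l.
- move=> _ [y [yL ye] <-].
  rewrite (ler_pdivrMr _ _ CL0) (mulrC _ (C * L)) -(mulrA C).
  apply: le_trans (dfjp_norm_lno_dilate (ltW L0) yL).
  rewrite ler_pXn2r ?nnegrE ?divr_ge0 ?(ltW e0) ?(ltW c0)// ler_pdivrMr// mulrC.
  by rewrite (le_trans ye)// (le_trans (ler_norm _))// psib.
by exists phi => //; exists delta => // y yL ye; apply: phiD; exists y.
Qed.

(** One phi and one delta serve all n: if |psi (y n)| >= e then, the dilate being symmetric, |phi (J
    (y n))| >= delta, which fails from some n on. *)
Lemma bounded_weak_cvg (psi : {linear lno_space m -> R^o}) (L : R) (y : nat -> lno_space m) :
  continuous psi -> 0 < L -> (forall n, lno_dilate L (y n)) ->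
  (forall phi : {linear X -> R^o}, continuous phi ->
    (fun n => phi (lno_J (y n))) @ \oo --> (0 : R^o)) ->
  (fun n => psi (y n)) @ \oo --> (0 : R^o).
Proof.
move=> psic L0 yL yw.
have yLN n : lno_dilate L (- y n).
  have [k Kk yE] := yL n; exists (- k).
    have := @dfjp_absolutely_convex _ _ K k k (-1) 0 Kk Kk.
    by rewrite scaleN1r scale0r addr0 normrN normr0 addr0 normr1; apply.
  by rewrite -[LHS]/(lno_Jlin _) linearN/= yE scalerN.
apply/cvgrPdist_lt => e e0.
have [phi phic [delta d0 phiP]] := bounded_weak_separation psic L0 e0.
move/cvgrPdist_lt : (yw _ phic) => /(_ _ d0); apply: filterS => n.
rewrite !sub0r !normrN => h; rewrite ltNge; apply/negP; rewrite ler_normr => /orP[ey|ey].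
  by move: h; rewrite ltNge (le_trans (phiP _ (yL n) ey))// ler_norm.
have := phiP _ (yLN n); rewrite linearN => /(_ ey).
rewrite -[lno_J _]/(lno_Jlin _) !linearN/= => h'.
by move: h; rewrite ltNge (le_trans h')// -normrN ler_norm.
Qed.

End lno_factorization.

(** * Transfer of integrals from the measure to its lift *)

Section lno_integrals.
Context d (T : measurableType d) (R : realType) (X : completeNormedModType R).
Variable m : set T -> X.
Hypothesis mm : vector_measure m.
Implicit Types (f g : T -> R) (A B : set T) (psi : {linear lno_space m -> R^o}).

Import HBNNSimple.
Local Notation mt := (lno_measure m).
Local Notation J := (lno_Jlin m).

Let mtm : vector_measure mt. Proof. exact: lno_measure_vector_measure. Qed.

Let Jmt A : measurable A -> (J \o mt) A = m A.
Proof. exact: lno_J_measure. Qed.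

Let phiJ (phi : {linear X -> R^o}) : {linear lno_space m -> R^o} := phi \o J.

Let phiJ_mt (phi : {linear X -> R^o}) A : measurable A ->
  (phiJ phi \o mt) A = (phi \o m) A.
Proof. by move=> mA; rewrite /= -Jmt. Qed.

Let phiJ_continuous (phi : {linear X -> R^o}) : continuous phi -> continuous (phiJ phi).
Proof.
by move=> phic y; apply: continuous_comp; [exact: lno_J_continuous|exact: phic].
Qed.

Lemma has_vintegral_lno_J A f y : has_vintegral mt A f y -> has_vintegral m A f (lno_J y).
Proof.
move=> yf phi phic; rewrite -(eq_signed_integral _ _ (phiJ_mt phi)).
exact: yf (phiJ_continuous phic).
Qed.

Lemma vintegrable_lno_J f : vintegrable mt f -> vintegrable m f.
Proof.
move=> [mf fi fA]; split=> // [phi phic|A mA].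
  by rewrite -(eq_vvariation (phiJ_mt phi)); apply: fi; exact: phiJ_continuous.
by have [y yf] := fA A mA; exists (lno_J y); exact: has_vintegral_lno_J.
Qed.

Lemma L1norm_lno_J f : (L1norm m f <= L1norm mt f)%E.
Proof.
apply: L1norm_le => phi [phic phib]; rewrite -(eq_vvariation (phiJ_mt phi)).
apply: L1norm_ge; split; first exact: phiJ_continuous.
by move=> y; rewrite (le_trans (phib _))// norm_lno_J.
Qed.

Let lno_T0 : lno_T m (fun=> 0) = 0.
Proof. by apply: lno_J_inj; rewrite (lno_TK mm (vintegrable0 mm).1) (vintegrable0 mm).2. Qed.

(** Integrals over all measurable [B] are recorded because [good_integral_le] multiplies f by the
    indicators of a Hahn decomposition. *)
Let good f := [/\ vintegrable m f, vintegrable mt f & forall B, measurable B ->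
  integration_operator mt (fun x => f x * \1_B x) = lno_T m (fun x => f x * \1_B x)].

Let good_nnsfun (h : {nnsfun T >-> R}) : good h.
Proof.
apply: (nnsfun_ind (P := good)).
  split; [exact: (vintegrable0 mm).1|exact: (vintegrable0 mtm).1|move=> B mB].
  have -> : (fun x => 0 * \1_B x) = (fun=> 0) :> (T -> R).
    by apply/funext => x; rewrite mul0r.
  by rewrite (vintegrable0 mtm).2 lno_T0.
move=> a B g mB [gi gti gE].
have [iB IB] := vintegrable_indic mm mB; have [itB ItB] := vintegrable_indic mtm mB.
split.
- by have [] := vintegrableP mm a iB gi.
- by have [] := vintegrableP mtm a itB gti.
move=> A mA; have mBA := measurableI _ _ mB mA.
have [iBA _] := vintegrable_indic mm mBA.
have [itBA ItBA] := vintegrable_indic mtm mBA.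
have -> : (fun x => (a * \1_B x + g x) * \1_A x) =
    (fun x => a * \1_(B `&` A) x + g x * \1_A x).
  by apply/funext => x; rewrite mulrDl -mulrA indicI.
apply: etrans (vintegrableP mtm a itBA (vintegrable_mulindic mtm mA gti)).2 _.
rewrite (gE A mA) ItBA.
exact: esym (lno_T_linear mm a iBA (vintegrable_mulindic mm mA gi)).
Qed.

(** By the Hahn sign of [psi \o mt], the left side is psi at the integral of a function of modulus
    f; for a [good] f that integral is a value of T, and T is a contraction. *)
Let good_integral_le psi (k : R) f : continuous psi -> 0 <= k ->
  (forall y, `|psi y| <= k * `|y|) -> good f -> (forall x, 0 <= f x) ->
  (\int[vvariation (psi \o mt)]_x (f x)%:E <= k%:E * L1norm m f)%E.
Proof.
move=> psic k0 psik [fi fti fE] f0.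
have [P mP PE] := signed_integral_sign (vector_measure_comp mtm psic).
have mC := measurableC mP.
have fP := vintegrable_mulindic mm mP fi; have fC := vintegrable_mulindic mm mC fi.
have ftP := vintegrable_mulindic mtm mP fti; have ftC := vintegrable_mulindic mtm mC fti.
rewrite -PE//; last exact: vintegrable_sintegrable.
have sE : (fun x => f x * (\1_P x - \1_(~` P) x)) =
    (fun x => -1 * (f x * \1_(~` P) x) + f x * \1_P x).
  by apply/funext => x; ring.
have gi := vintegrable_sign mm mP fi; have gti := vintegrable_sign mtm mP fti.
rewrite -(integration_operatorP psic gti) sE.
rewrite (vintegrableP mtm (-1) ftC ftP).2 (fE _ mP) (fE _ mC) -(lno_T_linear mm _ fC fP) -sE.
rewrite (le_trans (_ : _ <= (k * `|lno_T m (fun x => f x * (\1_P x - \1_(~` P) x))|)%:E)%E)//.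
  by rewrite lee_fin (le_trans (ler_norm _)).
rewrite EFinM; apply: lee_wpmul2l; first by rewrite lee_fin.
rewrite (le_trans (norm_lno_T mm gi))// (eq_L1norm _ (g := f))// => x.
by rewrite normrM norm_sign_indic mulr1.
Qed.

Section nonnegative.
Variable f : T -> R.
Hypotheses (fi : vintegrable m f) (f0 : forall x, 0 <= f x).

Let mf : measurable_fun setT f. Proof. by case: fi. Qed.
Let mEf : measurable_fun setT (EFin \o f). Proof. exact/measurable_EFinP. Qed.

Let h := nnsfun_approx measurableT mEf.

Let h_le n x : h n x <= f x.
Proof. by rewrite -lee_fin /h nnsfun_approxE le_approx// => y _; rewrite lee_fin. Qed.

Let h_cvg x : h ^~ x @ \oo --> f x.
Proof.
have := @cvg_nnsfun_approx _ _ _ _ measurableT _ mEf (fun x _ => f0 x) x I.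
by move=> /fine_cvg.
Qed.

Let h_nd x : {homo h ^~ x : n k / (n <= k)%N >-> n <= k}.
Proof. by move=> n k nk; exact: (lefP _ _ (nd_nnsfun_approx measurableT mEf nk)). Qed.

(** Monotone convergence from simple functions. It comes before the existence of the vector
    integrals of f and supplies the dominating function for it. *)
Let integral_le psi (k : R) : continuous psi -> 0 <= k ->
  (forall y, `|psi y| <= k * `|y|) ->
  (\int[vvariation (psi \o mt)]_x (f x)%:E <= k%:E * L1norm m f)%E.
Proof.
move=> psic k0 psik.
have [mu muE] := measure_of_vvariation (vector_measure_comp mtm psic).
rewrite (eq_integral_set_function _ _ muE).
have mh n : measurable_fun setT (fun x => (h n x)%:E) by exact/measurable_EFinP.
have h0 n x : setT x -> (0 <= (h n x)%:E)%E by rewrite lee_fin.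
have hnd x : setT x -> {homo (fun n => (h n x)%:E) : n k / (n <= k)%N >-> (n <= k)%E}.
  by move=> _ n j nj; rewrite lee_fin; exact: h_nd.
have := @cvg_monotone_convergence _ _ _ mu setT measurableT _ mh h0 hnd.
rewrite (_ : (fun x => limn _) = (fun x => (f x)%:E)); last first.
  apply/funext => x; apply/cvg_lim => //.
  by apply: cvg_EFin; [exact: nearW|exact: h_cvg].
move=> hf; rewrite -(cvg_lim _ hf)//; apply: lime_le; first by apply/cvg_ex; eexists; exact: hf.
apply: nearW => n.
have := good_integral_le psic k0 psik (good_nnsfun (h n)) (fun x => @fun_ge0 _ _ (h n) x).
rewrite (eq_integral_set_function _ _ muE) => /le_trans; apply.
apply: lee_wpmul2l; first by rewrite lee_fin.
by apply: le_L1norm => // x; rewrite !ger0_norm// h_le.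
Qed.

(** The remainders g_n = f - h_n are dominated by f, so all T g_n lie in one dilate of K, and their
    images in X tend weakly to 0 by dominated convergence. Hence psi (T g_n) tends to 0, while psi
    (T h_n) is the integral of h_n and tends to that of f. *)
Lemma lno_T_integral_ge0 psi : continuous psi ->
  sintegrable (psi \o mt) f /\
  psi (lno_T m f) = signed_integral (psi \o mt) setT f.
Proof.
move=> psic; have [k k0 psik] := dual_bound psic.
have fs : sintegrable (psi \o mt) f.
  split=> //; under eq_fun do rewrite ger0_norm//.
  rewrite (le_lt_trans (integral_le psic (ltW k0) psik))//.
  by rewrite lte_mul_pinfty ?lee_fin ?(ltW k0)//; exact: (L1norm_lty mm).
split=> //.
pose g n x := -1 * h n x + f x.
have hi n : vintegrable m (h n) by have [] := good_nnsfun (h n).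
have gi n : vintegrable m (g n) by have [] := vintegrableP mm (-1) (hi n) fi.
have gle n x : `|g n x| <= `|f x|.
  rewrite /g mulN1r addrC ger0_norm ?subr_ge0 ?h_le// ger0_norm//.
  by rewrite gerBl fun_ge0.
have gcvg x : g ^~ x @ \oo --> 0.
  rewrite (_ : g ^~ x = (fun n => f x - h n x)); last first.
    by apply/funext => n; rewrite /g mulN1r addrC.
  rewrite -(subrr (f x)); apply: cvgB; [exact: cvg_cst|exact: h_cvg].
have [L L0 fL] := L1norm_bound mm fi.
have gL n : lno_dilate L (lno_T m (g n)).
  rewrite /lno_dilate (lno_TK mm (gi n)); apply: (lno_body_scale mm L0 (gi n)).
  by rewrite (le_trans _ fL)//; apply: le_L1norm => //; case: (gi n).
have phig (phi : {linear X -> R^o}) : continuous phi ->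
    (fun n => phi (lno_J (lno_T m (g n)))) @ \oo --> (0 : R^o).
  move=> phic.
  have <- : signed_integral (phi \o m) setT (fun=> 0) = 0.
    by rewrite -(integration_operatorP phic (vintegrable0 mm).1) (vintegrable0 mm).2 linear0.
  under eq_fun do rewrite (lno_TK mm (gi _)) (integration_operatorP phic (gi _)).
  apply: (signed_integral_cvg (vector_measure_comp mm phic) _ _ gcvg gle).
    by move=> n; case: (gi n).
  exact: vintegrable_sintegrable.
have h1 := bounded_weak_cvg psic L0 gL phig.
have h2 : (fun n => signed_integral (psi \o mt) setT (h n)) @ \oo -->
    signed_integral (psi \o mt) setT f.
  apply: (signed_integral_cvg (vector_measure_comp mtm psic) _ fs h_cvg) => // n x.
  by rewrite !ger0_norm// h_le.
have gE n : psi (lno_T m (g n)) = psi (lno_T m f) - signed_integral (psi \o mt) setT (h n).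
  have [_ hti hE] := good_nnsfun (h n).
  rewrite (lno_T_linear mm (-1) (hi n) fi) scaleN1r addrC linearB.
  rewrite -(integration_operatorP psic hti).
  have := hE _ measurableT; under eq_fun do rewrite indicE in_setT mulr1.
  by move=> ->.
apply/eqP; rewrite -subr_eq0; apply/eqP.
have h3 : (fun n => psi (lno_T m (g n))) @ \oo -->
    (psi (lno_T m f) - signed_integral (psi \o mt) setT f : R^o).
  by under eq_fun do rewrite gE; apply: (@cvgB _ R^o) => //; exact: cvg_cst.
exact: cvg_unique h3 h1.
Qed.

Lemma L1norm_lno_ge0 : (L1norm mt f <= L1norm m f)%E.
Proof.
apply: L1norm_le => psi [psic psib]; under eq_fun do rewrite ger0_norm//.
rewrite (le_trans (integral_le psic ler01 _)) ?mul1e// => y.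
by rewrite mul1r.
Qed.

End nonnegative.


Let lno_vintegrable_ge0 f : vintegrable m f -> (forall x, 0 <= f x) ->
  vintegrable mt f /\ integration_operator mt f = lno_T m f.
Proof.
move=> fi f0.
have H A : measurable A ->
    has_vintegral mt setT (fun x => f x * \1_A x) (lno_T m (fun x => f x * \1_A x)).
  move=> mA psi psic.
  have fA0 x : 0 <= f x * \1_A x by rewrite mulr_ge0// indicE.
  by have [] := lno_T_integral_ge0 (vintegrable_mulindic mm mA fi) fA0 psic.
split.
  apply: (vintegrable_intro mtm) => [|psi psic|A mA]; last by eexists; exact: H.
  - by case: fi.
  - by have [] := lno_T_integral_ge0 fi f0 psic.
apply: vintegralE => psi psic.
by have [] := lno_T_integral_ge0 fi f0 psic.
Qed.

Lemma lno_vintegrable f : vintegrable m f ->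
  vintegrable mt f /\ integration_operator mt f = lno_T m f.
Proof.
move=> fi; have ni := vintegrable_norm mm fi.
(* f is the difference of f + |f| and |f|, both non-negative. *)
have [gi gE] := vintegrableP mm 1 fi ni.
have g0 x : 0 <= 1 * f x + `|f x|.
  by rewrite mul1r -lerBlDl sub0r -normrN ler_norm.
have [nti ntE] := lno_vintegrable_ge0 ni (fun x => normr_ge0 _).
have [gti gtE] := lno_vintegrable_ge0 gi g0.
have fE : f = (fun x => -1 * `|f x| + (1 * f x + `|f x|)).
  by apply/funext => x; rewrite mul1r mulN1r addrC addrK.
have [fti ftE] := vintegrableP mtm (-1) nti gti.
by rewrite fE ftE ntE gtE (lno_T_linear mm _ ni gi).
Qed.

Lemma L1norm_lno f : vintegrable m f -> L1norm m f = L1norm mt f.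
Proof.
move=> fi; apply/eqP; rewrite eq_le L1norm_lno_J/=.
have nE (nu : set T -> X) : L1norm nu f = L1norm nu (fun x => `|f x|).
  by apply: eq_L1norm => x; rewrite normr_id.
have ntE : L1norm mt f = L1norm mt (fun x => `|f x|).
  by apply: eq_L1norm => x; rewrite normr_id.
by rewrite nE ntE; apply: L1norm_lno_ge0 => //; exact: (vintegrable_norm mm).
Qed.

End lno_integrals.

(** * Comparison of the two variations *)

Section lno_variation.
Context d (T : measurableType d) (R : realType) (X : completeNormedModType R).
Variable m : set T -> X.
Hypothesis mm : vector_measure m.
Implicit Types (A B : set T).
Local Notation mt := (lno_measure m).
Local Notation C := (lno_const R).

Let mtm : vector_measure mt. Proof. exact: lno_measure_vector_measure. Qed.

Let C0 : 0 < C. Proof. exact: lt_trans (lno_const_gt1 R). Qed.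
Let sC0 : 0 < Num.sqrt C. Proof. by rewrite sqrtr_gt0. Qed.

Lemma norm_le_lno_measure A : measurable A -> `|m A| <= `|mt A|.
Proof. by move=> mA; rewrite -(lno_J_measure mm mA) norm_lno_J. Qed.

Lemma semivariation_le_vvariation A : (semivariation m A <= vvariation m A)%E.
Proof.
apply: ge_ereal_sup => _ [phi [_ phib] <-]; apply: vvariation_le => n F mF tF FA.
rewrite (@le_trans _ _ (\sum_(i < n) `|m (F i)|)%:E)//.
  by rewrite lee_fin; apply: ler_sum => i _; exact: phib.
by apply: ereal_sup_ubound; exists n, F.
Qed.

(** The semivariation and the norm of m(A) are both at most |m|(A), so interpolation gives |mt(A)|^2
    <= C |m|(A)^2; this is the origin of the square root of C. *)
Lemma lno_measure_le_vvariation A : measurable A ->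
  (`|mt A|%:E <= (Num.sqrt C)%:E * vvariation m A)%E.
Proof.
move=> mA; have v0 := vvariation_ge0 m mA.
have [->|voo] := eqVneq (vvariation m A) +oo%E.
  by rewrite gt0_muley ?leey// lte_fin.
have vfin : vvariation m A \is a fin_num by rewrite ge0_fin_numE// ltey.
have := lno_measure_interpolation mm mA.
have h : (C%:E * semivariation m A * `|m A|%:E <=
    C%:E * vvariation m A * vvariation m A)%E.
  apply: lee_pmul => //.
  - apply: mule_ge0; first by rewrite lee_fin ltW.
    by rewrite (semivariationE mm mA) L1norm_ge0.
  - apply: lee_wpmul2l; first by rewrite lee_fin ltW.
    exact: semivariation_le_vvariation.
  - exact: norm_le_vvariation.
move=> /le_trans/(_ h); rewrite -(fineK vfin) -!EFinM !lee_fin => {}h.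
rewrite -(@ler_pXn2r _ 2) ?nnegrE//; last first.
  by apply: mulr_ge0; [exact: ltW|exact: fine_ge0].
by rewrite exprMn (sqr_sqrtr (ltW C0)) expr2 mulrA.
Qed.

Lemma vvariation_le_lno A : (vvariation m A <= vvariation mt A)%E.
Proof.
apply: vvariation_le => n F mF tF FA.
rewrite (@le_trans _ _ (\sum_(i < n) `|mt (F i)|)%:E)//.
  by rewrite lee_fin; apply: ler_sum => i _; exact: norm_le_lno_measure.
by apply: ereal_sup_ubound; exists n, F.
Qed.

Lemma lno_vvariation_le A : measurable A ->
  (vvariation mt A <= (Num.sqrt C)%:E * vvariation m A)%E.
Proof.
move=> mA; have [mu muE] := measure_of_vvariation mm.
apply: vvariation_le => n F mF tF FA; rewrite -sumEFin.
apply: (@le_trans _ _ (\sum_(i < n) (Num.sqrt C)%:E * mu (F i))%E).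
  by apply: lee_sum => i _; rewrite -(muE _ (mF i)); exact: lno_measure_le_vvariation.
rewrite -ge0_sume_distrr// -measure_semi_additive_ord//; last exact: bigsetU_measurable.
rewrite muE// (_ : \big[setU/set0]_(i < n) F i = A)// -FA -bigcup_seq.
by apply: eq_bigcupl; split=> i //= _; exact: mem_index_enum.
Qed.

Lemma lno_vvariation_lty A : measurable A ->
  (vvariation m A < +oo)%E -> (vvariation mt A < +oo)%E.
Proof.
move=> mA voo; rewrite (le_lt_trans (lno_vvariation_le mA))//.
by rewrite lte_mul_pinfty// ?lee_fin ?(ltW sC0)// ge0_fin_numE ?vvariation_ge0.
Qed.

End lno_variation.

(** * Bochner integration *)

Section simple_maps.
Context d (T : measurableType d) (R : realType).

(** [vsimple] with an arbitrary codomain, so that pairs of simple maps and truth values are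
    covered. *)
Definition fin_simple (U : Type) (s : T -> U) :=
  finite_set (range s) /\ forall u, measurable (s @^-1` [set u]).

Lemma fin_simple_preimage (U : Type) (s : T -> U) (B : set U) :
  fin_simple s -> measurable (s @^-1` B).
Proof.
move=> [sf sm].
have -> : s @^-1` B = \bigcup_(u in range s `&` B) s @^-1` [set u].
  apply/seteqP; split=> [x Bx|x [u [_ Bu] /= xu]]; last by rewrite /= xu.
  by exists (s x) => //; split=> //; exists x.
by apply: fin_bigcup_measurable => //; exact: finite_setIl.
Qed.

(** Preimages are finite unions of level sets, whatever the map [q]. In
    [lno_derivative_simple_approx] that map is obtained by choice. *)
Lemma fin_simple_comp (U V : Type) (q : U -> V) (s : T -> U) :
  fin_simple s -> fin_simple (q \o s).
Proof.
move=> ss; split=> [|v]; last exact: (fin_simple_preimage (q @^-1` [set v]) ss).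
by have := finite_image q ss.1; rewrite image_comp.
Qed.

Lemma fin_simple_pair (U V : Type) (s : T -> U) (t : T -> V) :
  fin_simple s -> fin_simple t -> fin_simple (fun x => (s x, t x)).
Proof.
move=> [sf sm] [tf tm]; split.
  apply: (@sub_finite_set _ _ (range s `*` range t)); last exact: finite_setX.
  by move=> _ [x _ <-]; split; exists x.
move=> [u v]; rewrite (_ : _ @^-1` _ = s @^-1` [set u] `&` t @^-1` [set v]).
  exact: measurableI.
by apply/seteqP; split=> x /= [-> ->].
Qed.

Lemma fin_simple_measurable (s : T -> R) : fin_simple s -> measurable_fun setT s.
Proof. by move=> ss _ B _; rewrite setTI; exact: fin_simple_preimage. Qed.

Lemma fin_simple_restrict (U : Type) (s : T -> U) (N : set T) (u0 : U) :
  fin_simple s -> measurable N -> fin_simple (fun x => if x \in N then u0 else s x).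
Proof.
move=> ss mN.
have Ns : fin_simple (fun x => x \in N).
  split=> [|b].
    by apply: (@sub_finite_set _ _ setT) => //; exact: finite_finset.
  have : (fun x => x \in N) @^-1` [set b] = (if b then N else ~` N).
    case: b; apply/seteqP; split=> x /=.
    - by move/set_mem.
    - by move/mem_set.
    - by move=> + /mem_set Nx; rewrite Nx.
    - by move=> Nx; rewrite memNset.
  by move=> ->; case: b => //; exact: measurableC.
exact: (fin_simple_comp (fun p => if p.1 then u0 else p.2) (fin_simple_pair Ns ss)).
Qed.

Lemma fin_simple_bounded (Z : normedModType R) (s : T -> Z) : fin_simple s ->
  exists2 M, 0 <= M & forall x, `|s x| <= M.
Proof.
move=> [/finite_seqP[l sl] _].
have [M M0 lM] : exists2 M, 0 <= M & forall z, z \in l -> `|z| <= M.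
  elim: l {sl} => [|z l [M M0 IH]]; first by exists 0.
  exists (`|z| + M); first by rewrite addr_ge0.
  move=> w; rewrite inE => /predU1P[->|/IH wM]; first by rewrite lerDl.
  by rewrite (le_trans wM)// lerDr.
exists M => // x; apply: lM.
by have : range s (s x) by [exists x]; rewrite sl.
Qed.

End simple_maps.

Section negligible_nonmeasurable.
Context d (T : measurableType d) (R : realType) (mu : {measure set T -> \bar R}).
Import HBNNSimple.

(** The functions may be non-measurable, so the argument acts on the simple functions below them:
    restricting these to the complement of [N] leaves their integrals unchanged. *)
Lemma eq_integral_negligible (N : set T) (f g : T -> \bar R) :
  measurable N -> mu N = 0%E -> (forall x, 0 <= f x)%E -> (forall x, 0 <= g x)%E ->
  (forall x, ~ N x -> f x = g x) -> (\int[mu]_x f x = \int[mu]_x g x)%E.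
Proof.
move=> mN N0.
suff H (u v : T -> \bar R) : (forall x, 0 <= u x)%E -> (forall x, 0 <= v x)%E ->
    (forall x, ~ N x -> u x = v x) -> (\int[mu]_x u x <= \int[mu]_x v x)%E.
  move=> f0 g0 fg; apply/eqP; rewrite eq_le !H// => x Nx.
  by rewrite fg.
move=> u0 v0 uv; rewrite !ge0_integralTE//; apply: ge_ereal_sup => _ [h /= hu <-].
apply: ereal_sup_ubound; exists (proj_nnsfun h (measurableC mN)).
  move=> x /=; rewrite mindicE in_setC; have [/set_mem Nx|] := boolP (x \in N).
    by rewrite mulr0.
  by rewrite mulr1 => /negP; rewrite inE => Nx; rewrite -uv.
rewrite -!integralT_nnsfun; apply: ae_eq_integral => //; try exact/measurable_EFinP.
exists N; split=> // x /= /not_implyP[_]; apply: contra_notP => Nx.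
by rewrite mindicE in_setC memNset// mulr1.
Qed.

End negligible_nonmeasurable.

Section bochner_theory.
Context d (T : measurableType d) (R : realType) (mu : {finite_measure set T -> \bar R}).
Context (Z : normedModType R).
Implicit Types (s t : T -> Z) (F : T -> Z) (A : set T) (phi : {linear Z -> R^o}).

(** Convergence everywhere, in place of almost everywhere as in [strongly_measurable]: it makes |F|
    and phi o F measurable without completing the sigma-algebra. [ae_vlimit] reduces to this
    case. *)
Definition vlimit (s : nat -> T -> Z) F :=
  (forall n, vsimple (s n)) /\ forall x, s ^~ x @ \oo --> F x.

Lemma vlimit_comp (s : nat -> T -> Z) F (q : Z -> R) : continuous q -> vlimit s F ->
  measurable_fun setT (q \o F).
Proof.
move=> qc [ss sF]; apply: (@measurable_fun_cvg _ _ _ _ (fun n => q \o s n)).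
  by move=> n; apply: fin_simple_measurable; exact: fin_simple_comp (ss n).
by move=> x _; apply: continuous_cvg; [exact: qc|exact: sF].
Qed.

Lemma vlimitB (s : nat -> T -> Z) F t : vlimit s F -> vsimple t ->
  vlimit (fun n x => s n x - t x) (fun x => F x - t x).
Proof.
move=> [ss sF] ts; split=> [n|x]; last by apply: cvgB => //; exact: cvg_cst.
exact: (fin_simple_comp (fun p => p.1 - p.2) (fin_simple_pair (ss n) ts)).
Qed.

Lemma measurable_norm_vlimit (s : nat -> T -> Z) F : vlimit s F ->
  measurable_fun setT (fun x => `|F x|).
Proof. exact: (@vlimit_comp _ _ (fun z => `|z|) (@norm_continuous _ _)). Qed.

Lemma vlimit_cst t : vsimple t -> vlimit (fun=> t) t.
Proof. by move=> ts; split=> // x; exact: cvg_cst. Qed.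

Lemma integrable_bounded (f : T -> R) (M : R) : measurable_fun setT f ->
  (forall x, `|f x| <= M) -> mu.-integrable setT (EFin \o f).
Proof.
move=> mf fM; apply: (le_integrable measurableT _ _
  (finite_measure_integrable_cst mu M measurableT)).
  exact/measurable_EFinP.
by move=> x _; rewrite lee_fin (le_trans (fM x))// ler_norm.
Qed.

Lemma functional_simple_integrable phi s : vsimple s ->
  mu.-integrable setT (fun x => (phi (s x) : R)%:E).
Proof.
move=> ss; have ps : fin_simple (phi \o s : T -> R^o) by exact: fin_simple_comp.
have [M _ sM] := fin_simple_bounded ps.
by apply: (@integrable_bounded (phi \o s) M) => //; exact: fin_simple_measurable.
Qed.

(** The bridge to scalar integration: estimates for vector integrals are obtained by evaluating at a
    norming functional. *)
Lemma functional_vsimple_integral phi s A : vsimple s -> measurable A ->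
  phi (vsimple_integral mu A s) = \int[mu]_(x in A) phi (s x).
Proof.
move=> ss mA; rewrite /vsimple_integral fsbig_finite; last by case: ss.
have -> : \int[mu]_(x in A) phi (s x) = \int[mu]_(x in A)
    \sum_(z <- finmap.enum_fset (fset_set (range s))) phi z * \1_(s @^-1` [set z]) x.
  apply: eq_Rintegral => x _.
  have sx : s x \in finmap.enum_fset (fset_set (range s)).
    by have := in_fset_set ss.1 (s x); rewrite [RHS]mem_set//; exists x.
  rewrite (bigD1_seq (s x)) ?finmap.fset_uniq//= big1 ?addr0.
    by rewrite indicE mem_set// mulr1.
  by move=> z zs; rewrite indicE memNset ?mulr0//= => /esym/eqP; rewrite (negbTE zs).
elim: (finmap.enum_fset _) => [|z l IH].
  rewrite !big_nil linear0; under eq_Rintegral do rewrite big_nil.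
  by rewrite Rintegral_cst// mul0r.
have iZ (w : Z) : mu.-integrable A (EFin \o (fun x => phi w * \1_(s @^-1` [set w]) x)).
  apply: (integrableS measurableT) => //; apply: (@integrable_bounded _ `|phi w|).
    by apply: measurable_funM => //; apply: measurable_indic; exact: ss.2.
  by move=> x; rewrite normrM ler_piMr// indicE; case: (_ \in _); rewrite ?normr1 ?normr0.
have iS (l' : seq Z) : mu.-integrable A (EFin \o (fun x =>
    \sum_(w <- l') phi w * \1_(s @^-1` [set w]) x)).
  rewrite (_ : _ \o _ = fun x => (\sum_(w <- l') (phi w * \1_(s @^-1` [set w]) x)%:E)%E).
    by apply: integrable_sum => // w _; exact: iZ.
  by apply/funext => x; rewrite /= sumEFin.
rewrite !big_cons linearD linearZ/= IH.
under [in RHS]eq_Rintegral do rewrite big_cons.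
rewrite (RintegralD mA (iZ z) (iS l)); congr (_ + _).
rewrite RintegralZl//; last first.
  apply: (integrableS measurableT) => //; apply: (@integrable_bounded _ 1).
    by apply: measurable_indic; exact: ss.2.
  by move=> x; rewrite indicE; case: (_ \in _); rewrite ?normr1 ?normr0.
rewrite /Rintegral integral_indic//; last exact: ss.2.
by rewrite setIC mulrC.
Qed.

Lemma vsimple_integral_dist s t A : vsimple s -> vsimple t -> measurable A ->
  ((`|vsimple_integral mu A s - vsimple_integral mu A t|)%:E <=
    \int[mu]_x `|s x - t x|%:E)%E.
Proof.
move=> ss ts mA; set w := _ - _; have [phi [_ phib] <-] := norming_functional w.
have is_ := integrableS measurableT mA (@subsetT _ A) (functional_simple_integrable phi ss).
have it := integrableS measurableT mA (@subsetT _ A) (functional_simple_integrable phi ts).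
rewrite /w linearB !functional_vsimple_integral// -RintegralB//.
have sts : vsimple (fun x => s x - t x).
  exact: (fin_simple_comp (fun p => p.1 - p.2) (fin_simple_pair ss ts)).
have ist := functional_simple_integrable phi sts.
have istA := integrableS measurableT mA (@subsetT _ A) ist.
apply: (@le_trans _ _ (`|\int[mu]_(x in A) (phi (s x) - phi (t x))|)%:E).
  by rewrite lee_fin ler_norm.
rewrite (_ : \int[mu]_(x in A) _ = \int[mu]_(x in A) phi (s x - t x)); last first.
  by apply: eq_Rintegral => x _; rewrite linearB.
rewrite EFin_normr_Rintegral// (le_trans (le_abse_integral _ _ _))//.
  by case/integrableP: istA.
have mst : measurable_fun setT (fun x => (`|s x - t x|)%:E).
  by apply/measurable_EFinP; exact: measurable_norm_vlimit (vlimit_cst sts).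
apply: (@le_trans _ _ (\int[mu]_(x in A) `|s x - t x|%:E)%E).
  apply: ge0_le_integral => //.
  - by apply: measurableT_comp => //; case/integrableP: istA.
  - exact: measurable_funTS.
  - by move=> x _; rewrite /= lee_fin phib.
by apply: ge0_subset_integral => // x _; rewrite lee_fin.
Qed.

Lemma approx_dist (u : nat -> T -> Z) F s t : vlimit u F -> vsimple s -> vsimple t ->
  (\int[mu]_x `|s x - t x|%:E <=
    \int[mu]_x `|F x - s x|%:E + \int[mu]_x `|F x - t x|%:E)%E.
Proof.
move=> uF ss ts.
have m1 (v : T -> Z) : vsimple v -> measurable_fun setT (fun x => (`|F x - v x|)%:E).
  by move=> vs; apply/measurable_EFinP; exact: measurable_norm_vlimit (vlimitB uF vs).
have sts : vsimple (fun x => s x - t x).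
  exact: (fin_simple_comp (fun p => p.1 - p.2) (fin_simple_pair ss ts)).
rewrite -ge0_integralD//; [|exact: m1..]; apply: ge0_le_integral => //.
- by apply/measurable_EFinP; exact: measurable_norm_vlimit (vlimit_cst sts).
- by apply: emeasurable_funD; exact: m1.
- move=> x _; rewrite -EFinD lee_fin -(distrC (s x)).
  rewrite (le_trans _ (ler_normD _ _))// addrA subrK//.
Qed.

Lemma functional_integrable phi (u : nat -> T -> Z) F t : continuous phi ->
  vlimit u F -> vsimple t -> (\int[mu]_x `|F x - t x|%:E < +oo)%E ->
  mu.-integrable setT (fun x => (phi (F x) : R)%:E).
Proof.
move=> phic uF ts Ft; have [k k0 phik] := dual_bound phic.
have i1 : mu.-integrable setT (fun x => (`|F x - t x|)%:E).
  apply/integrableP; split.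
    by apply/measurable_EFinP; exact: measurable_norm_vlimit (vlimitB uF ts).
  by under eq_integral do rewrite abse_EFin normr_id.
have [M M0 tM] := fin_simple_bounded ts.
have i2 := finite_measure_integrable_cst mu M measurableT.
have i3 := integrableZl measurableT k (integrableD measurableT i1 i2).
apply: le_integrable i3 => //.
  by apply/measurable_EFinP; exact: (@vlimit_comp u F (phi : Z -> R)).
move=> x _; rewrite /= lee_fin (le_trans (phik _))// ger0_norm; last first.
  by rewrite mulr_ge0 ?addr_ge0// ltW.
rewrite ler_wpM2l ?(ltW k0)// -{1}(subrK (t x) (F x)).
by rewrite (le_trans (ler_normD _ _))// lerD2l.
Qed.

Lemma functional_dist phi (k : R) (u : nat -> T -> Z) F t A : continuous phi -> 0 <= k ->
  (forall z, `|phi z| <= k * `|z|) ->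
  vlimit u F -> vsimple t -> (\int[mu]_x `|F x - t x|%:E < +oo)%E -> measurable A ->
  ((`|\int[mu]_(x in A) phi (F x) - phi (vsimple_integral mu A t)|)%:E <=
    k%:E * \int[mu]_x `|F x - t x|%:E)%E.
Proof.
move=> phic k0 phik uF ts Ft mA.
have iF := integrableS measurableT mA (@subsetT _ A) (functional_integrable phic uF ts Ft).
have it := integrableS measurableT mA (@subsetT _ A) (functional_simple_integrable phi ts).
rewrite functional_vsimple_integral// -RintegralB//.
have iFt := integrableB mA iF it.
rewrite EFin_normr_Rintegral//.
rewrite (le_trans (le_abse_integral _ _ _))//; first by case/integrableP: iFt.
have mFt : measurable_fun setT (fun x => (`|F x - t x|)%:E).
  by apply/measurable_EFinP; exact: measurable_norm_vlimit (vlimitB uF ts).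
rewrite -ge0_integralZl//.
apply: (@le_trans _ _ (\int[mu]_(x in A) (k%:E * `|F x - t x|%:E))%E).
  apply: ge0_le_integral => //.
  - by apply: measurableT_comp => //; case/integrableP: iFt.
  - by apply: measurable_funTS; exact: measurable_funeM.
  - by move=> x _; rewrite /= -linearB -EFinM lee_fin phik.
apply: ge0_subset_integral => //; first exact: measurable_funeM.
by move=> x _; rewrite -EFinM lee_fin mulr_ge0.
Qed.

Lemma bochner_approx_bounded (u : nat -> T -> Z) F (M : R) : vlimit u F ->
  (forall n x, `|u n x| <= M) -> bochner_approx mu F u.
Proof.
move=> uF uM; split; first exact: uF.1.
have FM x : `|F x| <= M.
  have h : (fun n => `|u n x|) @ \oo --> `|F x| by apply: cvg_norm; exact: uF.2.
  by apply: (cvgr_to_le h); apply: nearW => n; exact: uM.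
have -> : 0%E = (\int[mu]_x (cst 0%E x) : \bar R)%E by rewrite integral0.
apply: (@dominated_cvg _ _ _ mu setT measurableT _ _ (cst (M + M)%:E)) => //.
- by move=> n; apply/measurable_EFinP; exact: measurable_norm_vlimit (vlimitB uF (uF.1 n)).
- move=> x _; apply: cvg_EFin; first exact: nearW.
  rewrite -(normr0 Z) -(subrr (F x)); apply: cvg_norm; apply: cvgB; first exact: cvg_cst.
  exact: uF.2.
- exact: finite_measure_integrable_cst.
- move=> n x _; rewrite /= normr_id lee_fin (le_trans (ler_normB _ _))//.
  by rewrite lerD.
Qed.

End bochner_theory.

Lemma ge0_cvge0P (R : realType) (f : nat -> \bar R) : (forall n, 0 <= f n)%E ->
  f @ \oo --> 0%E <-> forall e : R, 0 < e -> \forall n \near \oo, (f n < e%:E)%E.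
Proof.
move=> f0; split=> [/fine_cvgP[ff /cvgrPdist_lt fe] e e0|fe].
  have := fe _ e0; apply: filterS2 ff => n fin /=.
  rewrite sub0r normrN ger0_norm ?fine_ge0// => h.
  by rewrite -(fineK fin) lte_fin.
apply/fine_cvgP; split.
  apply: filterS (fe _ ltr01) => n h.
  by rewrite ge0_fin_numE// (lt_trans h)// ltry.
apply/cvgrPdist_lt => e e0; apply: filterS (fe _ e0) => n h /=.
rewrite sub0r normrN ger0_norm ?fine_ge0// -lte_fin fineK//.
by rewrite ge0_fin_numE// (lt_trans h)// ltry.
Qed.

Section bochner_integral_theory.
Context d (T : measurableType d) (R : realType) (mu : {finite_measure set T -> \bar R}).

Section normed.
Context (Z : normedModType R).
Implicit Types (s : nat -> T -> Z) (F : T -> Z) (A : set T) (phi : {linear Z -> R^o}) (z : Z).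

Lemma bochner_approx_lt F s (e : R) : bochner_approx mu F s -> 0 < e ->
  \forall n \near \oo, (\int[mu]_x `|F x - s n x|%:E < e%:E)%E.
Proof.
move=> [_ sF] e0; move: sF; rewrite ge0_cvge0P; first exact.
by move=> n; apply: integral_ge0 => x _; rewrite lee_fin.
Qed.

(** The norming functional changes with n, but the bound of [functional_dist] is the same on the
    whole dual ball; scalar identities for [z] thus give convergence in norm. *)
Lemma weak_integral_cvg F (u s : nat -> T -> Z) A z : vlimit u F -> bochner_approx mu F s ->
  measurable A ->
  (forall phi, continuous phi -> phi z = \int[mu]_(x in A) phi (F x)) ->
  (fun n => vsimple_integral mu A (s n)) @ \oo --> z.
Proof.
move=> uF sF mA zE; apply/cvgrPdist_lt => e e0.
apply: filterS (bochner_approx_lt sF e0) => n h.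
have [phi [phic phib] phiz] := norming_functional (z - vsimple_integral mu A (s n)).
have phib1 y : `|phi y| <= 1 * `|y| by rewrite mul1r.
have := functional_dist phic ler01 phib1 uF (sF.1 n) (lt_trans h (ltry _)) mA.
rewrite mul1e -zE// -linearB phiz normr_id => h'.
by rewrite -lte_fin (le_lt_trans h').
Qed.

Lemma bochner_integralE F (u s : nat -> T -> Z) A z : vlimit u F -> bochner_approx mu F s ->
  measurable A ->
  (forall phi, continuous phi -> phi z = \int[mu]_(x in A) phi (F x)) ->
  bochner_integral mu A F = z.
Proof.
move=> uF sF mA zE; have zs := weak_integral_cvg uF sF mA zE.
rewrite /bochner_integral; case: xgetP => [y _ ys|/(_ z) []].
  exact: cvg_unique (ys _ sF) zs.
by move=> s' s'F; exact: weak_integral_cvg uF s'F mA zE.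
Qed.

End normed.

Section complete.
Context (Z : completeNormedModType R).
Implicit Types (F : T -> Z) (A : set T) (phi : {linear Z -> R^o}) (z : Z).

(** Completeness gives a limit along one approximating sequence; its scalar values identify it as
    the limit along every other, which is what [bochner_integral] asks for. *)
Lemma bochner_integralP F (u s : nat -> T -> Z) A phi : vlimit u F ->
  bochner_approx mu F s -> measurable A -> continuous phi ->
  phi (bochner_integral mu A F) = \int[mu]_(x in A) phi (F x).
Proof.
move=> uF sF mA.
pose v n := vsimple_integral mu A (s n).
have /cvg_ex[z vz] : cvg (v @ \oo).
  apply: cauchy_cvg; apply/cauchyP => e e0.
  have e20 : 0 < e / 2 by rewrite divr_gt0.
  have [N _ NP] := bochner_approx_lt sF e20.
  exists (v N); exists N => // n /= Nn.
  rewrite -ball_normE/= -lte_fin.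
  rewrite (le_lt_trans (vsimple_integral_dist mu (sF.1 N) (sF.1 n) mA))//.
  rewrite (le_lt_trans (approx_dist mu uF (sF.1 N) (sF.1 n)))// (splitr e) EFinD.
  exact: (lteD (NP N (leqnn N)) (NP n Nn)).
have zE (psi : {linear Z -> R^o}) : continuous psi ->
    psi z = \int[mu]_(x in A) psi (F x).
  move=> psic; have [k k0 psik] := dual_bound psic.
  have h1 : (fun n => psi (v n)) @ \oo --> psi z.
    by apply: continuous_cvg; [exact: psic|exact: vz].
  have h2 : (fun n => psi (v n)) @ \oo --> (\int[mu]_(x in A) psi (F x) : R^o).
    apply/cvgrPdist_lt => e e0.
    have ek0 : 0 < e / k by rewrite divr_gt0.
    apply: filterS (bochner_approx_lt sF ek0) => n h.
    have := functional_dist psic (ltW k0) psik uF (sF.1 n) (lt_trans h (ltry _)) mA.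
    move=> h'; rewrite -lte_fin (le_lt_trans h')//.
    by rewrite -lte_pdivlMl// muleC -EFinM.
  exact: cvg_unique h1 h2.
by move=> phic; rewrite (bochner_integralE uF sF mA zE) zE.
Qed.

End complete.

End bochner_integral_theory.

Section eq_bochner.
Context d (T : measurableType d) (R : realType) (Z : normedModType R).

Lemma eq_bochner_derivative (mu mu' : set T -> \bar R) (nu : set T -> Z) (h : T -> Z) :
  (forall A, measurable A -> mu A = mu' A) ->
  bochner_derivative mu nu h -> bochner_derivative mu' nu h.
Proof.
move=> mumu'.
have apE s : bochner_approx mu h s <-> bochner_approx mu' h s.
  rewrite /bochner_approx.
  by under eq_fun do rewrite (eq_integral_set_function _ _ mumu').
move=> [[[s [ss [N [mN N0 sN]]]] [t /apE ta]] nuE]; split.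
  split; last by exists t.
  by exists s; split=> //; exists N; split=> //; rewrite -mumu'.
move=> A mA; rewrite nuE// /bochner_integral; congr xget.
have sE r : bochner_approx mu' h r ->
    (fun n => vsimple_integral mu A (r n)) = (fun n => vsimple_integral mu' A (r n)).
  move=> [rs _]; apply/funext => n; apply: eq_fsbigr => z _.
  by rewrite mumu'//; apply: measurableI => //; exact: (rs n).2.
apply/seteqP; split=> z /= zr r.
  by move=> ra; rewrite -(sE _ ra); apply: zr; exact/apE.
by move=> /apE ra; rewrite (sE _ ra); exact: zr.
Qed.

(** G is replaced by 0 on a measurable null set outside which the approximants converge; neither
    approximating sequences nor integrals see the change. *)
Lemma ae_vlimit (mu : {measure set T -> \bar R}) (nu : set T -> Z) (G : T -> Z) :
  bochner_derivative mu nu G ->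
  exists G' (u s : nat -> T -> Z), [/\ vlimit u G', bochner_approx mu G' s,
    forall A, measurable A -> nu A = bochner_integral mu A G' &
    (\int[mu]_x `|G' x|%:E = \int[mu]_x `|G x|%:E)%E].
Proof.
move=> [[[u [us [N [mN N0 uN]]]] [s sG]] nuE].
pose G' x := if x \in N then 0 else G x.
have GG' x : ~ N x -> G' x = G x by move=> Nx; rewrite /G' memNset.
have aE t : bochner_approx mu G t <-> bochner_approx mu G' t.
  rewrite /bochner_approx; suff -> : (fun n => \int[mu]_x `|G x - t n x|%:E)%E =
    (fun n => \int[mu]_x `|G' x - t n x|%:E)%E by [].
  apply/funext => n; apply: (eq_integral_negligible mN N0) => // x Nx.
  by rewrite GG'.
exists G', (fun n x => if x \in N then 0 else u n x), s; split.
- split=> [n|x]; first exact: (fin_simple_restrict 0 (us n) mN).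
  rewrite /G'; have [xN|xN] := boolP (x \in N); first exact: cvg_cst.
  apply: contrapT => nu'; apply: (negP xN); rewrite inE; exact: uN.
- exact/aE.
- move=> A mA; rewrite nuE// /bochner_integral; congr xget.
  by apply/seteqP; split=> z /= zr r /aE; exact: zr.
- by apply: (eq_integral_negligible mN N0) => // x Nx; rewrite GG'.
Qed.

End eq_bochner.

(** * Density of a measure with respect to a larger one *)

Section density.
Context d (T : measurableType d) (R : realType).
Local Open Scope ereal_scope.

Lemma measurable_gt0 (r : T -> R) : measurable_fun setT r ->
  measurable [set x | 0 < r x]%R.
Proof.
move=> mr; rewrite (_ : [set x | _] = setT `&` r @^-1` `]0%R, +oo[%classic).
  exact: mr.
by apply/seteqP; split=> x /=; rewrite in_itv/= andbT// => -[].
Qed.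

Lemma null_set_integral_le0 (mu : {measure set T -> \bar R}) (r : T -> R) :
  mu.-integrable setT (EFin \o r) ->
  let E := [set x | 0 < r x]%R in \int[mu]_(x in E) (r x)%:E <= 0 ->
  measurable E /\ mu E = 0.
Proof.
move=> ri E rE; have /integrableP[/measurable_EFinP mr _] := ri.
have mE : measurable E by exact: measurable_gt0.
split=> //.
have mrE : measurable_fun E (EFin \o r).
  by apply: measurable_funTS; exact/measurable_EFinP.
have rE0 : \int[mu]_(x in E) `|(EFin \o r) x| = 0.
  rewrite (eq_integral (fun x => (r x)%:E)); last first.
    by move=> x /set_mem; rewrite /E/= => rx; rewrite ger0_norm// ltW.
  apply/eqP; rewrite eq_le rE/= integral_ge0// => x.
  by rewrite /E/= lee_fin => /ltW.
have [N [mN N0 EN]] := (ae_eq_integral_abs mu mE mrE).1 rE0.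
apply/eqP; rewrite eq_le measure_ge0 andbT -N0 le_measure ?inE//.
move=> x Ex; apply: EN => /= /(_ Ex) [rx0].
by move: Ex; rewrite /E/= rx0 ltxx.
Qed.

(** The Radon-Nikodym derivative has values in [0, 1] almost everywhere. It is truncated because the
    bounds are used at every point, in particular by [simple_approximation01]. *)
Lemma density_le1 (nu mu : {finite_measure set T -> \bar R}) :
  (forall A, measurable A -> nu A <= mu A) ->
  exists g : T -> R, [/\ measurable_fun setT g, forall x, (0 <= g x <= 1)%R,
    \int[mu]_x (g x)%:E = nu setT &
    forall A (h : T -> R), measurable A -> nu.-integrable A (EFin \o h) ->
      (\int[nu]_(x in A) h x = \int[mu]_(x in A) (h x * g x))%R].
Proof.
move=> numu.
have dom : nu `<< mu.
  apply/null_content_dominatesP => A mA mA0.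
  by apply/eqP; rewrite eq_le measure_ge0 andbT -mA0; exact: numu.
pose f := Radon_Nikodym (charge_of_finite_measure nu) mu.
pose r x := fine (f x).
have fr : f = EFin \o r.
  by apply/funext => x; rewrite /r /= fineK//; exact: Radon_Nikodym_fin_num.
have fi : mu.-integrable setT (EFin \o r) by rewrite -fr; exact: Radon_Nikodym_integrable.
have /integrableP[/measurable_EFinP mr _] := fi.
have fE A : measurable A -> \int[mu]_(x in A) (r x)%:E = nu A.
  move=> mA; transitivity (\int[mu]_(x in A) f x); first by rewrite fr.
  by rewrite -[LHS]Radon_Nikodym_integral.
have i1 := finite_measure_integrable_cst mu 1 measurableT.
pose r1 x := (r x - 1)%R; pose r2 x := (- r x)%R.
have mr1 : measurable_fun setT r1 by exact: measurable_funB.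
have mr2 : measurable_fun setT r2 by exact: measurable_funN.
have mE1 := measurable_gt0 mr1; have mE2 := measurable_gt0 mr2.
set E1 := [set x | _] in mE1; set E2 := [set x | _] in mE2.
(* On {r > 1} the integral of r - 1 is nu - mu <= 0, and on {r < 0} that of - r is - nu <= 0, so
   both sets are null. *)
have [||_ E10] := @null_set_integral_le0 mu r1.
- exact: (integrableB measurableT fi i1).
- rewrite -/E1 (_ : \int[mu]_(x in E1) _ =
    \int[mu]_(x in E1) (r x)%:E - \int[mu]_(x in E1) (cst 1%:E x)); last first.
    have j1 := integrableS measurableT mE1 (@subsetT _ E1) fi.
    have j2 := integrableS measurableT mE1 (@subsetT _ E1) i1.
    by rewrite -(integralB mE1 j1 j2).
  rewrite fE// integral_cst// mul1e leeBlDr ?add0e ?numu//.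
  exact: fin_num_measure.
have [||_ E20] := @null_set_integral_le0 mu r2.
- exact: integrableN fi.
- rewrite -/E2 (_ : \int[mu]_(x in E2) _ = (-1)%:E * \int[mu]_(x in E2) (r x)%:E).
    by rewrite fE// mulN1e leeNl oppe0.
  rewrite -(integralZl mE2); last exact: integrableS fi.
  by apply: eq_integral => x _; rewrite mulN1e.
pose g x := Num.max 0%R (Num.min 1%R (r x)).
have mg : measurable_fun setT g.
  apply: (@measurable_maxr _ _ _ _ (cst 0%R) (fun x => Num.min 1%R (r x))) => //.
  exact: (@measurable_minr _ _ _ _ (cst 1%R) r).
pose N := E1 `|` E2.
have mN : measurable N by exact: measurableU.
have N0 : mu N = 0.
  apply/eqP; rewrite eq_le measure_ge0 andbT -[leRHS]adde0 -{1}E10 -E20.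
  exact: measureU2.
have gr x : ~ N x -> g x = r x.
  move=> /not_orP[]; rewrite /E1 /E2 /r1 /r2 /= => /negP + /negP.
  rewrite -!leNgt subr_le0 oppr_le0 => h1 h2.
  by rewrite /g min_r// max_r.
have gint A (h : T -> R) : measurable A -> measurable_fun A h ->
    (\int[mu]_(x in A) (h x * g x)%:E = \int[mu]_(x in A) (h x * r x)%:E).
  move=> mA mh; apply: ae_eq_integral => //.
  - by apply/measurable_EFinP; apply: measurable_funM => //; exact: measurable_funTS.
  - by apply/measurable_EFinP; apply: measurable_funM => //; exact: measurable_funTS.
  - exists N; split=> // x /= /not_implyP[_]; apply: contra_notP => Nx.
    by rewrite gr.
exists g; split=> //.
- move=> x; rewrite /g le_max lexx/= ge_max ler01/=.
  by rewrite ge_min lexx.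
- have := gint setT (cst 1%R) measurableT (measurable_cst _).
  under eq_integral do rewrite mul1r.
  by move=> ->; under eq_integral do rewrite mul1r; rewrite fE.
- move=> A h mA hi; rewrite /Rintegral gint//; last first.
    by apply/measurable_EFinP; case/integrableP: hi.
  rewrite -(Radon_Nikodym_change_of_variables dom mA hi); congr fine.
  by apply: eq_integral => x _; rewrite -/f fr EFinM.
Qed.

End density.

(** * The derivative of the lifted measure *)

Lemma finite_measure_of_vvariation d (T : measurableType d) (R : realType)
    (Z : normedModType R) (nu : set T -> Z) :
  vector_measure nu -> finite_variation nu ->
  exists mu : {finite_measure set T -> \bar R},
    forall A, measurable A -> vvariation nu A = mu A.
Proof.
move=> num nufin; have [mu muE] := measure_of_vvariation num.
have foo : (mu setT < +oo)%E by rewrite -muE.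
exists (mfrestr measurableT foo) => A mA.
rewrite (muE _ mA) -[A in LHS]setIT; exact: erefl.
Qed.

Section lno_derivative.
Context d (T : measurableType d) (R : realType) (X : completeNormedModType R).
Variable m : set T -> X.
Hypothesis mm : vector_measure m.
Local Notation K := (lno_body m).
Local Notation C := (lno_const R).
Local Notation mt := (lno_measure m).

Let KT := dfjp_set K.

Let K0 : KT 0.
Proof.
have [k Kk] := dfjp_nonempty K.
have := @dfjp_absolutely_convex _ _ K k k 0 0 Kk Kk.
by rewrite !scale0r addr0; apply; rewrite normr0 addr0.
Qed.

Definition lno_lift (x : X) : lno_space m := insubd (0 : dfjp_space K) x.

Lemma lno_liftK x : KT x -> lno_J (lno_lift x) = x.
Proof. by move=> Kx; rewrite /lno_J /lno_lift insubdK// -(scale1r x); exact: dfjp_domZ. Qed.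

Lemma norm_lno_lift x : KT x -> `|lno_lift x| <= 1.
Proof.
move=> Kx; rewrite dfjp_normE -[val _]/(lno_J _) lno_liftK// -(scale1r x).
by rewrite (le_trans (dfjp_norm_leZ _ Kx))// normr1.
Qed.

Lemma lno_lift_dist x y : KT x -> KT y ->
  `|lno_lift x - lno_lift y| ^+ 2 <= C * (2 * `|x - y|).
Proof.
move=> Kx Ky.
have JE : lno_J (lno_lift x - lno_lift y) = x - y.
  by rewrite -[LHS]/(lno_Jlin m _) linearB/= !lno_liftK.
rewrite -JE; apply: dfjp_norm_lno_dilate => //.
(* x - y is twice the half difference, a point of K; hence the dilation factor 2. *)
exists (2^-1 *: x + (- 2^-1) *: y).
  apply: dfjp_absolutely_convex => //.
  by rewrite normrN gtr0_norm//; lra.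
rewrite JE scalerDr !scalerA mulrN divff ?pnatr_eq0//.
by rewrite scale1r scaleN1r.
Qed.

Section derivative.
Variable mu : {finite_measure set T -> \bar R}.
Hypothesis muE : forall A, measurable A -> vvariation m A = mu A.
Variables (G : T -> X) (u s : nat -> T -> X).
Hypotheses (uG : vlimit u G) (sG : bochner_approx mu G s)
  (mG : forall A, measurable A -> m A = bochner_integral mu A G).

Let weak_mG (phi : {linear X -> R^o}) A : continuous phi -> measurable A ->
  phi (m A) = \int[mu]_(x in A) phi (G x).
Proof. by move=> phic mA; rewrite mG//; exact: (bochner_integralP uG sG). Qed.

Let phiG_integrable (phi : {linear X -> R^o}) A : continuous phi -> measurable A ->
  mu.-integrable A (EFin \o (phi \o G : T -> R)).
Proof.
move=> phic mA; apply: (integrableS measurableT) => //.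
have /filter_ex[n h] := bochner_approx_lt sG ltr01.
exact: functional_integrable phic uG (sG.1 n) (lt_trans h (ltry _)).
Qed.

(** The norm of the indicator of A is the semivariation of A, which is at most |m|(A) = mu(A). *)
Let average_in_body A : measurable A -> mu A != 0%E ->
  KT ((fine (mu A))^-1 *: m A).
Proof.
move=> mA A0; have [iA IA] := vintegrable_indic mm mA.
have Afin : mu A \is a fin_num by exact: fin_num_measure.
have L0 : 0 < fine (mu A).
  by rewrite fine_gt0// lt0e A0 measure_ge0/= -ge0_fin_numE.
have [|k Kk] := lno_body_scale mm L0 iA.
  by rewrite fineK// -(semivariationE mm mA) -muE//; exact: semivariation_le_vvariation.
by rewrite IA => ->; rewrite scalerA mulVf ?gt_eqF// scale1r.
Qed.

Let far (r : R) (z : X) := forall k, KT k -> r < `|k - z|.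

(** If mu(A) is positive, the average of G over A is a point of K, and every functional of the dual
    ball sees it within r of z, against [far]. *)
Let cap (r : R) A (z : X) : measurable A -> far r z ->
  (forall x, A x -> `|G x - z| <= r) -> mu A = 0%E.
Proof.
move=> mA zr Ar; apply/eqP; apply: contrapT => /negP A0.
have Afin : mu A \is a fin_num by exact: fin_num_measure.
have L0 : 0 < fine (mu A).
  by rewrite fine_gt0// lt0e A0 measure_ge0/= -ge0_fin_numE.
set c := (fine (mu A))^-1 *: m A.
have := zr _ (average_in_body mA A0); rewrite -/c ltNge => /negP; apply.
have [phi [phic phib] <-] := norming_functional (c - z).
have ic (e : R) : mu.-integrable A (EFin \o (fun=> e)).
  exact: integrableS (finite_measure_integrable_cst mu e measurableT).
rewrite linearB linearZ/= weak_mG//.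
have -> : phi z = (fine (mu A))^-1 * \int[mu]_(x in A) phi z.
  by rewrite Rintegral_cst// mulrCA mulVf ?mulr1// gt_eqF.
rewrite -[_ *: _]/(_ * _) -mulrBr -RintegralB//; last exact: phiG_integrable.
rewrite ler_pdivrMl// mulrC -Rintegral_cst//.
apply: le_Rintegral => // [|x Ax].
  exact: (integrableB mA (phiG_integrable phic mA) (ic (phi z))).
by rewrite -linearB (le_trans (ler_norm _))// (le_trans (phib _))// Ar.
Qed.

(** The values of all the [u n] form a countable set, so balls around them do the work of a
    countable covering of the complement of K. On each level set of [u n], [cap] applies. *)
Let E n j := [set x | far j.+1%:R^-1 (u n x) /\ `|G x - u n x| <= j.+1%:R^-1].

Let mEn n j : measurable (E n j).
Proof.
apply: measurableI; first exact: (fin_simple_preimage (far j.+1%:R^-1) (uG.1 n)).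
rewrite -[X in measurable X]setTI; apply: measurable_fun_le => //.
exact: measurable_norm_vlimit (vlimitB uG (uG.1 n)).
Qed.

Let muEn n j : mu (E n j) = 0%E.
Proof.
have -> : E n j = \bigcup_(z in range (u n)) (E n j `&` u n @^-1` [set z]).
  apply/seteqP; split=> [x Ex|x [z _ []]//]; exists (u n x) => //; by exists x.
have mEz z : measurable (E n j `&` u n @^-1` [set z]).
  by apply: measurableI => //; exact: (uG.1 n).2.
rewrite measure_fin_bigcup//; last 2 first.
- exact: (uG.1 n).1.
- by apply: trivIset_setIl; exact: trivIset_preimage1.
apply: fsbig1 => z _.
have [->|/set0P[x [[xf _] /= xz]]] := eqVneq (E n j `&` u n @^-1` [set z]) set0.
  exact: measure0.
apply: (@cap j.+1%:R^-1 _ z) => //; first by rewrite -xz.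
by move=> y [[_ +] /= <-].
Qed.

Let null : exists N, [/\ measurable N, mu N = 0%E & forall x, ~ N x -> KT (G x)].
Proof.
have [N [mN N0 EN]] : mu.-negligible (\bigcup_n \bigcup_j E n j).
  apply: negligible_bigcup => n.
  apply: negligible_bigcup => j.
  exists (E n j); split; [exact: mEn|exact: muEn|exact: subset_refl].
exists N; split=> // x Nx; apply: contrapT => KGx; apply: Nx; apply: EN.
have : open (~` KT) by apply: closed_openC; exact: dfjp_closed.
rewrite openE => /(_ _ KGx) /nbhs_ballP[r /= r0 rK].
(* A point of K within 1/(j+1) of [u n x] would then be within r of [G x]. *)
have [j jr] : exists j, j.+1%:R^-1 < r / 2.
  have r20 : 0 < r / 2 by rewrite divr_gt0.
  have [j _ /(_ j (leqnn j)) /=] := near_infty_natSinv_lt (PosNum r20).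
  by exists j.
have j0 : 0 < j.+1%:R^-1 :> R by rewrite invr_gt0.
have /cvgrPdist_le/(_ _ j0)[n _ /(_ n (leqnn n))/= nG] := uG.2 x.
exists n => //; exists j => //; split=> // k Kk.
rewrite ltNge; apply/negP => kj; apply: (rK k) => //.
rewrite -ball_normE/= -(subrK (u n x) (G x)) -addrA (le_lt_trans (ler_normD _ _))//.
by rewrite (splitr r) -(distrC k); apply: ltrD; [apply: le_lt_trans jr|apply: le_lt_trans jr].
Qed.

(** A nearest point of K may fail to exist, hence the slack 1/(n+1). The maps come from choice and
    are composed with simple maps only. *)
Let retraction : exists r : nat -> X -> X, forall n z,
  KT (r n z) /\ forall k, KT k -> `|z - r n z| <= `|z - k| + n.+1%:R^-1.
Proof.
have H (nz : nat * X) : exists k, KT k /\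
    forall k', KT k' -> `|nz.2 - k| <= `|nz.2 - k'| + nz.1.+1%:R^-1.
  case: nz => n z /=; pose D := [set `|z - k| | k in KT].
  have Dinf : has_inf D.
    by split; [exists `|z - 0|; exists 0|exists 0 => _ [k _ <-]].
  have n0 : 0 < n.+1%:R^-1 :> R by rewrite invr_gt0.
  have [_ [k Kk <-] kD] := inf_adherent n0 Dinf.
  exists k; split=> // k' Kk'; rewrite (le_trans (ltW kD))// lerD2r.
  by apply: ge_inf; [exact: Dinf.2|exists k'].
have [r rP] := choice H.
by exists (fun n z => r (n, z)) => n z; exact: (rP (n, z)).
Qed.

(** The lift to Y is controlled only between points of K, so the approximants have to take their
    values there along with their limit. Since [G2 x] is in K, moving [u2 n x] into K costs at most
    its distance to [G2 x] plus 1/(n+1). *)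
Lemma lno_derivative_simple_approx : exists (G2 : T -> X) (v : nat -> T -> X),
  [/\ vlimit v G2, forall n x, KT (v n x), forall x, KT (G2 x) &
      forall (phi : {linear X -> R^o}) A, continuous phi -> measurable A ->
        phi (m A) = \int[mu]_(x in A) phi (G2 x)].
Proof.
have [N [mN N0 NG]] := null; have [r rP] := retraction.
pose G2 x := if x \in N then 0 else G x.
pose u2 n x := if x \in N then 0 else u n x.
have KG2 x : KT (G2 x).
  by rewrite /G2; have [//|/negP] := boolP (x \in N); rewrite inE; exact: NG.
have u2G2 x : u2 ^~ x @ \oo --> G2 x.
  rewrite /G2 /u2; have [_|_] := boolP (x \in N); first exact: cvg_cst.
  exact: uG.2.
have su2 n : vsimple (u2 n) by exact: (fin_simple_restrict 0 (uG.1 n) mN).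
pose v n x := r n (u2 n x).
have sv n : vsimple (v n) by exact: (fin_simple_comp (r n) (su2 n)).
have vG2 x : v ^~ x @ \oo --> G2 x.
  apply/cvgrPdist_lt => e e0.
  (* Three thirds: twice the distance from [u2 n x] to [G2 x], and the slack of [retraction]. *)
  have e30 : 0 < e / 3 by rewrite divr_gt0.
  move/cvgrPdist_lt : (u2G2 x) => /(_ _ e30).
  have := near_infty_natSinv_lt (PosNum e30); apply: filterS2 => n /= n3 h.
  have := (rP n (u2 n x)).2 _ (KG2 x); rewrite -/(v n x) => vu.
  rewrite -(subrK (u2 n x) (G2 x)) -addrA (le_lt_trans (ler_normD _ _))//.
  rewrite (le_lt_trans (lerD (lexx _) vu))// distrC.
  move: h n3; rewrite (distrC (G2 x)) -[u2^~ x n]/(u2 n x).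
  by move: (`|u2 n x - G2 x|) (n.+1%:R^-1) => p q; lra.
exists G2, v; split=> //; first by move=> n x; exact: (rP _ _).1.
move=> phi A phic mA; rewrite weak_mG// /Rintegral; congr fine.
apply: ae_eq_integral => //.
- by have /integrableP[] := phiG_integrable phic mA.
- apply: measurable_funTS; apply/measurable_EFinP.
  exact: (@vlimit_comp _ _ _ _ v G2 (phi : X -> R)).
- exists N; split=> // x /= /not_implyP[_]; apply: contra_notP => Nx.
  by rewrite /G2 memNset.
Qed.

End derivative.

End lno_derivative.

Section bochner_derivative_theory.
Context d (T : measurableType d) (R : realType).
Import HBNNSimple.

Lemma simple_approximation01 (g : T -> R) : measurable_fun setT g ->
  (forall x, 0 <= g x <= 1) ->
  exists v : nat -> T -> R, [/\ forall n, fin_simple (v n),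
    forall n x, 0 <= v n x <= 1 & forall x, v ^~ x @ \oo --> g x].
Proof.
move=> mg g01; have /measurable_EFinP mEg := mg.
have g0 x : setT x -> (0 <= (EFin \o g) x)%E by rewrite /= lee_fin; case/andP: (g01 x).
exists (fun n => nnsfun_approx measurableT mEg n : T -> R); split=> [n|n x|x].
- split=> [|r]; first exact: fimfunP.
  exact: measurable_funPTI.
- apply/andP; split; first exact: fun_ge0.
  have := @le_approx _ _ _ setT _ n x g0 I; rewrite -nnsfun_approxE lee_fin => /le_trans.
  by apply; case/andP: (g01 x).
- by have /fine_cvgP[_] := cvg_nnsfun_approx measurableT mEg g0 (I : setT x).
Qed.

(** This bounds |m|(T) by the integral of |G| at the end of (iv). *)
Lemma vvariation_le_integral_norm (mu : {finite_measure set T -> \bar R})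
    (Z : completeNormedModType R) (nu : set T -> Z) (G : T -> Z) (u s : nat -> T -> Z) :
  vlimit u G -> bochner_approx mu G s ->
  (forall A, measurable A -> nu A = bochner_integral mu A G) ->
  (vvariation nu setT <= \int[mu]_x `|G x|%:E)%E.
Proof.
move=> uG sG nuG.
have mG : measurable_fun setT (fun x => (`|G x|)%:E).
  by apply/measurable_EFinP; exact: measurable_norm_vlimit uG.
have nuA A : measurable A -> (`|nu A|%:E <= \int[mu]_(x in A) `|G x|%:E)%E.
  move=> mA; have [phi [phic phib] phiA] := norming_functional (nu A).
  have [n Gn] := filter_ex (bochner_approx_lt sG ltr01).
  have iG := functional_integrable phic uG (sG.1 n) (lt_trans Gn (ltry _)).
  have iA := integrableS measurableT mA (@subsetT _ A) iG.
  have phiE : phi (nu A) = \int[mu]_(x in A) phi (G x).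
    by rewrite nuG//; exact: bochner_integralP uG sG mA phic.
  rewrite -phiA phiE; apply: (@le_trans _ _ (`|\int[mu]_(x in A) phi (G x)|)%:E).
    by rewrite lee_fin ler_norm.
  rewrite EFin_normr_Rintegral// (le_trans (le_abse_integral _ _ _))//.
    by case/integrableP: iA.
  apply: ge0_le_integral => //.
  - by apply: measurableT_comp => //; case/integrableP: iA.
  - exact: measurable_funTS.
  - by move=> x _; rewrite /= lee_fin phib.
apply: vvariation_le => n F mF tF FT; rewrite -sumEFin.
apply: (@le_trans _ _ (\sum_(i < n) \int[mu]_(x in F i) `|G x|%:E)%E).
  by apply: lee_sum => i _; exact: nuA.
have TE : \big[setU/set0]_(i < n) F i = setT.
  rewrite -FT -bigcup_seq.
  by apply: eq_bigcupl; split=> i //= _; exact: mem_index_enum.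
rewrite -ge0_integral_bigsetU ?TE//; first exact: index_enum_uniq.
exact: sub_trivIset tF.
Qed.

End bochner_derivative_theory.

Section lno_bochner_derivative.
Context d (T : measurableType d) (R : realType) (X : completeNormedModType R).
Variable m : set T -> X.
Hypothesis mm : vector_measure m.
Local Notation C := (lno_const R).
Local Notation mt := (lno_measure m).

Let mtm : vector_measure mt. Proof. exact: lno_measure_vector_measure. Qed.

Let C0 : 0 < C. Proof. exact: lt_trans (lno_const_gt1 R). Qed.

Lemma vlimit_lno_lift (v : nat -> T -> X) (G : T -> X) :
  (forall n x, dfjp_set (lno_body m) (v n x)) -> (forall x, dfjp_set (lno_body m) (G x)) -> vlimit v G ->
  vlimit (fun n => lno_lift m \o v n) (lno_lift m \o G).
Proof.
move=> Kv KG [sv vG]; split=> [n|x]; first exact: fin_simple_comp (sv n).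
apply/cvgrPdist_lt => e e0.
(* The threshold dictated by [lno_lift_dist]: the squared distance of two lifts is at most 2 C |x -
   y|. *)
have e1 : 0 < e ^+ 2 / (C * 2).
  by apply: divr_gt0; [exact: exprn_gt0|exact: (mulr_gt0 C0 (ltr0Sn R 1))].
move/cvgrPdist_lt : (vG x) => /(_ _ e1); apply: filterS => n /= h.
rewrite -(@ltr_pXn2r _ 2) ?nnegrE ?(ltW e0)//.
apply: le_lt_trans (lno_lift_dist (KG x) (Kv n x)) _.
rewrite mulrA mulrC.
by rewrite -(ltr_pdivlMr _ _ (mulr_gt0 C0 (ltr0Sn R 1))).
Qed.

(* With G viewed as Y-valued, F = g G for the density g = d|m|/d|mt| <= 1; then
   |F|^2 <= g^2 <= g, and the integral of g with respect to |mt| is |m|(T). *)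
Lemma lno_bochner_derivative (G : T -> X) : finite_variation m ->
  bochner_derivative (vvariation m) m G ->
  exists2 F : T -> lno_space m, bochner_derivative (vvariation mt) mt F &
    (\int[vvariation mt]_x (`|F x| ^+ 2)%:E <=
     C%:E * \int[vvariation m]_x `|G x|%:E)%E.
Proof.
move=> mfin mG.
have [mu muE] := finite_measure_of_vvariation mm mfin.
have mtfin : finite_variation mt by exact: lno_vvariation_lty.
have [mut mutE] := finite_measure_of_vvariation mtm mtfin.
have mumut A : measurable A -> (mu A <= mut A)%E.
  by move=> mA; rewrite -muE// -mutE//; exact: vvariation_le_lno.
have [g [mg g01 gT gE]] := density_le1 mumut.
have [G' [u [s [uG sG mG' GG]]]] := ae_vlimit (eq_bochner_derivative muE mG).
have [G2 [v [vG2 Kv KG2 mG2]]] := lno_derivative_simple_approx mm muE uG sG mG'.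
have [w [sw w01 wg]] := simple_approximation01 mg g01.
have tG := vlimit_lno_lift Kv KG2 vG2.
pose F x : lno_space m := g x *: lno_lift m (G2 x).
pose FF n x : lno_space m := w n x *: lno_lift m (v n x).
have FFF : vlimit FF F.
  split=> [n|x].
    exact: (fin_simple_comp (fun p => p.1 *: p.2) (fin_simple_pair (sw n) (tG.1 n))).
  by apply: cvgZ; [exact: wg|exact: tG.2].
have FF1 n x : `|FF n x| <= 1.
  have /andP[w0 w1] := w01 n x.
  rewrite normrZ ger0_norm// -[leRHS]mulr1; apply: ler_pM => //.
  exact: norm_lno_lift (Kv n x).
have aF := bochner_approx_bounded mut FFF FF1.
have mtF A : measurable A -> mt A = bochner_integral mut A F.
  (* J is injective and functionals separate the points of X, so testing against phi o J suffices;
     there the density g turns the integral against |mt| into one against |m|. *)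
  move=> mA; apply: lno_J_inj; apply: dual_inj => phi phic.
  rewrite lno_J_measure//.
  pose psi : {linear lno_space m -> R^o} := (phi \o lno_Jlin m : {linear lno_space m -> R^o}).
  have psic : continuous psi.
    by move=> y; apply: continuous_comp; [exact: lno_J_continuous|exact: phic].
  rewrite -[RHS]/(psi _) (bochner_integralP FFF aF mA psic) (mG2 _ _ phic mA).
  have [k k0 phik] := dual_bound phic.
  rewrite (gE A (fun x => phi (G2 x)) mA).
    apply: eq_Rintegral => x _; rewrite /F linearZ mulrC.
    by rewrite -[psi _]/(phi (lno_J (lno_lift m (G2 x)))) lno_liftK.
  apply: (integrableS measurableT) => //; apply: (@integrable_bounded _ _ _ _ _ k).
    exact: (@vlimit_comp _ _ _ _ v G2 (phi : X -> R)).
  move=> x; rewrite (le_trans (phik _))// -[leRHS]mulr1 ler_wpM2l ?(ltW k0)//.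
  exact: (@dfjp_subball _ _ (lno_body m) _ (KG2 x)).
exists F.
  apply: (@eq_bochner_derivative _ _ _ _ mut); first by move=> A mA; rewrite mutE.
  split=> //; split; last by exists FF.
  exists FF; split; first exact: FFF.1.
  exists set0; split=> // x /= xF; exfalso; apply: xF; exact: FFF.2.
rewrite (eq_integral_set_function _ _ mutE) (eq_integral_set_function _ _ muE).
apply: (@le_trans _ _ (\int[mut]_x (g x)%:E)%E).
  apply: ge0_le_integral => //.
  - apply/measurable_EFinP; apply: measurable_funX.
    exact: measurable_norm_vlimit FFF.
  - exact/measurable_EFinP.
  - move=> x _; rewrite lee_fin; have /andP[g0 g1] := g01 x.
    rewrite normrZ ger0_norm// exprMn -[leRHS]mulr1; apply: ler_pM => //.
    + exact: sqr_ge0.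
    + by rewrite expr2 ler_piMr.
    + by rewrite expr_le1//; exact: norm_lno_lift (KG2 x).
have G0 : (0 <= \int[mu]_x `|G x|%:E)%E.
  by apply: integral_ge0 => x _; rewrite lee_fin.
(* The integral of g is |m|(T), at most the integral of |G|; the factor C enters through 1 < C. *)
rewrite gT -muE//; apply: (@le_trans _ _ (\int[mu]_x `|G x|%:E)%E).
  by rewrite -GG; exact: vvariation_le_integral_norm uG sG mG'.
rewrite -[leLHS]mul1e; apply: lee_wpmul2r => //.
by rewrite lee_fin; exact: ltW (lno_const_gt1 R).
Qed.

End lno_bochner_derivative.

Theorem theorem4p5 (R : realType) :
  exists C : R, 0 < C /\
  forall (d : measure_display) (T : measurableType d)
    (X : completeNormedModType R) (m : set T -> X),
  vector_measure m -> (exists2 A, measurable A & m A != 0) ->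
  let mt : set T -> lno_space m := lno_measure m in
  (* I_m = J o T is the DFJP-LNO factorization and mt is a vector measure *)
  [/\ lno_body m = closure (integration_operator m @` L1ball m) :> set X,
      forall f : T -> R, vintegrable m f ->
        lno_J (lno_T m f) = integration_operator m f &
      vector_measure mt]
  /\
  (* (i) *)
  [/\ forall f : T -> R, vintegrable mt f <-> vintegrable m f,
      forall f : T -> R, vintegrable m f -> L1norm m f = L1norm mt f &
      forall A, measurable A -> semivariation m A = semivariation mt A]
  /\
  (* (ii) *)
  [/\ forall f : T -> R, vintegrable m f ->
        ((`|integration_operator mt f| ^+ 2)%:E <=
         C%:E * L1norm m f * `|integration_operator m f|%:E)%E &
      forall A, measurable A ->
        ((`|mt A| ^+ 2)%:E <= C%:E * semivariation m A * `|m A|%:E)%E]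
  /\
  (* (iii) *)
  [/\ forall A, measurable A ->
        (vvariation m A <= vvariation mt A <=
         (Num.sqrt C)%:E * vvariation m A)%E,
      finite_variation m -> finite_variation mt &
      sigma_finite_variation m -> sigma_finite_variation mt]
  /\
  (* (iv) *)
  (forall G : T -> X, finite_variation m ->
     bochner_derivative (vvariation m) m G ->
     exists2 F : T -> lno_space m, bochner_derivative (vvariation mt) mt F &
       (\int[vvariation mt]_x (`|F x| ^+ 2)%:E <=
        C%:E * \int[vvariation m]_x `|G x|%:E)%E).
Proof.
exists (lno_const R); split; first exact: lt_trans (lno_const_gt1 R).
move=> d T X m mm _ mt; have mtm : vector_measure mt := lno_measure_vector_measure mm.
split; [split|split; [split|split; [split|split; [split|]]]].
- exact: lno_bodyE.
- by move=> f fi; exact: lno_TK.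
- exact: mtm.
- move=> f; split; first exact: vintegrable_lno_J.
  by move=> fi; case: (lno_vintegrable mm fi).
- by move=> f fi; exact: L1norm_lno.
- move=> A mA; rewrite (semivariationE mm mA) (semivariationE mtm mA).
  exact: L1norm_lno mm _ (vintegrable_indic mm mA).1.
- move=> f fi; rewrite (lno_vintegrable mm fi).2.
  exact: lno_T_interpolation.
- by move=> A mA; exact: lno_measure_interpolation.
- move=> A mA; apply/andP; split; first exact: vvariation_le_lno.
  exact: lno_vvariation_le.
- by move=> mfin; exact: lno_vvariation_lty.
- move=> [A [mA Afin AT]]; exists A; split=> // i.
  exact: lno_vvariation_lty.
- by move=> G; exact: lno_bochner_derivative.
Qed.
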